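(* Let $\alpha$ be a real number with $0\le\alpha<1/2$. Then the equality $$\int_{-\infty}^{\infty}\frac{\ln\bigl|\zeta(1/2+\alpha+it)\,(-1/2+\alpha+it)\bigr|}{(1/2-\alpha)^2+t^2}\,dt=0$$ holds if and only if the Riemann zeta function $\zeta$ has no zeros $\sigma+it$ with $\sigma>1/2+\alpha$. In particular, for $\alpha=0$ this equality is equivalent to the Riemann hypothesis.
   Context: $\zeta$ denotes the Riemann zeta function. The Riemann hypothesis is the statement that $\zeta$ has no zeros with real part $>1/2$ (all non-trivial zeros lie on the line $\operatorname{Re} s=1/2$). *)

(* Defs.v *)
From mathcomp Require Import all_boot all_order all_algebra.
From mathcomp Require Import all_classical all_reals all_analysis.
From mathcomp.real_closed Require Import complex.
Set Implicit Arguments. Unset Strict Implicit. Unset Printing Implicit Defensive.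
Import Order.TTheory GRing.Theory Num.Theory numFieldNormedType.Exports.
Local Open Scope classical_set_scope.
Local Open Scope ring_scope.

Section Zeta.
Variable R : realType.

Definition cpowr (x : R) (s : R[i]) : R[i] :=
  Complex (x `^ complex.Re s * cos (complex.Im s * ln x))
          (x `^ complex.Re s * sin (complex.Im s * ln x)).

Definition zeta_approx (s : R[i]) (N : nat) : R[i] :=
  \sum_(0 <= n < N) cpowr (n.+1)%:R (- s) - cpowr N%:R (1 - s) / (1 - s).

(* Riemann zeta on the half-plane Re s > 0, s <> 1:
   zeta s = lim_{N -> oo} (sum_{n<=N} n^{-s} - N^{1-s}/(1-s)),
   the limit taken separately on real and imaginary parts. *)
Definition zeta (s : R[i]) : R[i] :=
  Complex (limn (fun N : nat => complex.Re (zeta_approx s N) : R))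
          (limn (fun N : nat => complex.Im (zeta_approx s N) : R)).

Definition cmod (z : R[i]) : R := complex.Re `|z|.

End Zeta.

(* Main.v *)
(* Put F(s) = (s - 1) zeta(s) and x = 1/2 + alpha. Up to a positive factor the integral
   is the Poisson mean of ln |F| over the line Re s = x, seen from the point 1 of the
   half-plane Re s > x. Since F(1) = 1, Jensen's formula makes it the sum, over the
   zeros rho of F with Re rho > x, of the positive values G(1, rho) of the Green function.
   For rational functions Jensen's formula is an explicit integral for each linear
   factor. F itself is a limit of rational functions r_N without poles in Re s >= 0,
   the error on Re s >= 1/4 being delta_N |s + 2|^3 with delta_N -> 0: cut the defining
   sequence of zeta at N and replace n^(-s) by (1 + s ln n / k)^(-k). The mean of
   ln |F| is the limit, as e -> 0, of the mean of ln max(|F|, e), and ln max(|w|, e) is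
   the average of ln |w - z| over the circle |z| = e, so the rational Jensen formula
   applies to r_N - z. A zero rho of F is retained by using r_N - r_N(rho) instead.
   If F has no zero in Re s > x, the zeros of r_N - z are close to the line or far away,
   and Jensen's formula with respect to the line Re s = 1/4, respectively to a remote
   pole, shows that their total weight is small. *)
Require Import Defs.
From mathcomp Require Import all_boot all_order all_algebra.
From mathcomp Require Import all_classical all_reals all_analysis.
From mathcomp.real_closed Require Import complex.
From mathcomp Require Import ring lra measurable_realfun.
Import Order.TTheory GRing.Theory Num.Theory numFieldNormedType.Exports.
Local Open Scope classical_set_scope.
Local Open Scope ring_scope.
Set Implicit Arguments. Unset Strict Implicit. Unset Printing Implicit Defensive.
(** * Improper integrals by antiderivatives *)

(** The only complex analysis used is the factorisation of polynomials: holomorphy of F never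
    enters, and every fact about F is a limit of facts about rational functions. The obstacle is
    that ln |r_N| has no lower bound uniform in N near zeros on or close to the line, so its means
    cannot be passed to the limit directly. Truncation at the level e restores dominated
    convergence. The lower bound given by Jensen's formula does not depend on e, so monotone
    convergence then removes e and yields integrability of ln |F| at the same time. When F has no
    zero in Re s > x, the order of choices is essential: first the width eta of the strip and the
    radius t, which make the error small; then e, from the minimum of |F| on a rectangle; last N.
    The line Re s = 1/4 lies left of every line in question at a fixed distance. A zero within eta
    of Re s = x therefore has a Green function of order eta for the latter line, while the one for
    Re s = 1/4 stays bounded below on bounded sets. The third power of |s + 2| comes from the factor
    s - 1 and the quadratic error of the rational exponentials. *)

Section ftc.
Context {R : realType}.
Local Notation mu := (@lebesgue_measure R).

Lemma is_derive_continuous (f : R -> R) (x d : R) :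
  is_derive x 1 f d -> {for x, continuous f}.
Proof. by move=> df; apply/differentiable_continuous/derivable1_diffP/ex_derive. Qed.

(** Split at [0]; the left half is reflected to [[0, +oo[], where [- F (- t)] is the antiderivative,
    so that the one-sided rule serves twice. *)
Lemma ge0_FTC_real (f F : R -> R) (l l' : R) : (forall x, 0 <= f x) -> continuous f ->
  (forall x : R, is_derive x 1 F (f x)) ->
  F x @[x --> +oo] --> l -> F x @[x --> -oo] --> l' ->
  (\int[mu]_x (f x)%:E = (l - l')%:E)%E.
Proof.
move=> f0 cf dF Fl Fl'.
have cF : continuous F.
  by move=> x; exact: is_derive_continuous (dF x).
have mf : measurable_fun [set: R] f by exact: continuous_measurable_fun.
have mposnums : measurable [set x : R | 0 <= x] by rewrite -set_itvcy.
rewrite -(setUv [set x : R | 0 <= x]) ge0_integral_setU//= ; last 4 first.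
  exact: measurableC.
  by apply/measurable_EFinP; rewrite setUv.
  by move=> x _; rewrite lee_fin.
  exact/disj_setPCl.
rewrite -set_itvcy// setCitvr.
rewrite integral_itv_bndo_bndc; last exact/measurable_EFinP/measurable_funTS.
rewrite -{2}oppr0 ge0_integration_by_substitutionNy//; last exact: continuous_subspaceT.
rewrite (@ge0_continuous_FTC2y _ f F _ l)//; last 3 first.
- exact: continuous_subspaceT.
- by apply: cvg_at_right_filter; exact: cF.
- by move=> x _; rewrite derive1E derive_val.
have dN (x : R) : is_derive x 1 (fun t : R => - F (- t)) (f (- x)).
  have h : is_derive x 1 (F \o -%R) (f (- x) * - 1).
    by apply: is_derive1_comp; exact: is_deriveNid.
  by have := is_deriveN h; rewrite mulrN1 opprK.
rewrite (@ge0_continuous_FTC2y _ (f \o -%R) (fun t : R => - F (- t)) _ (- l'))//=.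
- by rewrite oppr0 opprK -!EFinD; congr EFin; ring.
- by apply: continuous_subspaceT => x; apply: continuous_comp; [exact: opp_continuous|exact: cf].
- by apply: cvgN; move/cvgNy_compNP : Fl'.
- by apply: cvg_at_right_filter; exact: is_derive_continuous (dN 0).
- by move=> x _; rewrite derive1E derive_val.
Qed.

Lemma cvg_ninfty_compN (f : R -> R) (l : R) :
  f (- x) @[x --> +oo] --> l -> f x @[x --> -oo] --> l.
Proof. by move=> fl; apply/cvgNy_compNP. Qed.

Lemma cvg_invr_pinfty : x^-1 @[x --> +oo] --> (0 : R).
Proof.
apply/cvgrPdist_lt => e e0; near=> x.
have x0 : 0 < x by near: x; exact: nbhs_pinfty_gt.
rewrite sub0r normrN gtr0_norm ?invr_gt0// invf_plt ?posrE//.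
by near: x; apply: nbhs_pinfty_gt; rewrite realV num_real.
Unshelve. all: by end_near. Qed.

(** Under [y = t^-1] the limit at infinity becomes continuity of [g] at [0]. *)
Lemma cvg_ratio_quadratic_pinfty (a x u v : R) :
  (a + (t - u) ^+ 2) / (x + (t - v) ^+ 2) @[t --> +oo] --> (1 : R).
Proof.
pose g (y : R) := (a * y ^+ 2 + (1 - u * y) ^+ 2) / (x * y ^+ 2 + (1 - v * y) ^+ 2).
have cg : {for 0, continuous g}.
  apply: cvgM; last apply: cvgV.
  - apply: cvgD; first by apply: cvgMr; exact: exprn_continuous.
    apply: (@continuous_comp _ _ _ (fun y => 1 - u * y) (fun y => y ^+ 2)); last exact: exprn_continuous.
    by apply: cvgB; [exact: cvg_cst|exact: mulrl_continuous].
  - by rewrite expr0n/= !mulr0 subr0 add0r expr1n oner_neq0.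
  - apply: cvgD; first by apply: cvgMr; exact: exprn_continuous.
    apply: (@continuous_comp _ _ _ (fun y => 1 - v * y) (fun y => y ^+ 2)); last exact: exprn_continuous.
    by apply: cvgB; [exact: cvg_cst|exact: mulrl_continuous].
have -> : 1 = g 0 by rewrite /g expr0n/= !mulr0 subr0 !add0r expr1n divr1.
have : (g \o GRing.inv) t @[t --> +oo] --> g 0.
  exact: (cvg_comp _ _ cvg_invr_pinfty).
apply: cvg_trans; apply: near_eq_cvg; near=> t.
have t0 : t != 0 by rewrite gt_eqF//; near: t; exact: nbhs_pinfty_gt.
rewrite /g/=.
have h b w : b * t^-1 ^+ 2 + (1 - w * t^-1) ^+ 2 = (b + (t - w) ^+ 2) / t ^+ 2 by field.
by rewrite !h -mulf_div divff ?mulr1// invr_eq0 expf_neq0.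
Unshelve. all: by end_near. Qed.

Lemma cvg_ln_ratio_pinfty (a x u v : R) : 0 < a -> 0 < x ->
  ln (a + (t - u) ^+ 2) - ln (x + (t - v) ^+ 2) @[t --> +oo] --> (0 : R).
Proof.
move=> a0 x0.
have p (b w t : R) : 0 < b -> 0 < b + (t - w) ^+ 2 by move=> b0; rewrite ltr_pwDl// sqr_ge0.
have -> : (fun t => ln (a + (t - u) ^+ 2) - ln (x + (t - v) ^+ 2)) =
    @ln R \o (fun t => (a + (t - u) ^+ 2) / (x + (t - v) ^+ 2)).
  by apply/funext => t; rewrite /= ln_div ?posrE ?p.
apply: (cvg_comp _ _ (cvg_ratio_quadratic_pinfty a x u v)).
have := @continuous_ln R 1 ltr01.
by rewrite /prop_for/continuous_at ln1.
Qed.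

End ftc.
(** * The Poisson kernel of a half-plane *)

Section poisson.
Context {R : realType}.
Local Notation mu := (@lebesgue_measure R).
Implicit Types (a b u x y t : R).

(** Normalised to mass 1: harmonic measure of a vertical line, seen from a point at distance [a]. *)
Definition poisson a t : R := a / (pi * (a ^+ 2 + t ^+ 2)).

Lemma pi_neq0 : pi != 0 :> R. Proof. by rewrite gt_eqF// pi_gt0. Qed.

Lemma sqrD_gt0 a t : a != 0 -> 0 < a ^+ 2 + t ^+ 2.
Proof. by move=> a0; rewrite ltr_pwDl ?sqr_ge0// exprn_even_gt0. Qed.

Lemma poisson_gt0 a t : 0 < a -> 0 < poisson a t.
Proof.
by move=> a0; rewrite divr_gt0// mulr_gt0 ?pi_gt0// sqrD_gt0// gt_eqF.
Qed.

Lemma poisson_ge0 a t : 0 < a -> 0 <= poisson a t.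
Proof. by move=> a0; exact/ltW/poisson_gt0. Qed.

Lemma continuous_poisson a : 0 < a -> continuous (poisson a).
Proof.
move=> a0 t; apply: cvgM; first exact: cvg_cst.
apply: cvgV; first by rewrite mulf_neq0 ?gt_eqF ?pi_gt0// sqrD_gt0// gt_eqF.
by apply: cvgM; [exact: cvg_cst|apply: cvgD; [exact: cvg_cst|exact: exprn_continuous]].
Qed.

Lemma is_derive_ln_quadratic u x t : 0 < x ->
  is_derive t 1 (fun t => ln (x + (t - u) ^+ 2)) (2 * (t - u) / (x + (t - u) ^+ 2)).
Proof.
move=> x0.
have h : is_derive t 1 (fun t => x + (t - u) ^+ 2) (2 * (t - u)).
  by apply: is_derive_eq; rewrite /GRing.scale/=; ring.
have p : 0 < x + (t - u) ^+ 2 by rewrite ltr_pwDl// sqr_ge0.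
have := @is_derive1_comp R (@ln R) _ t _ _ (is_derive1_ln p) h.
by rewrite mulrC.
Qed.

Lemma is_derive_atan_affine u x t : x != 0 ->
  is_derive t 1 (fun t => atan ((t - u) / x)) (x / (x ^+ 2 + (t - u) ^+ 2)).
Proof.
move=> x0.
have h : is_derive t 1 (fun t => (t - u) / x) x^-1.
  by apply: is_derive_eq; rewrite /GRing.scale/=; ring.
have := @is_derive1_comp R (@atan R) _ t _ _ (is_derive1_atan _) h.
move=> /is_derive_eq; apply; field.
by rewrite x0 gt_eqF ?sqrD_gt0.
Qed.

Lemma cvg_atan_affine_pinfty u x : 0 < x ->
  atan ((t - u) / x) @[t --> +oo] --> (pi / 2 : R).
Proof.
move=> x0; suff h : (t - u) / x @[t --> +oo] --> +oo by have := cvg_comp _ _ h (@cvgy_atan R).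
apply/cvgryPge => A; near=> t.
rewrite ler_pdivlMr// lerBrDr.
near: t; apply: nbhs_pinfty_ge; exact: num_real.
Unshelve. all: by end_near. Qed.

Lemma cvg_atan_affine_ninfty u x : 0 < x ->
  atan ((t - u) / x) @[t --> -oo] --> (- (pi / 2) : R).
Proof.
move=> x0; apply: cvg_ninfty_compN.
have -> : (fun t => atan ((- t - u) / x)) = fun t => - atan ((t - (- u)) / x).
  by apply/funext => t /=; rewrite -atanN; congr atan; field; rewrite gt_eqF.
by apply: cvgN; exact: cvg_atan_affine_pinfty.
Qed.

Lemma cvg_ln_ratio_ninfty a x u v : 0 < a -> 0 < x ->
  ln (a + (t - u) ^+ 2) - ln (x + (t - v) ^+ 2) @[t --> -oo] --> (0 : R).
Proof.
move=> a0 x0; apply: cvg_ninfty_compN.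
have -> : (fun t => ln (a + (- t - u) ^+ 2) - ln (x + (- t - v) ^+ 2)) =
    fun t => ln (a + (t - (- u)) ^+ 2) - ln (x + (t - (- v)) ^+ 2).
  by apply/funext => t /=; congr (ln _ - ln _); ring.
exact: cvg_ln_ratio_pinfty.
Qed.

Lemma integral_poisson a : 0 < a -> (\int[mu]_t (poisson a t)%:E = 1)%E.
Proof.
move=> a0; transitivity (2^-1 - (- 2^-1) : R)%:E; last by congr EFin; field.
apply: (@ge0_FTC_real _ _ (fun t => pi^-1 * atan ((t - 0) / a))).
- by move=> t; exact/ltW/poisson_gt0.
- exact: continuous_poisson.
- move=> t; have h := is_derive_atan_affine 0 t (lt0r_neq0 a0).
  apply: is_derive_eq; rewrite /GRing.scale/= subr0 /poisson.
  by rewrite invfM mulrCA.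
- have -> : 2^-1 = pi^-1 * (pi / 2) :> R by move: pi pi_neq0 => p p0; field.
  by apply: cvgMr; exact: cvg_atan_affine_pinfty.
- have -> : - 2^-1 = pi^-1 * (- (pi / 2)) :> R by move: pi pi_neq0 => p p0; field.
  by apply: cvgMr; exact: cvg_atan_affine_ninfty.
Qed.

(** The double pole that remains when the partial fractions of [integral_poissonM_cauchy]
    degenerate. *)
Lemma integral_cauchy_sqr a : 0 < a ->
  (\int[mu]_t (a / (a ^+ 2 + t ^+ 2) ^+ 2)%:E = (pi / (2 * a ^+ 2))%:E)%E.
Proof.
move=> a0.
have n0 t : a ^+ 2 + t ^+ 2 != 0 by rewrite gt_eqF// sqrD_gt0// gt_eqF.
pose F (t : R) := (2 * a)^-1 * (t / (a ^+ 2 + t ^+ 2)) + (2 * a ^+ 2)^-1 * atan ((t - 0) / a).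
have c0 : (2 * a)^-1 * (t / (a ^+ 2 + t ^+ 2)) @[t --> +oo] --> (0 : R).
  have -> : (fun t => (2 * a)^-1 * (t / (a ^+ 2 + t ^+ 2))) =
      fun t => (2 * a)^-1 * (t^-1 * ((0 + (t - 0) ^+ 2) / (a ^+ 2 + (t - 0) ^+ 2))).
    apply/funext => t; rewrite subr0 add0r; congr (_ * _).
    by have [->|t0] := eqVneq t 0; [rewrite mul0r invr0 mul0r|field; rewrite n0 t0].
  rewrite -[X in _ --> X](_ : (2 * a)^-1 * (0 * 1) = 0); last by rewrite mul0r mulr0.
  by apply: cvgMr; apply: cvgM; [exact: cvg_invr_pinfty|exact: cvg_ratio_quadratic_pinfty].
have c0' : (2 * a)^-1 * (t / (a ^+ 2 + t ^+ 2)) @[t --> -oo] --> (0 : R).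
  apply: cvg_ninfty_compN.
  have -> : (fun t => (2 * a)^-1 * (- t / (a ^+ 2 + (- t) ^+ 2))) =
      fun t => - ((2 * a)^-1 * (t / (a ^+ 2 + t ^+ 2))).
    by apply/funext => t /=; rewrite sqrrN mulNr mulrN.
  by rewrite -[X in _ --> X]oppr0; exact: cvgN.
transitivity ((2 * a ^+ 2)^-1 * (pi / 2) - (2 * a ^+ 2)^-1 * - (pi / 2) : R)%:E; last first.
  by congr EFin; move: pi => p; field; rewrite gt_eqF.
apply: (@ge0_FTC_real _ _ F).
- by move=> t; rewrite divr_ge0 ?sqr_ge0 ?ltW.
- move=> t; apply: cvgM; first exact: cvg_cst.
  apply: cvgV; first by rewrite expf_neq0.
  apply: (@continuous_comp _ _ _ (fun t => a ^+ 2 + t ^+ 2) (fun t => t ^+ 2)); last exact: exprn_continuous.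
  by apply: cvgD; [exact: cvg_cst|exact: exprn_continuous].
- move=> t; have h := is_derive_atan_affine 0 t (lt0r_neq0 a0).
  have d : is_derive t 1 (fun t => (a ^+ 2 + t ^+ 2)^-1) (- (a ^+ 2 + t ^+ 2) ^- 2 * (2 * t)).
    have d1 : is_derive t 1 (fun t => a ^+ 2 + t ^+ 2) (2 * t).
      by apply: is_derive_eq; rewrite /GRing.scale/=; ring.
    exact: (@is_deriveV R (fun t => a ^+ 2 + t ^+ 2) t _ 1 (n0 t) d1).
  apply: is_derive_eq; rewrite /GRing.scale/= subr0.
  by field; rewrite n0 gt_eqF.
- by rewrite -[X in _ --> X]add0r; apply: cvgD => //; apply: cvgMr; exact: cvg_atan_affine_pinfty.
- by rewrite -[X in _ --> X]add0r; apply: cvgD => //; apply: cvgMr; exact: cvg_atan_affine_ninfty.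
Unshelve. all: by end_near. Qed.

(* Partial fractions; the two Lorentzians coincide exactly when [u = 0] and [x = a]. *)
Lemma integral_poissonM_cauchy a x u : 0 < a -> 0 < x ->
  (\int[mu]_t (poisson a t / (x ^+ 2 + (t - u) ^+ 2))%:E =
   ((a + x) / (x * ((a + x) ^+ 2 + u ^+ 2)))%:E)%E.
Proof.
move=> a0 x0.
have p0 : pi != 0 :> R by rewrite gt_eqF// pi_gt0.
have na t : a ^+ 2 + t ^+ 2 != 0 by rewrite gt_eqF// sqrD_gt0// gt_eqF.
have nx t : x ^+ 2 + (t - u) ^+ 2 != 0 by rewrite gt_eqF// sqrD_gt0// gt_eqF.
have [uxa|uxa] := boolP ((u == 0) && (x == a)).
  move: uxa => /andP[/eqP -> /eqP ->].
  transitivity (pi^-1%:E * \int[mu]_t (a / (a ^+ 2 + t ^+ 2) ^+ 2)%:E)%E; last first.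
    rewrite integral_cauchy_sqr// -EFinM; congr EFin; move: pi p0 => p p0; field.
    by rewrite p0 !gt_eqF// addr_gt0.
  rewrite -ge0_integralZl//.
  - apply: eq_integral => t _; rewrite -EFinM subr0; congr EFin; rewrite /poisson; move: pi p0 => p p0; field.
    by rewrite p0 na.
  - apply/measurable_EFinP; apply: continuous_measurable_fun => t; apply: cvgM; first exact: cvg_cst.
    apply: cvgV; first by rewrite expf_neq0.
    apply: (@continuous_comp _ _ _ (fun t => a ^+ 2 + t ^+ 2) (fun t => t ^+ 2)); last exact: exprn_continuous.
    by apply: cvgD; [exact: cvg_cst|exact: exprn_continuous].
  - by move=> t _; rewrite lee_fin divr_ge0 ?sqr_ge0 ?ltW.
  - by rewrite lee_fin invr_ge0 pi_ge0.
(* The resultant of the two quadratics in [t], nonzero unless they coincide; it is the common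
   denominator of the partial-fraction coefficients [al], [be], [ga]. *)
pose D := (x ^+ 2 + u ^+ 2 - a ^+ 2) ^+ 2 + (2 * u * a) ^+ 2.
have D0 : D != 0.
  apply: contraNneq uxa => D0.
  have h1 : 0 <= (x ^+ 2 + u ^+ 2 - a ^+ 2) ^+ 2 by exact: sqr_ge0.
  have h2 : 0 <= (2 * u * a) ^+ 2 by exact: sqr_ge0.
  have /eqP : (2 * u * a) ^+ 2 = 0 by move: D0 h1 h2; rewrite /D; lra.
  rewrite expf_eq0/= !mulf_eq0 (gt_eqF a0) pnatr_eq0/= orbF => /eqP u0.
  rewrite u0 eqxx/=.
  have /eqP : (x ^+ 2 + u ^+ 2 - a ^+ 2) ^+ 2 = 0 by move: D0 h1 h2; rewrite /D; lra.
  rewrite expf_eq0/= u0 expr0n/= addr0 subr_sqr mulf_eq0 (gt_eqF (addr_gt0 x0 a0)) orbF.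
  by rewrite subr_eq0.
have DE : D = ((a + x) ^+ 2 + u ^+ 2) * ((a - x) ^+ 2 + u ^+ 2) by rewrite /D; ring.
pose al := 2 * u / D.
pose be := (x ^+ 2 + u ^+ 2 - a ^+ 2) / D.
pose ga := (a ^+ 2 + u ^+ 2 - x ^+ 2) / D.
(* The two logarithms carry opposite coefficients, so their difference vanishes at both ends and
   only the arctangents contribute. *)
pose F (t : R) := a / pi * (al / 2 * (ln (a ^+ 2 + (t - 0) ^+ 2) - ln (x ^+ 2 + (t - u) ^+ 2))
   + (be / a * atan ((t - 0) / a) + ga / x * atan ((t - u) / x))).
pose l := (be / a * (pi / 2) + ga / x * (pi / 2)).
pose l' := (be / a * - (pi / 2) + ga / x * - (pi / 2)).
transitivity (a / pi * (al / 2 * 0 + l) - a / pi * (al / 2 * 0 + l'))%:E; last first.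
  congr EFin; rewrite /l /l' /be /ga; move: D0; rewrite DE mulf_eq0 negb_or => /andP[D1 D2].
  by move: pi p0 => p p0; field; rewrite D1 D2 p0 !gt_eqF.
apply: (@ge0_FTC_real R (fun t => poisson a t / (x ^+ 2 + (t - u) ^+ 2)) F
  (a / pi * (al / 2 * 0 + l)) (a / pi * (al / 2 * 0 + l'))).
- by move=> t; rewrite divr_ge0 ?addr_ge0 ?sqr_ge0// ltW// poisson_gt0.
- move=> t; apply: cvgM; first exact: continuous_poisson.
  apply: cvgV => //; apply: cvgD; first exact: cvg_cst.
  apply: (@continuous_comp _ _ _ (fun t => t - u) (fun t => t ^+ 2)); last exact: exprn_continuous.
  by apply: cvgB; [exact: cvg_id|exact: cvg_cst].
- move=> t.
  have h1 := is_derive_atan_affine 0 t (lt0r_neq0 a0).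
  have h2 := is_derive_atan_affine u t (lt0r_neq0 x0).
  have h3 := is_derive_ln_quadratic 0 t (exprn_gt0 2 a0).
  have h4 := is_derive_ln_quadratic u t (exprn_gt0 2 x0).
  apply: is_derive_eq; rewrite /GRing.scale/= subr0 /poisson /al /be /ga.
  move: D0; rewrite /D => D0.
  move: pi p0 => p p0; field.
  by rewrite D0 na nx p0 !gt_eqF.
- apply: cvgMr; apply: cvgD; first by apply: cvgMr; apply: cvg_ln_ratio_pinfty; exact: exprn_gt0.
  by apply: cvgD; apply: cvgMr; exact: cvg_atan_affine_pinfty.
- apply: cvgMr; apply: cvgD; first by apply: cvgMr; apply: cvg_ln_ratio_ninfty; exact: exprn_gt0.
  by apply: cvgD; apply: cvgMr; exact: cvg_atan_affine_ninfty.
Qed.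

(** Inversion jumps at [0], so continuity does not apply; it is written with the measurable real
    power, and both expressions vanish at [0]. *)
Lemma measurable_invr : measurable_fun [set: R] (@GRing.inv R).
Proof.
have -> : @GRing.inv R = fun x => x * (x ^+ 2) `^ (- 1).
  apply/funext => x; have [->|x0] := eqVneq x 0; first by rewrite invr0 mul0r.
  by rewrite powR_inv1 ?sqr_ge0// expr2 invfM mulrA divff// mul1r.
apply: measurable_funM => //.
apply: (@measurableT_comp _ _ _ _ _ _ (fun x => x `^ (- 1))); first exact: measurable_powR.
exact: exprn_measurable.
Qed.

Lemma measurable_funV d (T : measurableType d) (f : T -> R) :
  measurable_fun setT f -> measurable_fun setT (fun w => (f w)^-1).
Proof. by move=> mf; exact: measurableT_comp measurable_invr mf. Qed.

Lemma measurable_poisson a : measurable_fun setT (poisson a).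
Proof.
apply: measurable_funM => //; apply: measurable_funV; apply: measurable_funM => //.
by apply: measurable_funD => //; exact: exprn_measurable.
Qed.

Definition pint a (h : R -> R) : Prop :=
  mu.-integrable setT (fun t => (h t * poisson a t)%:E).

Definition pmean a (h : R -> R) : R := (\int[mu]_t (h t * poisson a t))%R.

Lemma ge0_pint a (h : R -> R) c : 0 < a -> measurable_fun setT h -> (forall t, 0 <= h t) ->
  (\int[mu]_t (h t * poisson a t)%:E = c%:E)%E -> pint a h /\ pmean a h = c.
Proof.
move=> a0 mh h0 hc; split; last by rewrite /pmean /Rintegral hc.
apply/integrableP; split.
  by apply/measurable_EFinP; apply: measurable_funM => //; exact: measurable_poisson.
have hp t : (0 <= (h t * poisson a t)%:E)%E by rewrite lee_fin; exact: mulr_ge0 (h0 t) (poisson_ge0 t a0).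
by under eq_integral do rewrite gee0_abs//; rewrite hc ltry.
Qed.

Lemma pint_cst a c : 0 < a -> pint a (cst c).
Proof.
move=> a0; have [h _] : pint a (cst 1) /\ pmean a (cst 1) = 1.
  apply: ge0_pint => //; rewrite -(integral_poisson a0).
  by under eq_integral do rewrite /cst mul1r.
have := integrableZl measurableT c h.
by apply: eq_integrable => // t _; rewrite -EFinM mul1r.
Qed.

Lemma pmean_cst a c : 0 < a -> pmean a (cst c) = c.
Proof.
move=> a0; rewrite /pmean RintegralZl//; last first.
  have := pint_cst 1 a0.
  by apply: eq_integrable => // t _; rewrite mul1r.
by rewrite /Rintegral integral_poisson//= mulr1.
Qed.

Lemma FTC_ocitv (f F : R -> R) y l : 0 < y -> F y - F 0 = l ->
  (forall v, 0 <= v -> {for v, continuous f}) ->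
  (forall v : R, 0 <= v -> is_derive v 1 F (f v)) ->
  (\int[mu]_(v in `]0%R, y]) (f v)%:E = l%:E)%E.
Proof.
move=> y0 <- cf dF.
have cw : {within `[0, y], continuous f}.
  apply: continuous_in_subspaceT => v; rewrite inE/= in_itv/= => /andP[v0 _].
  exact: cf.
rewrite integral_itv_obnd_cbnd; last first.
  apply/measurable_EFinP; apply: (@measurable_funS _ _ _ _ `[0, y]) => //.
    by apply: subset_itvr; rewrite bnd_simp.
  exact: subspace_continuous_measurable_fun.
rewrite (@continuous_FTC2 _ _ F)//.
- split.
  + move=> v; rewrite in_itv/= => /andP[/ltW v0 _].
    by have dv := dF v v0; exact: ex_derive.
  + apply: cvg_at_right_filter; exact: is_derive_continuous (dF _ _).
  + apply: cvg_at_left_filter; exact: is_derive_continuous (dF _ (ltW y0)).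
- move=> v; rewrite in_itv/= => /andP[/ltW v0 _].
  by have dv := dF v v0; rewrite derive1E derive_val.
Qed.

(** Spreads the logarithm over scales [v]. Each layer is nonnegative and rational in [s], so that
    its Poisson mean is known and Tonelli applies. *)
Lemma integral_ln_layer (s y : R) : 0 < y ->
  (\int[mu]_(v in `]0%R, y]) (s ^+ 2 * v / (1 + (s * v) ^+ 2))%:E =
   (ln (1 + (s * y) ^+ 2) / 2)%:E)%E.
Proof.
move=> y0.
have n0 v : 0 < 1 + (s * v) ^+ 2 by rewrite ltr_pwDl// sqr_ge0.
apply: (@FTC_ocitv _ (fun v : R => ln (1 + (s * v) ^+ 2) / 2)) => //.
- by rewrite mulr0 expr0n/= addr0 ln1 mul0r subr0.
- move=> v _; apply: cvgM; first exact: mulrl_continuous.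
  apply: cvgV; first by rewrite gt_eqF.
  apply: cvgD; first exact: cvg_cst.
  apply: (@continuous_comp _ _ _ (fun v => s * v) (fun v => v ^+ 2)); last exact: exprn_continuous.
  exact: mulrl_continuous.
- move=> v _; have h : is_derive v 1 (fun v : R => 1 + (s * v) ^+ 2) (2 * s ^+ 2 * v).
    by apply: is_derive_eq; rewrite /GRing.scale/=; ring.
  have h2 := @is_derive1_comp R (@ln R) _ v _ _ (is_derive1_ln (n0 v)) h.
  apply: is_derive_eq; rewrite /GRing.scale/=; field.
  by rewrite gt_eqF.
Qed.

Lemma integral_pmean a (h : R -> R) : pint a h ->
  (\int[mu]_t (h t * poisson a t)%:E = (pmean a h)%:E)%E.
Proof. by move=> ih; rewrite /pmean /Rintegral fineK//; exact: integrable_fin_num. Qed.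

Lemma eq_pint a (f g : R -> R) : f =1 g -> pint a f -> pint a g.
Proof. by move=> /funext ->. Qed.

Lemma pintD a (f g : R -> R) : pint a f -> pint a g -> pint a (fun t => f t + g t).
Proof.
move=> hf hg; have := integrableD measurableT hf hg.
by apply: eq_integrable => // t _; rewrite /= -EFinD mulrDl.
Qed.

Lemma pintZ a c (f : R -> R) : pint a f -> pint a (fun t => c * f t).
Proof.
move=> hf; have := integrableZl measurableT c hf.
by apply: eq_integrable => // t _; rewrite -EFinM mulrA.
Qed.

Lemma pintB a (f g : R -> R) : pint a f -> pint a g -> pint a (fun t => f t - g t).
Proof.
move=> hf hg; apply: (@eq_pint _ (fun t => f t + (-1) * g t)).
  by move=> t; rewrite mulN1r.
exact/pintD/pintZ.
Qed.

Lemma pmeanD a (f g : R -> R) : pint a f -> pint a g ->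
  pmean a (fun t => f t + g t) = pmean a f + pmean a g.
Proof.
move=> hf hg; rewrite /pmean -RintegralD//.
by apply: eq_Rintegral => t _; rewrite mulrDl.
Qed.

Lemma pmeanZ a c (f : R -> R) : pint a f -> pmean a (fun t => c * f t) = c * pmean a f.
Proof.
move=> hf; rewrite /pmean -RintegralZl//.
by apply: eq_Rintegral => t _; rewrite mulrA.
Qed.

Lemma pmeanB a (f g : R -> R) : pint a f -> pint a g ->
  pmean a (fun t => f t - g t) = pmean a f - pmean a g.
Proof.
move=> hf hg; rewrite -mulN1r -pmeanZ// -pmeanD//; last exact: pintZ.
by congr pmean; apply/funext => t; rewrite mulN1r.
Qed.

Lemma le_pmean a (f g : R -> R) : 0 < a -> pint a f -> pint a g ->
  (forall t, f t <= g t) -> pmean a f <= pmean a g.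
Proof.
move=> a0 hf hg fg; apply: le_Rintegral => // t _.
by rewrite ler_wpM2r// poisson_ge0.
Qed.

Lemma pint_le a (f g : R -> R) : 0 < a -> measurable_fun setT f -> pint a g ->
  (forall t, `|f t| <= g t) -> pint a f.
Proof.
move=> a0 mf hg fg; apply: le_integrable hg => //.
  by apply/measurable_EFinP; apply: measurable_funM => //; exact: measurable_poisson.
move=> t _; rewrite lee_fin !normrM ler_wpM2r//.
exact: le_trans (fg t) (ler_norm _).
Qed.

(** With [x = v^-1] the layer is the constant [x] minus [x ^+ 3] times a Lorentzian, which
    [integral_poissonM_cauchy] integrates. *)
Lemma integral_poisson_layer a u (v : R) : 0 < a -> 0 < v ->
  (\int[mu]_t ((t - u) ^+ 2 * v / (1 + ((t - u) * v) ^+ 2) * poisson a t)%:E =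
   (((1 + a * v) * a + u ^+ 2 * v) / ((1 + a * v) ^+ 2 + (u * v) ^+ 2))%:E)%E.
Proof.
move=> a0 v0; pose x := v^-1; have x0 : 0 < x by rewrite invr_gt0.
have nx t : x ^+ 2 + (t - u) ^+ 2 != 0 by rewrite gt_eqF// sqrD_gt0// gt_eqF.
have mg : measurable_fun setT (fun t => (x ^+ 2 + (t - u) ^+ 2)^-1).
  apply: measurable_funV; apply: measurable_funD => //; apply: measurable_funX.
  exact: measurable_funB.
have [ig mgE] : pint a (fun t => (x ^+ 2 + (t - u) ^+ 2)^-1) /\
    pmean a (fun t => (x ^+ 2 + (t - u) ^+ 2)^-1) = (a + x) / (x * ((a + x) ^+ 2 + u ^+ 2)).
  apply: ge0_pint => //.
    by move=> t; rewrite invr_ge0 addr_ge0 ?sqr_ge0.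
  rewrite -(integral_poissonM_cauchy u a0 x0).
  by apply: eq_integral => t _; rewrite mulrC.
have ic := pint_cst x a0.
have iz := pintZ (x ^+ 3) ig.
under eq_integral => t _.
  rewrite (_ : (t - u) ^+ 2 * v / (1 + ((t - u) * v) ^+ 2) = cst x t - x ^+ 3 * (x ^+ 2 + (t - u) ^+ 2)^-1); last first.
    rewrite /x /cst; field; rewrite (gt_eqF v0)/=.
    by rewrite gt_eqF// ltr_pwDl// sqr_ge0.
  over.
rewrite integral_pmean; last exact: pintB.
rewrite pmeanB// pmeanZ// pmean_cst// mgE; congr EFin.
rewrite /x; field.
have p0 : 0 < 1 + a * v by rewrite addr_gt0// mulr_gt0.
by rewrite !gt_eqF//= ?sqrD_gt0// ?gt_eqF//.
Qed.

(** Integrates the Poisson means of the layers back over the scale; the result is again a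
    logarithm. *)
Lemma ln_layer_measure a u y : 0 < a -> 0 < y ->
  (\int[mu]_(v in `]0%R, y])
     (((1 + a * v) * a + u ^+ 2 * v) / ((1 + a * v) ^+ 2 + (u * v) ^+ 2))%:E =
   (ln ((1 + a * y) ^+ 2 + (u * y) ^+ 2) / 2)%:E)%E.
Proof.
move=> a0 y0.
have n0 v : 0 <= v -> 0 < (1 + a * v) ^+ 2 + (u * v) ^+ 2.
  by move=> v0; rewrite sqrD_gt0// gt_eqF// ltr_pwDl// mulr_ge0// ltW.
apply: (@FTC_ocitv _ (fun v : R => ln ((1 + a * v) ^+ 2 + (u * v) ^+ 2) / 2)) => //.
- by rewrite !mulr0 addr0 expr1n expr0n/= addr0 ln1 mul0r subr0.
- have csq w b : continuous (fun v : R => (b + w * v) ^+ 2).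
    move=> v; apply: (@continuous_comp _ _ _ (fun v => b + w * v) (fun v => v ^+ 2)); last exact: exprn_continuous.
    by apply: cvgD; [exact: cvg_cst|exact: mulrl_continuous].
  move=> v v0; apply: cvgM.
    apply: cvgD; last exact: mulrl_continuous.
    by apply: cvgMl; apply: cvgD; [exact: cvg_cst|exact: mulrl_continuous].
  apply: cvgV; first by rewrite gt_eqF// n0.
  apply: cvgD; first exact: csq.
  apply: (@continuous_comp _ _ _ (fun v => u * v) (fun v => v ^+ 2)); last exact: exprn_continuous.
  exact: mulrl_continuous.
- move=> v v0.
  have h : is_derive v 1 (fun v : R => (1 + a * v) ^+ 2 + (u * v) ^+ 2)
      (2 * (1 + a * v) * a + 2 * u ^+ 2 * v).
    by apply: is_derive_eq; rewrite /GRing.scale/=; ring.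
  have h2 := @is_derive1_comp R (@ln R) _ v _ _ (is_derive1_ln (n0 _ v0)) h.
  apply: is_derive_eq; rewrite /GRing.scale/=; field.
  by rewrite gt_eqF// n0.
Qed.

(** Tonelli on the layers. The value is the logarithm continued harmonically from the line to the
    point at distance [a]. *)
Lemma pmean_ln_sqr a u y : 0 < a -> 0 < y ->
  pint a (fun t => ln (1 + ((t - u) * y) ^+ 2) / 2) /\
  pmean a (fun t => ln (1 + ((t - u) * y) ^+ 2) / 2) = ln ((1 + a * y) ^+ 2 + (u * y) ^+ 2) / 2.
Proof.
move=> a0 y0.
have n1 s : 1 <= 1 + s ^+ 2 :> R by rewrite lerDl sqr_ge0.
have mh : measurable_fun setT (fun t => ln (1 + ((t - u) * y) ^+ 2) / 2).
  apply: measurable_funM => //; apply: measurableT_comp; first exact: measurable_ln.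
  apply: measurable_funD => //; apply: measurable_funX; apply: measurable_funM => //.
  exact: measurable_funB.
apply: ge0_pint => //; first by move=> t; rewrite divr_ge0// ln_ge0.
pose k (z : R * R) : R := (z.1 - u) ^+ 2 * z.2 / (1 + ((z.1 - u) * z.2) ^+ 2) * poisson a z.1.
pose f (z : R * R) : \bar R := (k z * \1_(`]0%R, y]) z.2)%:E.
have mf : measurable_fun setT f.
  have m1 : measurable_fun setT (fun z : R * R => z.1 - u) by exact: measurable_funB.
  apply/measurable_EFinP; apply: measurable_funM; last first.
    have m2 : measurable_fun setT (\1_(`]0%R, y]) : R -> R) by exact: measurable_indic.
    exact: measurableT_comp m2 measurable_snd.
  apply: measurable_funM; last exact: measurableT_comp (measurable_poisson a) measurable_fst.
  apply: measurable_funM; first by apply: measurable_funM => //; exact: measurable_funX.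
  apply: measurable_funV; apply: measurable_funD => //.
  by apply: measurable_funX; exact: measurable_funM.
have f0 z : (0 <= f z)%E.
  rewrite lee_fin /k indicE; case: (boolP (_ \in _)); rewrite ?mulr0// inE/= in_itv/= => /andP[z0 _].
  rewrite mulr1 mulr_ge0 ?poisson_ge0// divr_ge0//; first by rewrite mulr_ge0 ?sqr_ge0// ltW.
  by rewrite addr_ge0 ?sqr_ge0.
rewrite -(ln_layer_measure u a0 y0) [RHS]integral_mkcond.
transitivity (\int[mu]_t \int[mu]_v f (t, v))%E.
  apply: eq_integral => t _; rewrite EFinM -integral_ln_layer// muleC.
  rewrite integral_mkcond -ge0_integralZl//.
  - apply: eq_integral => v _; rewrite /f /k/= restrict_EFin patch_indic/= -EFinM; congr EFin.
    by rewrite mulrC mulrAC.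
  - rewrite restrict_EFin; apply/measurable_EFinP.
    rewrite patch_indic; apply: measurable_funM; last exact: measurable_indic.
    apply: measurable_funM; first exact: measurable_funM.
    by apply: measurable_funV; apply: measurable_funD => //; apply: measurable_funX; exact: measurable_funM.
  - move=> v _; rewrite /patch; case: ifPn => //; rewrite inE/= in_itv/= => /andP[v0 _].
    by rewrite lee_fin divr_ge0 ?addr_ge0 ?sqr_ge0// mulr_ge0 ?sqr_ge0 ?ltW.
  - by rewrite lee_fin poisson_ge0.
rewrite fubini_tonelli//; apply: eq_integral => v _.
rewrite /patch; case: ifPn => [|vy].
  move=> vD; move: (vD); rewrite inE/= in_itv/= => /andP[v0 _].
  rewrite -integral_poisson_layer//; apply: eq_integral => t _.
  by rewrite /f indicE vD mulr1.
by apply: integral0_eq => t _; rewrite /f indicE (negbTE vy) mulr0.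
Qed.

Lemma pint_measurable a (h : R -> R) : 0 < a -> pint a h -> measurable_fun setT h.
Proof.
move=> a0 /integrableP[/measurable_EFinP mh _].
have -> : h = fun t => h t * poisson a t * (poisson a t)^-1.
  by apply/funext => t; rewrite mulfK// gt_eqF// poisson_gt0.
by apply: measurable_funM => //; apply: measurable_funV; exact: measurable_poisson.
Qed.

(* Junk values of [f] are allowed where [h] diverges to [-oo]: that set is null. *)
Lemma pmean_decreasing_limit a (h : nat -> R -> R) (f : R -> R) c : 0 < a ->
  (forall n, pint a (h n)) -> measurable_fun setT f ->
  (forall n t, h n.+1 t <= h n t) -> (forall n, c <= pmean a (h n)) ->
  (forall t, (h n t @[n --> \oo] --> f t) \/ (h n t @[n --> \oo] --> -oo)) ->
  pint a f /\ (pmean a (h n) @[n --> \oo] --> pmean a f).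
Proof.
move=> a0 ih mf dh hc hf.
have hle t : {homo h^~ t : n m / (n <= m)%N >-> m <= n}.
  by apply: homo_leq => // y x z xy yz; exact: le_trans yz xy.
pose g n t := ((h 0%N t - h n t) * poisson a t)%:E.
have gint n : mu.-integrable setT (g n) by exact: pintB (ih 0%N) (ih n).
have gE n : (\int[mu]_t g n t = (pmean a (h 0%N) - pmean a (h n))%:E)%E.
  by rewrite /g integral_pmean ?pmeanB//; exact: pintB.
have g0 n t : (0 <= g n t)%E.
  by rewrite lee_fin mulr_ge0 ?poisson_ge0// subr_ge0 hle.
have gnd t : {homo g^~ t : n m / (n <= m)%N >-> (n <= m)%E}.
  by move=> n m nm; rewrite lee_fin ler_wpM2r ?poisson_ge0// lerD2l lerN2 hle.
pose G t := limn (g^~ t).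
have gG t : g n t @[n --> \oo] --> G t.
  exact: ereal_nondecreasing_is_cvgn (gnd t).
have mg n : measurable_fun setT (g n) by case/integrableP: (gint n).
have mG : measurable_fun setT G by apply: (emeasurable_fun_cvg g) => //.
have G0 t : (0 <= G t)%E.
  by apply: lime_ge; [apply/cvg_ex; exists (G t); exact: gG|near=> n].
have cvI := @cvg_monotone_convergence _ _ _ mu setT measurableT g mg (fun n t _ => g0 n t) (fun t _ => gnd t).
have IGle : (\int[mu]_t G t <= (pmean a (h 0%N) - c)%:E)%E.
  rewrite -(cvg_lim _ cvI)//; apply: lime_le.
    by apply/cvg_ex; eexists; exact: cvI.
  by near=> n; rewrite gE lee_fin lerD2l lerN2.
have IG0 : (0 <= \int[mu]_t G t)%E by apply: integral_ge0.
have Gint : mu.-integrable setT G.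
  apply/integrableP; split=> //; under eq_integral do rewrite gee0_abs//.
  exact: le_lt_trans IGle (ltry _).
pose e t := ((h 0%N t - f t) * poisson a t)%:E.
have me : measurable_fun setT e.
  apply/measurable_EFinP; apply: measurable_funM; last exact: measurable_poisson.
  apply: measurable_funB => //.
  exact: pint_measurable a0 (ih 0%N).
(* The lower bound [c] makes [G] integrable, hence finite almost everywhere, whereas divergence of
   [h n t] to [-oo] would give [G t = +oo]. *)
have Ge : ae_eq mu setT G e.
  have := integrable_ae measurableT Gint; apply: filterS => t /(_ I) Gt _.
  have [ht|ht] := hf t.
    apply: cvg_unique (gG t) _ => //.
    apply/fine_cvgP; split; first by near=> n.
    by apply: cvgMl; apply: cvgB => //; exact: cvg_cst.
  exfalso; suff : G t = +oo%E by move=> Goo; rewrite Goo in Gt.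
  apply: cvg_unique (gG t) _ => //; apply/cvgeryP.
  move/cvgrNyPle : ht => ht; apply/cvgryPge => A; near=> n.
  rewrite -ler_pdivrMr ?poisson_gt0// lerBrDr -lerBrDl.
  by near: n; exact: ht.
have eint : mu.-integrable setT e.
  apply/integrableP; split=> //.
  rewrite (@ge0_ae_eq_integral _ _ _ mu setT _ (fun t => `|G t|%E))//; last 3 first.
    exact: measurableT_comp.
    exact: measurableT_comp.
    by move: Ge; apply: filterS => t + _ => /(_ I) ->.
  by case/integrableP: Gint.
have IGe : (\int[mu]_t G t = \int[mu]_t e t)%E by apply: ae_eq_integral.
have fint : pint a f.
  apply: (@eq_pint _ (fun t => h 0%N t - (h 0%N t - f t))); first by move=> t; ring.
  exact: pintB.
split=> //.
have -> : pmean a f = pmean a (h 0%N) - fine (\int[mu]_t G t)%E.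
  by rewrite IGe /e integral_pmean; [rewrite pmeanB//=; ring|exact: pintB].
have -> : (fun n => pmean a (h n)) = fun n => pmean a (h 0%N) - fine (\int[mu]_t g n t)%E.
  by apply/funext => n; rewrite gE/=; ring.
apply: cvgB; first exact: cvg_cst.
apply: fine_cvg; rewrite fineK//.
by rewrite ge0_fin_numE//; exact: le_lt_trans IGle (ltry _).
Unshelve. all: by end_near. Qed.

Lemma ln_sqr_half x : 0 < x -> ln (x ^+ 2) / 2 = ln x.
Proof. by move=> x0; rewrite lnXn// mulr2n; field. Qed.

Lemma cvg_harmonic_sqr (c : R) : (n.+1%:R^-1 : R) ^+ 2 + c @[n --> \oo] --> c.
Proof.
rewrite -[X in _ --> X](_ : (0 : R) ^+ 2 + c = c); last by rewrite expr0n add0r.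
apply: cvgD; last exact: cvg_cst.
by apply: (@cvg_comp _ _ _ _ (fun z : R => z ^+ 2) _ _ _ (@cvg_harmonic R)); exact: exprn_continuous.
Qed.

Lemma pmean_ln_quadratic_gt0 a b u : 0 < a -> 0 < b ->
  pint a (fun t => ln (b ^+ 2 + (t - u) ^+ 2) / 2) /\
  pmean a (fun t => ln (b ^+ 2 + (t - u) ^+ 2) / 2) = ln ((a + b) ^+ 2 + u ^+ 2) / 2.
Proof.
move=> a0 b0; have b0' : 0 < b^-1 by rewrite invr_gt0.
have [hi hm] := pmean_ln_sqr u a0 b0'.
have E : (fun t => ln (b ^+ 2 + (t - u) ^+ 2) / 2) =
    fun t => cst (ln b) t + ln (1 + ((t - u) * b^-1) ^+ 2) / 2.
  apply/funext => t; rewrite (_ : b ^+ 2 + _ = b ^+ 2 * (1 + ((t - u) * b^-1) ^+ 2)); last first.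
    by field; rewrite gt_eqF.
  rewrite lnM ?posrE ?exprn_gt0 ?ltr_pwDl ?sqr_ge0// lnXn// -mulr_natl /cst.
  by field.
rewrite E; split; first exact: pintD (pint_cst _ a0) hi.
rewrite pmeanD ?pmean_cst//; last exact: pint_cst.
rewrite hm (_ : (a + b) ^+ 2 + u ^+ 2 = b ^+ 2 * ((1 + a * b^-1) ^+ 2 + (u * b^-1) ^+ 2)); last first.
  by field; rewrite gt_eqF.
have q : 0 < (1 + a / b) ^+ 2 + (u / b) ^+ 2.
  by rewrite sqrD_gt0// gt_eqF// ltr_pwDl// divr_ge0// ltW.
by rewrite lnM ?posrE ?exprn_gt0// lnXn// -mulr_natl; field.
Qed.

(** The new case [b = 0] has its singularity on the line; it follows by letting [b] decrease to [0]
    along [n.+1%:R^-1]. *)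
Lemma pmean_ln_quadratic a b u : 0 < a -> 0 <= b ->
  pint a (fun t => ln (b ^+ 2 + (t - u) ^+ 2) / 2) /\
  pmean a (fun t => ln (b ^+ 2 + (t - u) ^+ 2) / 2) = ln ((a + b) ^+ 2 + u ^+ 2) / 2.
Proof.
move=> a0; rewrite le_eqVlt => /predU1P[<-|b0]; last exact: pmean_ln_quadratic_gt0.
rewrite expr0n/= addr0.
pose h n t : R := ln ((n.+1%:R^-1) ^+ 2 + (t - u) ^+ 2) / 2.
have n0 n : 0 < (n.+1%:R^-1 : R) by rewrite invr_gt0.
have hP n := pmean_ln_quadratic_gt0 u a0 (n0 n).
have hle (x y : R) : 0 < x -> x <= y -> ln x <= ln y by move=> x0 xy; rewrite ler_ln// posrE ?(lt_le_trans x0).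
have hcv : pmean a (h n) @[n --> \oo] --> ln (a ^+ 2 + u ^+ 2) / 2.
  under eq_fun do rewrite (hP _).2.
  apply: cvgMl.
  suff : (a + n.+1%:R^-1) ^+ 2 + u ^+ 2 @[n --> \oo] --> a ^+ 2 + u ^+ 2.
    move=> c; apply: (cvg_comp _ _ c); apply: continuous_ln.
    by rewrite sqrD_gt0// gt_eqF.
  apply: cvgD; last exact: cvg_cst.
  have c1 : a + n.+1%:R^-1 @[n --> \oo] --> a.
    by rewrite -[X in _ --> X]addr0; apply: cvgD; [exact: cvg_cst|exact: cvg_harmonic].
  by apply: (@cvg_comp _ _ _ _ (fun z : R => z ^+ 2) _ _ _ c1); exact: exprn_continuous.
have [|||||hi hc] := @pmean_decreasing_limit a h (fun t => ln (0 + (t - u) ^+ 2) / 2) (ln (a ^+ 2 + u ^+ 2) / 2) a0.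
- by move=> n; exact: (hP n).1.
- apply: measurable_funM => //; apply: measurableT_comp; first exact: measurable_ln.
  by apply: measurable_funD => //; apply: measurable_funX; exact: measurable_funB.
- move=> n t; rewrite ler_pM2r// hle ?sqrD_gt0 ?gt_eqF// lerD2r.
  by rewrite ler_pXn2r ?nnegrE ?invr_ge0// lef_pV2 ?posrE// ler_nat.
- move=> n; rewrite (hP n).2 ler_pM2r// hle ?sqrD_gt0 ?gt_eqF// lerD2r.
  by have := n0 n; move: (n.+1%:R^-1) => e e0; rewrite ler_pXn2r ?nnegrE ?addr_ge0 ?lerDl ?(ltW a0) ?(ltW e0).
- move=> t; have [->|tu] := eqVneq t u; [right|left].
    apply/cvgrNyPle => A; near=> n.
    rewrite /h subrr expr0n/= addr0 ln_sqr_half// lnV ?posrE// lerNl.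
    rewrite -[leLHS]expRK hle ?expR_gt0//; apply: (@le_trans _ _ n%:R); last by rewrite ler_nat.
    near: n; exact: nbhs_infty_ger.
  apply: cvgMl.
  have tu2 : 0 < (t - u) ^+ 2 by rewrite exprn_even_gt0//= subr_eq0.
  rewrite (add0r ((t - u) ^+ 2)).
  by have := cvg_comp _ _ (@cvg_harmonic_sqr ((t - u) ^+ 2)) (continuous_ln tu2).
move: hi hc; under eq_fun do rewrite add0r.
move=> hi hc; split=> //.
by apply: cvg_unique hc hcv.
Unshelve. all: by end_near. Qed.

Lemma aeS (P Q : R -> Prop) : (forall t, P t -> Q t) ->
  (\forall t \ae mu, P t) -> \forall t \ae mu, Q t.
Proof. exact: (@filterS _ _ (ae_filter_ringOfSetsType mu)). Qed.

Lemma pint_ae a (f g : R -> R) : 0 < a -> measurable_fun setT g -> pint a f ->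
  (\forall t \ae mu, f t = g t) -> pint a g /\ pmean a g = pmean a f.
Proof.
move=> a0 mg hf fg.
have mf := pint_measurable a0 hf.
have mw : measurable_fun setT (poisson a) by exact: measurable_poisson.
have mE (h : R -> R) : measurable_fun setT h ->
    measurable_fun setT (fun t => (h t * poisson a t)%:E).
  by move=> mh; apply/measurable_EFinP; exact: measurable_funM.
have ae_fg : ae_eq mu setT (fun t => (f t * poisson a t)%:E) (fun t => (g t * poisson a t)%:E).
  by move: fg; apply: aeS => t -> _.
split.
  apply/integrableP; split; first exact: mE.
  rewrite -(@ge0_ae_eq_integral _ _ _ mu setT (fun t => `|(f t * poisson a t)%:E|%E))//.
  - by case/integrableP: hf.
  - by apply: measurableT_comp => //; exact: mE.
  - by apply: measurableT_comp => //; exact: mE.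
  - by move: ae_fg; apply: aeS => t + _ => /(_ I) ->.
by rewrite /pmean /Rintegral; congr fine; apply: ae_eq_integral => //;
  [exact: mE|exact: mE|move: ae_fg; apply: aeS => t + _ => /(_ I) ->].
Qed.

(** Discards the finitely many heights at which a rational function vanishes on the line. *)
Lemma ae_notin_seq (s : seq R) : \forall t \ae mu, t \notin s.
Proof.
have cs : countable [set` s] by exact: finite_set_countable.
exists [set` s]; split.
- exact: countable_measurable.
- exact: countable_lebesgue_measure0.
- by move=> t /= /negP; rewrite negbK.
Qed.

(** The minimum of [f] and [g] is a version of [f] for which the inequality holds everywhere. *)
Lemma le_pmean_ae a (f g : R -> R) : 0 < a -> pint a f -> pint a g ->
  (\forall t \ae mu, f t <= g t) -> pmean a f <= pmean a g.
Proof.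
move=> a0 hf hg fg.
have mm : measurable_fun setT (fun t => Order.min (f t) (g t)).
  by apply: measurable_minr; [exact: pint_measurable a0 hf|exact: pint_measurable a0 hg].
have ae_min : \forall t \ae mu, f t = Order.min (f t) (g t).
  by move: fg; apply: aeS => t fg; rewrite min_l.
have [hm <-] := pint_ae a0 mm hf ae_min.
by apply: le_pmean => // t; rewrite ge_min lexx orbT.
Qed.

Lemma pmean_dominated a (h : nat -> R -> R) (f g : R -> R) : 0 < a ->
  (forall n, measurable_fun setT (h n)) -> measurable_fun setT f -> pint a g ->
  (forall n t, `|h n t| <= g t) -> (forall t, h n t @[n --> \oo] --> f t) ->
  pint a f /\ (pmean a (h n) @[n --> \oo] --> pmean a f).
Proof.
move=> a0 mh mf hg hle hf.
have mE (k : R -> R) : measurable_fun setT k ->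
    measurable_fun setT (fun t => (k t * poisson a t)%:E).
  by move=> mk; apply/measurable_EFinP; apply: measurable_funM => //; exact: measurable_poisson.
have [|||fi _ cv] := @dominated_convergence _ _ _ mu setT measurableT
  (fun n t => (h n t * poisson a t)%:E) (fun t => (f t * poisson a t)%:E)
  (fun t => (g t * poisson a t)%:E) (fun n => mE _ (mh n)) (mE _ mf).
- apply: aeW => t _; apply/fine_cvgP; split; first by near=> n.
  by apply: cvgMl; exact: hf.
- exact: hg.
- apply: aeW => t n _; rewrite lee_fin normrM (ger0_norm (poisson_ge0 t a0)).
  by rewrite ler_wpM2r ?poisson_ge0.
split=> //; apply: fine_cvg; rewrite -integral_pmean//.
Unshelve. all: by end_near. Qed.

End poisson.

(** * The complex modulus *)

Section complex_modulus.
Context {R : realType}.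
Implicit Types z w s : R[i].

Lemma cmodE z : cmod z = Num.sqrt (complex.Re z ^+ 2 + complex.Im z ^+ 2).
Proof. by rewrite /cmod normc_def. Qed.

Lemma cmod_normc z : (cmod z)%:C%C = `|z|.
Proof. by rewrite cmodE normc_def. Qed.

Lemma cmod_ge0 z : 0 <= cmod z. Proof. by rewrite cmodE sqrtr_ge0. Qed.

Lemma cmod_eq0 z : (cmod z == 0) = (z == 0).
Proof. by rewrite -[z == 0]normr_eq0 -cmod_normc -(inj_eq (@complexI R)). Qed.

Lemma cmod0 : cmod (0 : R[i]) = 0. Proof. by apply/eqP; rewrite cmod_eq0. Qed.

Lemma cmod_gt0 z : (0 < cmod z) = (z != 0).
Proof. by rewrite lt_neqAle cmod_ge0 andbT eq_sym cmod_eq0. Qed.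

Lemma cmodM z w : cmod (z * w) = cmod z * cmod w.
Proof. by apply: (@complexI R); rewrite rmorphM/= !cmod_normc normrM. Qed.

Lemma cmodV z : cmod z^-1 = (cmod z)^-1.
Proof. by apply: (@complexI R); rewrite fmorphV/= !cmod_normc normfV. Qed.

Lemma cmodX z n : cmod (z ^+ n) = cmod z ^+ n.
Proof. by apply: (@complexI R); rewrite rmorphXn/= !cmod_normc normrX. Qed.

Lemma cmodN z : cmod (- z) = cmod z.
Proof. by rewrite /cmod normrN. Qed.

Lemma cmodBC z w : cmod (z - w) = cmod (w - z).
Proof. by rewrite -cmodN opprB. Qed.

Lemma cmod_le_add z w : cmod (z + w) <= cmod z + cmod w.
Proof. by rewrite -lecR rmorphD/= !cmod_normc ler_normD. Qed.

Lemma cmod_le_sub z w : cmod (z - w) <= cmod z + cmod w.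
Proof. by rewrite -(cmodN w) cmod_le_add. Qed.

Lemma cmod_real (x : R) : cmod (x%:C)%C = `|x|.
Proof. by rewrite cmodE/= expr0n/= addr0 sqrtr_sqr. Qed.

Lemma cmod1 : cmod (1 : R[i]) = 1.
Proof. by rewrite -[1]/((1 : R)%:C)%C cmod_real normr1. Qed.

Lemma cmod_nat n : cmod (n%:R : R[i]) = n%:R.
Proof. by rewrite -(rmorph_nat (real_complex R)) cmod_real normr_nat. Qed.

Lemma cmod_sum I (r : seq I) (P : pred I) (F : I -> R[i]) :
  cmod (\sum_(i <- r | P i) F i) <= \sum_(i <- r | P i) cmod (F i).
Proof.
elim/big_rec2: _ => [|i y x _ le_xy]; first by rewrite cmod0.
by apply: le_trans (cmod_le_add _ _) _; rewrite lerD2l.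
Qed.

Lemma Re_le_cmod z : `|complex.Re z| <= cmod z.
Proof. by rewrite cmodE -sqrtr_sqr ler_wsqrtr// lerDl sqr_ge0. Qed.

Lemma Im_le_cmod z : `|complex.Im z| <= cmod z.
Proof. by rewrite cmodE -sqrtr_sqr ler_wsqrtr// lerDr sqr_ge0. Qed.

Lemma cmod_le_ReIm z : cmod z <= `|complex.Re z| + `|complex.Im z|.
Proof.
rewrite cmodE -[leRHS]ger0_norm ?addr_ge0// -sqrtr_sqr ler_wsqrtr// sqrrD !real_normK ?num_real//.
by rewrite lerD2r lerDl mulrn_wge0// mulr_ge0.
Qed.

Lemma sqr_cmod z : cmod z ^+ 2 = complex.Re z ^+ 2 + complex.Im z ^+ 2.
Proof. by rewrite cmodE sqr_sqrtr// addr_ge0 ?sqr_ge0. Qed.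

Lemma ln_cmod z : ln (cmod z) = ln (complex.Re z ^+ 2 + complex.Im z ^+ 2) / 2.
Proof.
rewrite -sqr_cmod; have [->|z0] := eqVneq z 0; last by rewrite ln_sqr_half// cmod_gt0.
by rewrite cmod0 expr0n/= ln0// mul0r.
Qed.

Lemma cmod_dist z w : `|cmod z - cmod w| <= cmod (z - w).
Proof.
rewrite ler_norml; apply/andP; split.
  by rewrite lerNl opprB lerBlDr cmodBC; have := cmod_le_add (w - z) z; rewrite subrK.
by rewrite lerBlDr; have := cmod_le_add (z - w) w; rewrite subrK.
Qed.

End complex_modulus.

(** * Measurability of complex-valued functions, by components *)

Section complex_measurable.
Context {d} {T : measurableType d} {R : realType}.
Implicit Types f g : T -> R[i].

Definition cmeasurable f : Prop :=
  measurable_fun setT (fun t => complex.Re (f t)) /\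
  measurable_fun setT (fun t => complex.Im (f t)).

Lemma cmeasurable_cst (z : R[i]) : cmeasurable (fun=> z).
Proof. by split; exact: measurable_cst. Qed.

Lemma cmeasurable_Complex (u v : T -> R) : measurable_fun setT u -> measurable_fun setT v ->
  cmeasurable (fun t => Complex (u t) (v t)).
Proof. by []. Qed.

Lemma cmeasurableD f g : cmeasurable f -> cmeasurable g -> cmeasurable (fun t => f t + g t).
Proof.
move=> [f1 f2] [g1 g2]; split.
  rewrite (_ : (fun _ => _) = fun t => complex.Re (f t) + complex.Re (g t)).
    exact: measurable_funD.
  by apply/funext => t; case: (f t) (g t) => [? ?] [? ?].
rewrite (_ : (fun _ => _) = fun t => complex.Im (f t) + complex.Im (g t)).
  exact: measurable_funD.
by apply/funext => t; case: (f t) (g t) => [? ?] [? ?].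
Qed.

Lemma cmeasurableM f g : cmeasurable f -> cmeasurable g -> cmeasurable (fun t => f t * g t).
Proof.
move=> [f1 f2] [g1 g2]; split.
  rewrite (_ : (fun _ => _) = fun t => complex.Re (f t) * complex.Re (g t) - complex.Im (f t) * complex.Im (g t)).
    by apply: measurable_funB; exact: measurable_funM.
  by apply/funext => t; case: (f t) (g t) => [? ?] [? ?].
rewrite (_ : (fun _ => _) = fun t => complex.Re (f t) * complex.Im (g t) + complex.Im (f t) * complex.Re (g t)).
  by apply: measurable_funD; exact: measurable_funM.
by apply/funext => t; case: (f t) (g t) => [? ?] [? ?].
Qed.

Lemma cmeasurableV f : cmeasurable f -> cmeasurable (fun t => (f t)^-1).
Proof.
move=> [f1 f2].
have m : measurable_fun setT (fun t => (complex.Re (f t) ^+ 2 + complex.Im (f t) ^+ 2)^-1).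
  by apply: measurable_funV; apply: measurable_funD; exact: measurable_funX.
split.
  rewrite (_ : (fun _ => _) = fun t => complex.Re (f t) / (complex.Re (f t) ^+ 2 + complex.Im (f t) ^+ 2)).
    exact: measurable_funM.
  by apply/funext => t; case: (f t) => ? ?.
rewrite (_ : (fun _ => _) = fun t => (-1) * (complex.Im (f t) / (complex.Re (f t) ^+ 2 + complex.Im (f t) ^+ 2))).
  by apply: measurable_funM => //; exact: measurable_funM.
by apply/funext => t; rewrite mulN1r; case: (f t) => ? ?.
Qed.

Lemma cmeasurable_horner (p : {poly R[i]}) f : cmeasurable f -> cmeasurable (fun t => p.[f t]).
Proof.
move=> mf; elim/poly_ind: p => [|p c IH].
  by under eq_fun do rewrite horner0; exact: cmeasurable_cst.
under eq_fun do rewrite hornerMXaddC.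
by apply: cmeasurableD; [exact: cmeasurableM|exact: cmeasurable_cst].
Qed.

Lemma measurable_cmod f : cmeasurable f -> measurable_fun setT (fun t => cmod (f t)).
Proof.
move=> [f1 f2]; under eq_fun do rewrite cmodE.
apply: measurableT_comp; first by apply: continuous_measurable_fun; exact: sqrt_continuous.
by apply: measurable_funD; exact: measurable_funX.
Qed.

Lemma measurable_ln_cmod f : cmeasurable f -> measurable_fun setT (fun t => ln (cmod (f t))).
Proof. by move=> mf; apply: measurableT_comp; [exact: measurable_ln|exact: measurable_cmod]. Qed.

End complex_measurable.

(** * Jensen's formula for rational functions *)

Section jensen.
Context {R : realType}.
Local Notation mu := (@lebesgue_measure R).
Implicit Types (z s : R[i]) (p q : {poly R[i]}) (x c t : R).

(* [green x c z] is the Green function of the half-plane [Re > x] with pole at the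
   real point [c], extended by [0] to the other points [z]. *)
Definition green x c z : R :=
  ln ((c - x + `|x - complex.Re z|) ^+ 2 + complex.Im z ^+ 2) / 2 - ln (cmod (Complex c 0 - z)).

Lemma cmeasurable_line x : cmeasurable (Complex x : R -> R[i]).
Proof. by split => /=. Qed.

(** On the line, only the distance of [z] from it and the height of [z] are visible. The mean is
    thus the logarithm of the distance from [c] to the copy of [z] in [Re <= x], and [green] is the
    discrepancy with the distance to [z] itself. *)
Lemma pmean_ln_linear x c z : x < c ->
  pint (c - x) (fun t => ln (cmod (Complex x t - z))) /\
  pmean (c - x) (fun t => ln (cmod (Complex x t - z))) = ln (cmod (Complex c 0 - z)) + green x c z.
Proof.
move=> xc; rewrite /green [X in _ = X]addrC subrK.
have := @pmean_ln_quadratic R (c - x) `|x - complex.Re z| (complex.Im z).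
rewrite real_normK ?num_real// subr_gt0 => /(_ xc (normr_ge0 _)).
have -> : (fun t => ln ((x - complex.Re z) ^+ 2 + (t - complex.Im z) ^+ 2) / 2) =
    fun t => ln (cmod (Complex x t - z)).
  by apply/funext => t; rewrite ln_cmod; case: z.
by [].
Qed.

Lemma ln_cmod_prod (rs : seq R[i]) s : s \notin rs ->
  ln (cmod (\prod_(z <- rs) (s - z))) = \sum_(z <- rs) ln (cmod (s - z)).
Proof.
elim: rs => [|z rs IH]; first by rewrite !big_nil cmod1 ln1.
rewrite inE negb_or => /andP[sz srs]; rewrite !big_cons cmodM lnM ?IH ?posrE// cmod_gt0 ?subr_eq0//.
by rewrite prodf_seq_neq0; apply/allP => w wrs; rewrite subr_eq0; apply: contraNneq srs => ->.
Qed.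

Lemma pmean_ln_prod x c (rs : seq R[i]) : x < c ->
  pint (c - x) (fun t => \sum_(z <- rs) ln (cmod (Complex x t - z))) /\
  pmean (c - x) (fun t => \sum_(z <- rs) ln (cmod (Complex x t - z))) =
    \sum_(z <- rs) (ln (cmod (Complex c 0 - z)) + green x c z).
Proof.
move=> xc; have a0 : 0 < c - x by rewrite subr_gt0.
elim: rs => [|z rs [IH1 IH2]].
  under eq_fun do rewrite big_nil; rewrite big_nil.
  by split; [exact: pint_cst|exact: pmean_cst].
have [h1 h2] := pmean_ln_linear z xc.
under eq_fun do rewrite big_cons; rewrite big_cons -IH2 -h2.
by split; [exact: pintD|exact: pmeanD].
Qed.

(** The product splits under [ln] only off the roots, because [ln 0] is a default value; the heights
    of the roots form a null set. *)
Lemma pmean_ln_poly x c p (rs : seq R[i]) : x < c ->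
  p = lead_coef p *: \prod_(z <- rs) ('X - z%:P) -> p.[Complex c 0] != 0 ->
  pint (c - x) (fun t => ln (cmod p.[Complex x t])) /\
  pmean (c - x) (fun t => ln (cmod p.[Complex x t])) =
    ln (cmod p.[Complex c 0]) + \sum_(z <- rs) green x c z.
Proof.
move=> xc pE pc0; have a0 : 0 < c - x by rewrite subr_gt0.
have hE s : p.[s] = lead_coef p * \prod_(z <- rs) (s - z).
  rewrite {1}pE hornerZ horner_prod; congr (_ * _); apply: eq_bigr => z _.
  by rewrite hornerXsubC.
have lc0 : lead_coef p != 0.
  by apply: contraNneq pc0; rewrite hE => ->; rewrite mul0r.
have pn0 s : s \notin rs -> ln (cmod p.[s]) = ln (cmod (lead_coef p)) + \sum_(z <- rs) ln (cmod (s - z)).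
  move=> srs; rewrite hE cmodM lnM ?posrE ?cmod_gt0// ?ln_cmod_prod//.
  by rewrite prodf_seq_neq0; apply/allP => w wrs; rewrite subr_eq0; apply: contraNneq srs => ->.
have crs : Complex c 0 \notin rs.
  apply: contraNN pc0 => crs; rewrite hE (big_rem _ crs)/= subrr mul0r mulr0//.
have [h1 h2] := pmean_ln_prod rs xc.
pose f t := cst (ln (cmod (lead_coef p))) t + \sum_(z <- rs) ln (cmod (Complex x t - z)).
have fi : pint (c - x) f by apply: pintD => //; exact: pint_cst.
have mg : measurable_fun setT (fun t => ln (cmod p.[Complex x t])).
  by apply: measurable_ln_cmod; apply: cmeasurable_horner; exact: cmeasurable_line.
have ae_fg : \forall t \ae mu, f t = ln (cmod p.[Complex x t]).
  move: (ae_notin_seq [seq complex.Im z | z <- rs]); apply: aeS => t trs.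
  rewrite pn0//; apply: contraNN trs => trs; apply/mapP; by exists (Complex x t).
have [? ->] := pint_ae a0 mg fi ae_fg; split=> //.
rewrite pmeanD//; last exact: pint_cst.
by rewrite pmean_cst// h2 big_split/= addrA pn0.
Qed.

Lemma green_left x c z : x < c -> complex.Re z <= x -> green x c z = 0.
Proof.
move=> xc zx; rewrite /green ger0_norm ?subr_ge0// ln_cmod.
rewrite (_ : c - x + _ = c - complex.Re z); last by ring.
by case: z zx => zr zi /= _; rewrite sub0r sqrrN subrr.
Qed.

Lemma green_right x c z : x < c -> x <= complex.Re z ->
  green x c z = ln ((c - x + (complex.Re z - x)) ^+ 2 + complex.Im z ^+ 2) / 2 -
    ln ((c - complex.Re z) ^+ 2 + complex.Im z ^+ 2) / 2.
Proof.
move=> xc zx; rewrite /green distrC ger0_norm ?subr_ge0// ln_cmod.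
by case: z zx => zr zi /= _; rewrite sub0r sqrrN.
Qed.

Lemma green_ge0 x c z : x < c -> Complex c 0 != z -> 0 <= green x c z.
Proof.
move=> xc cz; have [zx|xz] := leP (complex.Re z) x; first by rewrite green_left.
rewrite (green_right xc (ltW xz)) subr_ge0 ler_pM2r// ler_ln ?posrE.
- rewrite lerD2r -subr_ge0 [leRHS](_ : _ = 4 * ((c - x) * (complex.Re z - x))); last by ring.
  by rewrite !mulr_ge0 ?subr_ge0 ?ltW.
- rewrite lt_neqAle addr_ge0 ?sqr_ge0// andbT eq_sym paddr_eq0 ?sqr_ge0// !sqrf_eq0 subr_eq0.
  by apply: contraNN cz; case: z xz => zr zi /= _ /andP[/eqP -> /eqP ->].
- by rewrite ltr_pwDl ?sqr_ge0// exprn_gt0//; lra.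
Qed.

Definition halfplane_rational (f : R[i] -> R[i]) : Prop :=
  exists p q, forall s, 0 <= complex.Re s -> q.[s] != 0 /\ f s = p.[s] / q.[s].

Lemma halfplane_rational_horner p : halfplane_rational (horner p).
Proof. by exists p, 1 => s _; rewrite hornerC oner_neq0 divr1. Qed.

Lemma halfplane_rationalD f g : halfplane_rational f -> halfplane_rational g ->
  halfplane_rational (fun s => f s + g s).
Proof.
move=> [p1 [q1 h1]] [p2 [q2 h2]]; exists (p1 * q2 + p2 * q1), (q1 * q2) => s s0.
have [q10 ->] := h1 s s0; have [q20 ->] := h2 s s0.
by rewrite hornerD !hornerM mulf_neq0// addf_div.
Qed.

Lemma halfplane_rationalM f g : halfplane_rational f -> halfplane_rational g ->
  halfplane_rational (fun s => f s * g s).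
Proof.
move=> [p1 [q1 h1]] [p2 [q2 h2]]; exists (p1 * p2), (q1 * q2) => s s0.
have [q10 ->] := h1 s s0; have [q20 ->] := h2 s s0.
by rewrite !hornerM mulf_neq0// mulf_div.
Qed.

Lemma halfplane_rational_sum I (r : seq I) (f : I -> R[i] -> R[i]) :
  (forall i, halfplane_rational (f i)) ->
  halfplane_rational (fun s => \sum_(i <- r) f i s).
Proof.
move=> hf; elim: r => [|i r IH].
  rewrite (_ : (fun s => _) = horner 0); first exact: halfplane_rational_horner.
  by apply/funext => s; rewrite big_nil horner0.
rewrite (_ : (fun s => _) = fun s => f i s + \sum_(j <- r) f j s).
  exact: halfplane_rationalD.
by apply/funext => s; rewrite big_cons.
Qed.

Lemma halfplane_rationalV p : (forall s, 0 <= complex.Re s -> p.[s] != 0) ->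
  halfplane_rational (fun s => p.[s]^-1).
Proof. by move=> hp; exists 1, p => s s0; rewrite hornerC div1r; split=> //; exact: hp. Qed.

Lemma halfplane_rational_subC f z : halfplane_rational f -> halfplane_rational (fun s => f s - z).
Proof.
move=> hf; rewrite (_ : (fun s => _) = fun s => f s + (- z%:P).[s]).
  by apply: halfplane_rationalD => //; exact: halfplane_rational_horner.
by apply/funext => s; rewrite hornerN hornerC.
Qed.

Lemma cmeasurable_halfplane_rational d (T : measurableType d) f (g : T -> R[i]) :
  halfplane_rational f -> cmeasurable g -> (forall w, 0 <= complex.Re (g w)) ->
  cmeasurable (fun w => f (g w)).
Proof.
move=> [p [q h]] mg g0.
rewrite (_ : (fun w => _) = fun w => p.[g w] * (q.[g w])^-1).
  apply: cmeasurableM; first exact: cmeasurable_horner.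
  by apply: cmeasurableV; exact: cmeasurable_horner.
by apply/funext => w; have [_ ->] := h _ (g0 w).
Qed.

Lemma green0_halfplane x c (rs : seq R[i]) : x < c -> (forall z, z \in rs -> complex.Re z <= x) ->
  \sum_(z <- rs) green x c z = 0.
Proof. by move=> xc rx; rewrite big_seq big1// => z zrs; rewrite green_left// rx. Qed.

(* Jensen's formula for a half-plane: the poles lie outside and do not contribute. *)
Lemma pmean_ln_halfplane_rational f s0 : halfplane_rational f -> 0 <= complex.Re s0 -> f s0 != 0 ->
  exists rs : seq R[i], (forall s, 0 <= complex.Re s -> (f s == 0) = (s \in rs)) /\
    forall x c, 0 <= x -> x < c -> f (Complex c 0) != 0 ->
    pint (c - x) (fun t => ln (cmod (f (Complex x t)))) /\
    pmean (c - x) (fun t => ln (cmod (f (Complex x t)))) =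
      ln (cmod (f (Complex c 0))) + \sum_(z <- rs) green x c z.
Proof.
move=> [p [q h]] s00 fs0.
have [rs pE] := closed_field_poly_normal p.
have [rq qE] := closed_field_poly_normal q.
have lp0 : lead_coef p != 0.
  by apply: contraNneq fs0 => lp; rewrite (h _ s00).2 pE lp scale0r horner0 mul0r.
have lq0 : lead_coef q != 0.
  by apply: contraNneq (h _ s00).1 => lq; rewrite qE lq scale0r horner0.
have root_prod l (ts : seq R[i]) s : l != 0 ->
    ((l *: \prod_(z <- ts) ('X - z%:P)).[s] == 0) = (s \in ts).
  move=> l0; rewrite hornerZ mulf_eq0 (negbTE l0)/=.
  by rewrite -/(root _ s) root_prod_XsubC.
(* One list of zeros serves all lines and all poles: [pmean_ln_r_sub_le] plays three of these
   formulas against each other. *)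
exists rs; split.
  move=> s sr; have [qs ->] := h s sr.
  by rewrite mulf_eq0 invr_eq0 (negbTE qs) orbF {1}pE root_prod.
move=> x c x0 xc fc0; have a0 : 0 < c - x by rewrite subr_gt0.
have c0 : 0 <= c by apply: le_trans x0 (ltW xc).
have [qc0 fcE] := h (Complex c 0) c0.
have pc0 : p.[Complex c 0] != 0 by apply: contraNneq fc0 => pc0; rewrite fcE pc0 mul0r.
have [i1 m1] := pmean_ln_poly xc pE pc0.
have [i2 m2] := pmean_ln_poly xc qE qc0.
have rq0 : \sum_(z <- rq) green x c z = 0.
  apply: green0_halfplane => // z zq; rewrite leNgt; apply/negP => xz.
  have /h[] : 0 <= complex.Re z by apply: le_trans x0 (ltW xz).
  by rewrite {1}qE root_prod// zq.
pose g t := ln (cmod p.[Complex x t]) - ln (cmod q.[Complex x t]).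
have gi : pint (c - x) g by exact: pintB.
have mf : measurable_fun setT (fun t => ln (cmod (f (Complex x t)))).
  apply: measurable_ln_cmod; apply: cmeasurable_halfplane_rational => //.
    by exists p, q.
  exact: cmeasurable_line.
have ae_gf : \forall t \ae mu, g t = ln (cmod (f (Complex x t))).
  move: (ae_notin_seq [seq complex.Im z | z <- rs]); apply: aeS => t trs.
  have [qt0 ->] := h (Complex x t) x0.
  have pt0 : p.[Complex x t] != 0.
    rewrite pE root_prod//; apply: contraNN trs => trs; apply/mapP; by exists (Complex x t).
  by rewrite cmodM cmodV ln_div ?posrE ?cmod_gt0.
have [? ->] := pint_ae a0 mf gi ae_gf; split=> //.
by rewrite pmeanB// m1 m2 rq0 addr0 fcE cmodM cmodV ln_div ?posrE ?cmod_gt0// addrAC.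
Qed.

End jensen.

(** * Averaging over a circle *)

Section exchange.
Context {R : realType}.
Local Notation mu := (@lebesgue_measure R).

(** [H] will be a logarithm, unbounded below but dominated above by [B] uniformly in [y]. Tonelli is
    therefore applied to the nonnegative function [B - H]. *)
Lemma pmean_exchange (a b : R) (H : R -> R -> R) (B G : R -> R) : 0 < a -> 0 < b ->
  measurable_fun setT (fun w : R * R => H w.1 w.2) ->
  (forall t y, H t y <= B t) -> pint a B ->
  (forall t, pint b (H t)) -> pint a (fun t => pmean b (H t)) ->
  (forall y, pint a (H^~ y)) -> pint b G -> (forall y, pmean a (H^~ y) <= G y) ->
  pmean a (fun t => pmean b (H t)) <= pmean b G.
Proof.
move=> a0 b0 mH HB iB iH iM iH' iG HG.
pose k (w : R * R) := ((B w.1 - H w.1 w.2) * poisson a w.1 * poisson b w.2)%:E.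
have mB := pint_measurable a0 iB.
have mk : measurable_fun setT k.
  apply/measurable_EFinP; apply: measurable_funM; last exact: measurableT_comp (measurable_poisson b) measurable_snd.
  apply: measurable_funM; last exact: measurableT_comp (measurable_poisson a) measurable_fst.
  by apply: measurable_funB => //; exact: measurableT_comp mB measurable_fst.
have k0 w : (0 <= k w)%E.
  rewrite lee_fin; apply: mulr_ge0; last exact: poisson_ge0.
  by apply: mulr_ge0; [rewrite subr_ge0|exact: poisson_ge0].
have L : (\int[mu]_t \int[mu]_y k (t, y) = (pmean a B - pmean a (fun t => pmean b (H t)))%:E)%E.
  rewrite -pmeanB// -integral_pmean; last exact: pintB.
  apply: eq_integral => t _.
  have ic := pint_cst (B t) b0.
  transitivity (\int[mu]_y ((poisson a t * (cst (B t) y - H t y)) * poisson b y)%:E)%E.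
    by apply: eq_integral => y _; rewrite /k/= /cst (mulrC (poisson a t)).
  rewrite integral_pmean; last by apply: pintZ; exact: pintB.
  by rewrite pmeanZ ?pmeanB ?pmean_cst// 1?mulrC//; exact: pintB.
pose N y := pmean a B - pmean a (H^~ y).
have Rk y : (\int[mu]_t k (t, y) = (N y * poisson b y)%:E)%E.
  transitivity (\int[mu]_t ((poisson b y * (B t - H t y)) * poisson a t)%:E)%E.
    by apply: eq_integral => t _; rewrite /k/=; congr EFin; ring.
  rewrite integral_pmean; last by apply: pintZ; exact: pintB.
  by rewrite pmeanZ ?pmeanB// 1?mulrC//; exact: pintB.
(* Tonelli gives measurability of [N] times the kernel, and the kernel is positive and can be
   divided out. *)
have mN : measurable_fun setT N.
  have := @measurable_fun_fubini_tonelli_G _ _ _ _ R mu k mk k0.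
  rewrite /fubini_G; under eq_fun do rewrite Rk; move/measurable_EFinP => m.
  rewrite (_ : N = fun y => N y * poisson b y * (poisson b y)^-1).
    by apply: measurable_funM => //; apply: measurable_funV; exact: measurable_poisson.
  by apply/funext => y; rewrite mulfK// gt_eqF// poisson_gt0.
have N0 y : 0 <= N y.
  by rewrite subr_ge0; apply: le_pmean.
have [iN mNE] : pint b N /\ pmean b N = pmean a B - pmean a (fun t => pmean b (H t)).
  apply: ge0_pint => //; rewrite -L fubini_tonelli//.
  by apply: eq_integral => y _; rewrite Rk.
have : pmean b (fun y => cst (pmean a B) y - G y) <= pmean b N.
  apply: le_pmean => //; first by apply: pintB => //; exact: pint_cst.
  by move=> y; rewrite /N/cst lerD2l lerN2.
rewrite mNE pmeanB ?pmean_cst//; last exact: pint_cst.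
by rewrite lerD2l lerN2.
Qed.

(* [y |-> (iy - 1)/(iy + 1)] maps the real line to the unit circle, and the Poisson
   kernel at height 1 to the uniform measure. *)
Definition cayley (y : R) : R[i] := Complex (-1) y / Complex 1 y.

Lemma Complex1_neq0 (y : R) : Complex 1 y != 0 :> R[i].
Proof. by rewrite eq_complex/= oner_eq0. Qed.

Lemma cmod_cayley y : cmod (cayley y) = 1.
Proof.
have h : cmod (Complex (-1) y) = cmod (Complex 1 y) by rewrite !cmodE/= sqrrN.
by rewrite cmodM cmodV h divff// cmod_eq0 Complex1_neq0.
Qed.

(** In the Cayley parameter [z - e%:C * cayley y] is a quotient of two linear functions of
    [Complex 0 y], so [pmean_ln_linear] is used twice. The root [w] of the numerator has positive
    real part exactly when [cmod z < e], which decides between the two values of the maximum. *)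
Lemma pmean_ln_circle (e : R) (z : R[i]) : 0 < e ->
  pint 1 (fun y => ln (cmod (z - e%:C%C * cayley y))) /\
  pmean 1 (fun y => ln (cmod (z - e%:C%C * cayley y))) = ln (Num.max (cmod z) e).
Proof.
move=> e0.
have E y : z - e%:C%C * cayley y = ((z + e%:C%C) + Complex 0 y * (z - e%:C%C)) / Complex 1 y.
  have C1 : Complex 1 y = 1 + Complex 0 y by apply/eqP; rewrite eq_complex/= addr0 add0r !eqxx.
  have C2 : Complex (-1) y = -1 + Complex 0 y by apply/eqP; rewrite eq_complex/= addr0 oppr0 add0r !eqxx.
  rewrite /cayley C2; have := Complex1_neq0 y; rewrite C1.
  by move: (Complex 0 y) => w w0; field.
have mf : measurable_fun setT (fun y => ln (cmod (z - e%:C%C * cayley y))).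
  apply: measurable_ln_cmod; under eq_fun do rewrite E.
  apply: cmeasurableM; last by apply: cmeasurableV; exact: (cmeasurable_line 1).
  apply: cmeasurableD; first exact: cmeasurable_cst.
  by apply: cmeasurableM; [exact: (cmeasurable_line 0)|exact: cmeasurable_cst].
have [iq mq] := @pmean_ln_linear R 0 1 (-1) ltr01.
rewrite subr0 in iq mq.
have qE y : Complex 0 y - (-1) = Complex 1 y :> R[i].
  by apply/eqP; rewrite opprK eq_complex/= add0r addr0 !eqxx.
move: iq mq; under eq_fun do rewrite qE.
have Rem1 : complex.Re (-1 : R[i]) <= 0 by exact: lerN10.
rewrite (green_left ltr01 Rem1).
have -> : Complex 1 0 - (-1) = 2%:R :> R[i].
  by rewrite opprK mulr2n; apply/eqP; rewrite eq_complex/= addr0 !eqxx.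
rewrite addr0 cmod_nat => iq mq.
(* For [z = e] the numerator is constant and has no root [w]. *)
have [ze|ze] := eqVneq z e%:C%C.
  have -> : (fun y => ln (cmod (z - e%:C%C * cayley y))) =
      fun y => cst (ln (2 * e)) y - ln (cmod (Complex 1 y)).
    apply/funext => y; rewrite E ze subrr mulr0 addr0 cmodM cmodV.
    rewrite -rmorphD cmod_real/= ger0_norm ?addr_ge0 ?(ltW e0)// ln_div ?posrE ?cmod_gt0 ?Complex1_neq0 ?addr_gt0//.
    by rewrite /cst mulr_natl mulr2n.
  split; first by apply: pintB => //; exact: pint_cst.
  rewrite pmeanB ?pmean_cst//; last exact: pint_cst.
  rewrite mq lnM ?posrE// addrAC subrr add0r ze cmod_real gtr0_norm// /Num.max ltxx.
  by [].
pose w := - (z + e%:C%C) / (z - e%:C%C).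
have ze0 : z - e%:C%C != 0 by rewrite subr_eq0.
have [iw mw] := @pmean_ln_linear R 0 1 w ltr01.
rewrite subr0 in iw mw.
pose g y := (cst (ln (cmod (z - e%:C%C))) y + ln (cmod (Complex 0 y - w))) - ln (cmod (Complex 1 y)).
have ic := pint_cst (ln (cmod (z - e%:C%C))) (@ltr01 R).
have ig : pint 1 g by apply: pintB => //; exact: pintD.
have gf : \forall y \ae mu, g y = ln (cmod (z - e%:C%C * cayley y)).
  move: (ae_notin_seq [:: complex.Im w]); apply: aeS => y; rewrite inE => yw.
  rewrite E (_ : z + e%:C%C + _ = (z - e%:C%C) * (Complex 0 y - w)); last first.
    by rewrite /w; move: (Complex 0 y) (e%:C%C) ze0 => v e' ze0; field.
  have yw0 : Complex 0 y - w != 0.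
    by rewrite subr_eq0; apply: contraNneq yw => <-.
  rewrite !cmodM cmodV ln_div ?posrE ?lnM ?mulr_gt0 ?cmod_gt0 ?posrE ?cmod_gt0 ?Complex1_neq0//.
have [? ->] := pint_ae ltr01 mf ig gf; split=> //.
rewrite pmeanB//; last exact: pintD.
rewrite pmeanD// pmean_cst// mw mq.
have D0 : 0 < cmod (z - e%:C%C) by rewrite cmod_gt0.
have C10 : Complex 1 0 = 1 :> R[i] by [].
have wD : complex.Re w * cmod (z - e%:C%C) ^+ 2 = e ^+ 2 - cmod z ^+ 2.
  have : 0 < cmod (z - e%:C%C) ^+ 2 by exact: exprn_gt0.
  rewrite /w !sqr_cmod; case: (z) => zr zi /=; rewrite oppr0 addr0 => d0.
  by field; rewrite gt_eqF.
have [ez|ze'] := leP e (cmod z).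
  rewrite green_left// ?addr0; last first.
    rewrite -(pmulr_lle0 _ (exprn_gt0 2 D0)) wD subr_le0 ler_pXn2r ?nnegrE ?cmod_ge0//.
    exact: ltW.
  have z0 : 0 < cmod z by apply: lt_le_trans ez.
  rewrite C10 (_ : 1 - w = 2%:R * z / (z - e%:C%C)); last first.
    by rewrite /w; move: (e%:C%C) ze0 => e' ze0; field.
  rewrite !cmodM cmodV cmod_nat ln_div ?posrE ?mulr_gt0// lnM ?posrE//.
  by ring.
rewrite /green C10 subr0 sub0r normrN (addrC (ln (cmod (1 - w)))) subrK.
have wr0 : 0 <= complex.Re w.
  rewrite -(pmulr_lge0 _ (exprn_gt0 2 D0)) wD subr_ge0 ler_pXn2r ?nnegrE ?cmod_ge0// ltW//.
rewrite ger0_norm// (_ : _ + _ ^+ 2 = complex.Re (1 + w) ^+ 2 + complex.Im (1 + w) ^+ 2); last first.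
  by case: (w) => wr wi /=; rewrite add0r.
rewrite -ln_cmod (_ : 1 + w = - (2%:R * e%:C%C) / (z - e%:C%C)); last first.
  by rewrite /w; move: (e%:C%C) ze0 => e' ze0; field.
rewrite !cmodM cmodV cmodN cmodM cmod_nat cmod_real gtr0_norm// ln_div ?posrE ?mulr_gt0// lnM ?posrE//.
by ring.
Qed.

End exchange.

(** * Estimates of the Green function near the line and far away *)

Section green_estimates.
Context {R : realType}.
Implicit Types (z : R[i]) (x c a : R).

Lemma ln_diff_le (u v : R) : 0 < u -> 0 < v -> ln u - ln v <= (u - v) / v.
Proof.
move=> u0 v0; rewrite -ln_div ?posrE// mulrBl divff ?gt_eqF//.
have h : -1 < u / v - 1 by rewrite ltrBrDl subrr divr_gt0.
by have := le_ln1Dx h; rewrite subrKC.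
Qed.

Lemma green_denominator_gt0 c z : Complex c 0 != z ->
  0 < (c - complex.Re z) ^+ 2 + complex.Im z ^+ 2.
Proof.
move=> cz; rewrite lt_neqAle addr_ge0 ?sqr_ge0// andbT eq_sym paddr_eq0 ?sqr_ge0//.
rewrite !sqrf_eq0 subr_eq0.
by apply: contraNN cz; case: z => zr zi /= /andP[/eqP -> /eqP ->].
Qed.

(** The arguments of the two logarithms differ by exactly [4 * (c - x) * (complex.Re z - x)].
    Concavity of [ln] bounds the difference from above here, and from below in [green_ge] with the
    arguments exchanged. *)
Lemma green_le x c z : x < c -> x <= complex.Re z -> Complex c 0 != z ->
  green x c z <= 2 * (c - x) * (complex.Re z - x) / ((c - complex.Re z) ^+ 2 + complex.Im z ^+ 2).
Proof.
move=> xc xz cz; have D0 := green_denominator_gt0 cz.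
rewrite green_right// -mulrBl ler_pdivrMr//.
have u0 : 0 < (c - x + (complex.Re z - x)) ^+ 2 + complex.Im z ^+ 2.
  by rewrite ltr_pwDl ?sqr_ge0// exprn_gt0//; lra.
apply: le_trans (ln_diff_le u0 D0) _.
by rewrite [leRHS]mulrAC ler_pM2r ?invr_gt0//; rewrite le_eqVlt; apply/orP; left; apply/eqP; ring.
Qed.

Lemma green_ge x c z : x < c -> x <= complex.Re z -> Complex c 0 != z ->
  2 * (c - x) * (complex.Re z - x) / ((c - x + (complex.Re z - x)) ^+ 2 + complex.Im z ^+ 2)
    <= green x c z.
Proof.
move=> xc xz cz; have D0 := green_denominator_gt0 cz.
rewrite green_right// -mulrBl ler_pdivlMr//.
have u0 : 0 < (c - x + (complex.Re z - x)) ^+ 2 + complex.Im z ^+ 2.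
  by rewrite ltr_pwDl ?sqr_ge0// exprn_gt0//; lra.
rewrite -lerN2; rewrite opprB; apply: le_trans (ln_diff_le D0 u0) _.
by rewrite [leRHS](_ : _ = (- (2 * (c - x) * (complex.Re z - x) * 2)) /
  ((c - x + (complex.Re z - x)) ^+ 2 + complex.Im z ^+ 2)); [rewrite ler_pM2r ?invr_gt0//; rewrite le_eqVlt; apply/orP; left; apply/eqP|]; ring.
Qed.

Lemma green_gt0 x c z : x < c -> x < complex.Re z -> Complex c 0 != z -> 0 < green x c z.
Proof.
move=> xc xz cz; apply: lt_le_trans (green_ge xc (ltW xz) cz).
rewrite divr_gt0//; first by rewrite !mulr_gt0 ?subr_gt0.
by rewrite ltr_pwDl ?sqr_ge0// exprn_gt0//; lra.
Qed.

(** With [D] the squared distance from [1] to [z], the left side is at most [eta / D]. On the right,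
    [complex.Re z - 1 / 4 >= 1 / 4] gives at least [3 / 8 / (D + 9 / 4)]. The bound on [eta] keeps
    [z] at distance at least [(1 - x) / 2] from the pole [1], so that [D] and [D + 9 / 4] are
    comparable. *)
Lemma green_near_boundary x (eta : R) z : 1 / 2 <= x -> x < 1 -> 0 < eta -> eta <= (1 - x) / 2 ->
  x <= complex.Re z -> complex.Re z <= x + eta -> Complex 1 0 != z ->
  green x 1 z <= 8 / 3 * (1 + 9 / (1 - x) ^+ 2) * eta * green (1 / 4) 1 z.
Proof.
move=> x2 x1 eta0 etax xz zx z1.
have D0 := green_denominator_gt0 z1.
have h4 : 1 / 4 < 1 :> R by lra.
have hz : 1 / 4 <= complex.Re z by lra.
apply: le_trans (green_le x1 xz z1) _.
have hg := green_ge h4 hz z1.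
have a0 : 0 < 1 - x by lra.
set D := _ + _ in D0 *; set a := 1 - x in etax a0 *.
have aD : a ^+ 2 <= 4 * D.
  have : a / 2 <= 1 - complex.Re z by rewrite /a in etax *; lra.
  move=> h; have h2 : (a / 2) ^+ 2 <= (1 - complex.Re z) ^+ 2 by rewrite ler_pXn2r ?nnegrE//; lra.
  have := sqr_ge0 (complex.Im z); rewrite /D; move: h2; rewrite expr_div_n; lra.
have g1 : (3 / 8) / (D + 9 / 4) <= green (1 / 4) 1 z.
  apply: le_trans hg.
  have e1 : (1 - 1 / 4 + (complex.Re z - 1 / 4)) ^+ 2 + complex.Im z ^+ 2 =
     D + 3 * (complex.Re z - 1 / 4) by rewrite /D; field.
  rewrite e1 ler_pdivrMr; last by lra.
  rewrite mulrAC ler_pdivlMr; last by lra.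
  rewrite /a in etax; nra.
have k0 : 0 < 8 / 3 * (1 + 9 / a ^+ 2) * eta.
  by rewrite !mulr_gt0// addr_gt0// divr_gt0// exprn_gt0.
apply: le_trans (_ : 8 / 3 * (1 + 9 / a ^+ 2) * eta * (3 / 8 / (D + 9 / 4)) <= _); last first.
  by rewrite ler_pM2l.
have -> : 8 / 3 * (1 + 9 / a ^+ 2) * eta * (3 / 8 / (D + 9 / 4)) = eta * ((1 + 9 / a ^+ 2) / (D + 9 / 4)).
  by field; rewrite !gt_eqF//; lra.
apply: (@le_trans _ _ (eta / D)).
  rewrite ler_pM2r ?invr_gt0//.
  have : 2 * a <= 1 by rewrite /a; lra.
  by move=> ha; apply: (@le_trans _ _ (1 * (complex.Re z - x))); [rewrite ler_wpM2r//; lra|lra].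
rewrite ler_pM2l// ler_pdivlMr; last by lra.
rewrite mulrC ler_pdivrMr//.
have : 9 / 4 <= 9 / a ^+ 2 * D by rewrite mulrAC ler_pdivlMr ?exprn_gt0//; lra.
by rewrite mulrDl mul1r; lra.
Qed.

(** Let [r] be the distance from [z] to the line and [M] the squared distance from [z] to the point
    [x]. For the pole [1] the Green function is at most [4 * (1 - x) * r / M], for the pole [x + t]
    at least [t * r / (2 * M)]; moving the pole away gains a factor of order [t]. *)
Lemma green_far x (t : R) z : 1 / 2 <= x -> x < 1 -> 2 <= t -> x <= complex.Re z ->
  t ^+ 2 <= (complex.Re z - x) ^+ 2 + complex.Im z ^+ 2 ->
  Complex 1 0 != z -> Complex (x + t) 0 != z ->
  green x 1 z <= 4 / t * green x (x + t) z.
Proof.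
move=> x2 x1 t2 xz tz z1 zt.
have xt : x < x + t by lra.
apply: le_trans (green_le x1 xz z1) _.
have := green_ge xt xz zt.
have t0 : 0 < 4 / t by rewrite divr_gt0//; lra.
rewrite -(ler_pM2l t0); apply: le_trans.
have D0 := green_denominator_gt0 z1.
set r := complex.Re z - x; set y := complex.Im z.
have r0 : 0 <= r by rewrite subr_ge0.
have -> : x + t - x = t by ring.
have tr0 : 0 < (t + r) ^+ 2 + y ^+ 2 by rewrite ltr_pwDl ?sqr_ge0// exprn_gt0//; lra.
have -> : 4 / t * (2 * t * r / ((t + r) ^+ 2 + y ^+ 2)) = 8 * r / ((t + r) ^+ 2 + y ^+ 2).
  by field; rewrite !gt_eqF//; lra.
have E : (1 - complex.Re z) ^+ 2 + y ^+ 2 = (1 - x - r) ^+ 2 + y ^+ 2 by rewrite /r; congr (_ + _); ring.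
rewrite E in D0 *.
set M := r ^+ 2 + y ^+ 2.
have MM : t ^+ 2 <= M by [].
have M4 : 4 <= M by apply: le_trans MM; rewrite (_ : 4 = 2 ^+ 2); [rewrite ler_pXn2r ?nnegrE//; lra|ring].
have rM : r <= M / 2.
  have := sqr_ge0 y; have := sqr_ge0 (r - 1); rewrite /M in M4 *.
  move: (y ^+ 2) M4 => Y; rewrite sqrrB1.
  have [r2|r2] := leP r 2; first by lra.
  have : 2 * r <= r * r by rewrite ler_pM2r//; lra.
  by rewrite expr2; lra.
rewrite ler_pdivlMr// mulrAC ler_pdivrMr//.
have h1 : (t + r) ^+ 2 + y ^+ 2 <= 4 * M.
  have := sqr_ge0 (t - r); have := sqr_ge0 y; rewrite /M in MM *.
  have -> : (t + r) ^+ 2 = 2 * t ^+ 2 + 2 * r ^+ 2 - (t - r) ^+ 2 by ring.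
  by have := sqr_ge0 r; lra.
have h2 : M / 2 <= (1 - x - r) ^+ 2 + y ^+ 2.
  have -> : (1 - x - r) ^+ 2 + y ^+ 2 = M - 2 * (1 - x) * r + (1 - x) ^+ 2 by rewrite /M; ring.
  have := sqr_ge0 (1 - x).
  have : 2 * (1 - x) * r <= 1 * r by rewrite ler_wpM2r//; lra.
  lra.
have h3 : 2 * (1 - x) * r <= r by rewrite -[leRHS]mul1r ler_wpM2r//; lra.
apply: (@le_trans _ _ (r * (4 * M))).
  by apply: ler_pM => //; [rewrite !mulr_ge0//; lra|exact: ltW].
have -> : r * (4 * M) = 8 * r * (M / 2) by field.
by rewrite ler_wpM2l// mulr_ge0.
Qed.

End green_estimates.

(** * Cubic growth bounds and truncated logarithms *)

Section growth.
Context {R : realType}.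
Implicit Types (s z : R[i]) (M x t c e : R).

Lemma cmodD2_ge1 s : 0 <= complex.Re s -> 1 <= cmod (s + 2).
Proof.
move=> s0; apply: le_trans (Re_le_cmod _).
have -> : complex.Re (s + 2) = complex.Re s + 2 by case: (s).
by rewrite ger0_norm; lra.
Qed.

(** The majorant of all logarithms below. Since [-2] lies left of the line, [s + 2] contributes no
    Green term and the Poisson mean is the value at the pole; the shift by [2] also keeps the
    majorant nonnegative. *)
Definition ln_growth (M x t : R) : R := ln M + 3 * ln (cmod (Complex x t + 2)).

Lemma ln_growth_ge0 M x t : 1 <= M -> 0 <= x -> 0 <= ln_growth M x t.
Proof.
by move=> M1 x0; rewrite addr_ge0 ?ln_ge0// mulr_ge0// ln_ge0// cmodD2_ge1.
Qed.

Lemma ln_le_growth M x t (z : R) : 1 <= M -> 0 <= x -> z <= M * cmod (Complex x t + 2) ^+ 3 ->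
  ln z <= ln_growth M x t.
Proof.
move=> M1 x0 zM; have [z0|z0] := leP z 0; first by rewrite ln0// ln_growth_ge0.
have M0 : 0 < M by apply: lt_le_trans M1.
have W0 : 0 < cmod (Complex x t + 2) by apply: lt_le_trans (cmodD2_ge1 _).
apply: (@le_trans _ _ (ln (M * cmod (Complex x t + 2) ^+ 3))).
  by rewrite ler_ln ?posrE// mulr_gt0// exprn_gt0.
by rewrite lnM ?posrE// ?exprn_gt0// lnXn// /ln_growth mulr_natl.
Qed.

Lemma pmean_ln_growth M x c : 0 <= x -> x < c ->
  pint (c - x) (ln_growth M x) /\ pmean (c - x) (ln_growth M x) = ln M + 3 * ln (c + 2).
Proof.
move=> x0 xc; have a0 : 0 < c - x by rewrite subr_gt0.
have [i m] := pmean_ln_linear (-2) xc.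
have Re2 : complex.Re (-2 : R[i]) <= x.
  by rewrite (_ : complex.Re _ = -2); [lra|rewrite -(rmorph_nat (real_complex R)) -rmorphN].
have c2 : cmod (Complex c 0 - (-2)) = c + 2.
  rewrite (_ : _ - _ = (c + 2)%:C%C); last by rewrite opprK rmorphD rmorph_nat.
  by rewrite cmod_real ger0_norm; lra.
have h : (fun t => ln (cmod (Complex x t - (-2)))) = fun t => ln (cmod (Complex x t + 2)).
  by apply/funext => t; rewrite opprK.
rewrite h (green_left xc Re2) addr0 c2 in i m.
have ic := pint_cst (ln M) a0; have iz := pintZ 3 i.
split; first exact: pintD.
by rewrite [LHS](@pmeanD _ _ (cst (ln M)))// pmean_cst// pmeanZ// m.
Qed.

Lemma ln_max_bound M x t (z : R) e : 1 <= M -> 0 <= x -> 0 < e -> e <= 1 ->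
  z <= M * cmod (Complex x t + 2) ^+ 3 -> `|ln (Num.max z e)| <= ln_growth M x t - ln e.
Proof.
move=> M1 x0 e0 e1 zM.
have le0 : ln e <= 0 by exact: ln_le0.
have g0 := ln_growth_ge0 t M1 x0.
have m0 : 0 < Num.max z e by rewrite lt_max e0 orbT.
rewrite ler_norml; apply/andP; split.
  apply: (@le_trans _ _ (ln e)); first by rewrite opprB gerDl oppr_le0.
  by rewrite ler_ln ?posrE// le_max lexx orbT.
apply: (@le_trans _ _ (ln_growth M x t)); last by rewrite lerDl oppr_ge0.
apply: ln_le_growth => //; rewrite ge_max zM/=.
apply: le_trans e1 _; apply: (@le_trans _ _ (1 * 1)); first by rewrite mulr1.
by apply: ler_pM => //; apply: exprn_ege1; exact: cmodD2_ge1.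
Qed.

Lemma cvg_ln_max (e : R) (u : nat -> R) l : 0 < e -> u n @[n --> \oo] --> l ->
  ln (Num.max (u n) e) @[n --> \oo] --> ln (Num.max l e).
Proof.
move=> e0 ul.
have m : Num.max (u n) e @[n --> \oo] --> Num.max l e.
  rewrite maxr_absE; under eq_fun do rewrite maxr_absE.
  apply: cvgMl; apply: cvgD; first by apply: cvgD => //; exact: cvg_cst.
  by apply: cvg_norm; apply: cvgB => //; exact: cvg_cst.
have m0 : 0 < Num.max l e by rewrite lt_max e0 orbT.
by have := cvg_comp _ _ m (continuous_ln m0).
Qed.

Lemma cvg_cmod_dist (g : nat -> R[i]) z : cmod (g n - z) @[n --> \oo] --> 0 ->
  cmod (g n) @[n --> \oo] --> cmod z.
Proof.
move=> gz; apply/cvgrPdist_le => e e0; move/cvgr0Pnorm_le : (gz) => /(_ _ e0).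
apply: filterS => n; rewrite ger0_norm ?cmod_ge0// => gn.
by rewrite distrC; exact: le_trans (cmod_dist _ _) gn.
Qed.

End growth.

(** * Continuity of complex-valued functions, by components *)

Section complex_continuity.
Context {T : topologicalType} {R : realType}.
Implicit Types f g : T -> R[i].

Definition ccontinuous_at f (t : T) : Prop :=
  (complex.Re (f u) @[u --> t] --> complex.Re (f t)) /\
  (complex.Im (f u) @[u --> t] --> complex.Im (f t)).

Lemma ccontinuous_at_cst (z : R[i]) t : ccontinuous_at (fun=> z) t.
Proof. by split; exact: cvg_cst. Qed.

Lemma ccontinuous_atD f g t : ccontinuous_at f t -> ccontinuous_at g t ->
  ccontinuous_at (fun u => f u + g u) t.
Proof.
move=> [f1 f2] [g1 g2].
have ReE (z w : R[i]) : complex.Re (z + w) = complex.Re z + complex.Re w by case: z w => [? ?] [? ?].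
have ImE (z w : R[i]) : complex.Im (z + w) = complex.Im z + complex.Im w by case: z w => [? ?] [? ?].
split.
  rewrite ReE (_ : (fun _ => _) = fun u => complex.Re (f u) + complex.Re (g u)).
    exact: cvgD.
  by apply/funext => u; rewrite ReE.
rewrite ImE (_ : (fun _ => _) = fun u => complex.Im (f u) + complex.Im (g u)).
  exact: cvgD.
by apply/funext => u; rewrite ImE.
Qed.

Lemma ccontinuous_atM f g t : ccontinuous_at f t -> ccontinuous_at g t ->
  ccontinuous_at (fun u => f u * g u) t.
Proof.
move=> [f1 f2] [g1 g2].
have ReE (z w : R[i]) : complex.Re (z * w) = complex.Re z * complex.Re w - complex.Im z * complex.Im w.
  by case: z w => [? ?] [? ?].
have ImE (z w : R[i]) : complex.Im (z * w) = complex.Re z * complex.Im w + complex.Im z * complex.Re w.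
  by case: z w => [? ?] [? ?].
split.
  rewrite ReE (_ : (fun _ => _) = fun u => complex.Re (f u) * complex.Re (g u) - complex.Im (f u) * complex.Im (g u)).
    by apply: cvgB; exact: cvgM.
  by apply/funext => u; rewrite ReE.
rewrite ImE (_ : (fun _ => _) = fun u => complex.Re (f u) * complex.Im (g u) + complex.Im (f u) * complex.Re (g u)).
  by apply: cvgD; exact: cvgM.
by apply/funext => u; rewrite ImE.
Qed.

Lemma ccontinuous_atV f t : f t != 0 -> ccontinuous_at f t -> ccontinuous_at (fun u => (f u)^-1) t.
Proof.
move=> ft0 [f1 f2].
have n0 : complex.Re (f t) ^+ 2 + complex.Im (f t) ^+ 2 != 0.
  by rewrite -sqr_cmod expf_neq0// cmod_eq0.
have c : (complex.Re (f u) ^+ 2 + complex.Im (f u) ^+ 2)^-1 @[u --> t] -->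
    (complex.Re (f t) ^+ 2 + complex.Im (f t) ^+ 2)^-1.
  apply: cvgV => //; rewrite !expr2; under eq_fun do rewrite !expr2.
  by apply: cvgD; exact: cvgM.
have ReE (z : R[i]) : complex.Re z^-1 = complex.Re z * (complex.Re z ^+ 2 + complex.Im z ^+ 2)^-1.
  by case: z.
have ImE (z : R[i]) : complex.Im z^-1 = - (complex.Im z * (complex.Re z ^+ 2 + complex.Im z ^+ 2)^-1).
  by case: z.
split.
  by rewrite ReE; under eq_fun do rewrite ReE; exact: cvgM.
by rewrite ImE; under eq_fun do rewrite ImE; apply: cvgN; exact: cvgM.
Qed.

Lemma ccontinuous_at_horner (p : {poly R[i]}) f t : ccontinuous_at f t ->
  ccontinuous_at (fun u => p.[f u]) t.
Proof.
move=> cf; elim/poly_ind: p => [|p c IH].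
  rewrite (_ : (fun u => _) = fun=> 0); first exact: ccontinuous_at_cst.
  by apply/funext => u; rewrite horner0.
rewrite (_ : (fun u => _) = fun u => p.[f u] * f u + c); last first.
  by apply/funext => u; rewrite hornerMXaddC.
by apply: ccontinuous_atD; [exact: ccontinuous_atM|exact: ccontinuous_at_cst].
Qed.

Lemma cvg_cmod_ccontinuous f t : ccontinuous_at f t -> cmod (f u) @[u --> t] --> cmod (f t).
Proof.
move=> [f1 f2]; rewrite cmodE; under eq_fun do rewrite cmodE.
apply: (@cvg_comp _ _ _ (fun u => complex.Re (f u) ^+ 2 + complex.Im (f u) ^+ 2) Num.sqrt _
  (nbhs (complex.Re (f t) ^+ 2 + complex.Im (f t) ^+ 2))); last exact: sqrt_continuous.
by rewrite !expr2; under eq_fun do rewrite !expr2; apply: cvgD; exact: cvgM.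
Qed.

End complex_continuity.

(** * Uniform limits of rational functions *)

Section uniform_limit.
Context {R : realType}.
Variables (F : R[i] -> R[i]) (r : nat -> R[i] -> R[i]) (delta : nat -> R).
Hypothesis rational_r : forall N, halfplane_rational (r N).
Hypothesis delta0 : delta N @[N --> \oo] --> 0.
Hypothesis r_F : forall N s, 1 / 4 <= complex.Re s -> cmod (r N s - F s) <= delta N * cmod (s + 2) ^+ 3.

(** An [e / 3] argument, with [B] a local bound for the weight [cmod (s + 2) ^+ 3]. Strictness of
    [1 / 4 < u.1] leaves a neighbourhood where [r_F] is available. The continuity feeds the
    compactness argument of [cmod_limit_bounded_away]. *)
Lemma continuous_cmod_limit (u : R * R) : 1 / 4 < u.1 ->
  {for u, continuous (fun u => cmod (F (Complex u.1 u.2)))}.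
Proof.
move=> u4; apply/cvgrPdist_le => e e0.
pose B := (cmod (Complex u.1 u.2 + 2) + 1) ^+ 3.
have B0 : 0 < B by rewrite exprn_gt0// ltr_wpDl// cmod_ge0.
have [N HN] : exists N, delta N <= e / 3 / B.
  have eB : 0 < e / 3 / B by rewrite !divr_gt0.
  move/cvgr0Pnorm_le : (delta0) => /(_ _ eB)[N _ h]; exists N.
  by apply: le_trans (ler_norm _) (h N _) => /=.
have id_c : ccontinuous_at (fun u : R * R => Complex u.1 u.2) u.
  by split; [exact: cvg_fst|exact: cvg_snd].
have fst_u : (fst v : R) @[v --> u] --> (u.1 : R) by exact: cvg_fst.
have near4 : \forall v \near u, 1 / 4 < v.1 by exact: (cvgr_gt u.1 fst_u (1 / 4) u4).
have cr : ccontinuous_at (fun u : R * R => r N (Complex u.1 u.2)) u.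
  have [p [q h]] := rational_r N.
  have qn0 : q.[Complex u.1 u.2] != 0 by apply: (h _ _).1 => /=; lra.
  have [c1 c2] := ccontinuous_atM (ccontinuous_at_horner p id_c)
    (ccontinuous_atV qn0 (ccontinuous_at_horner q id_c)).
  have E : \forall v \near u, p.[Complex v.1 v.2] / q.[Complex v.1 v.2] = r N (Complex v.1 v.2).
    by move: near4; apply: filterS => v v4; rewrite (h _ _).2//=; lra.
  have Eu := nbhs_singleton E.
  by split; rewrite -Eu; [move: c1|move: c2]; apply: cvg_trans; apply: near_eq_cvg;
     move: E; apply: filterS => v ->.
have e3 : 0 < e / 3 by rewrite divr_gt0.
move/cvgrPdist_le : (cvg_cmod_ccontinuous cr) => /(_ _ e3) near_r.
have nearB : \forall v \near u, cmod (Complex v.1 v.2 + 2) < cmod (Complex u.1 u.2 + 2) + 1.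
  have lt1 : cmod (Complex u.1 u.2 + 2) < cmod (Complex u.1 u.2 + 2) + 1 by rewrite ltrDl.
  have cv := cvg_cmod_ccontinuous (ccontinuous_atD id_c (ccontinuous_at_cst 2 u)).
  exact: (cvgr_lt _ cv _ lt1).
have dist_le (v : R * R) : 1 / 4 < v.1 -> cmod (Complex v.1 v.2 + 2) <= cmod (Complex u.1 u.2 + 2) + 1 ->
    `|cmod (r N (Complex v.1 v.2)) - cmod (F (Complex v.1 v.2))| <= e / 3.
  move=> v4 vB; apply: le_trans (cmod_dist _ _) _.
  apply: le_trans (r_F _ _) _; first exact: ltW.
  apply: (@le_trans _ _ (e / 3 / B * cmod (Complex v.1 v.2 + 2) ^+ 3)).
    by rewrite ler_wpM2r// exprn_ge0// cmod_ge0.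
  rewrite ler_pdivlMr in HN => //.
  rewrite mulrAC ler_pdivrMr// ler_pM2l ?divr_gt0// ler_pXn2r ?nnegrE ?cmod_ge0//.
  by rewrite addr_ge0// cmod_ge0.
near=> v.
have v4 : 1 / 4 < v.1 by near: v.
have d1 : `|cmod (r N (Complex v.1 v.2)) - cmod (F (Complex v.1 v.2))| <= e / 3.
  by apply: dist_le => //; apply: ltW; near: v.
have d2 : `|cmod (r N (Complex u.1 u.2)) - cmod (F (Complex u.1 u.2))| <= e / 3.
  by apply: dist_le => //; rewrite lerDl.
have d3 : `|cmod (r N (Complex u.1 u.2)) - cmod (r N (Complex v.1 v.2))| <= e / 3 by near: v.
move: d1 d2 d3; rewrite !ler_norml => /andP[? ?] /andP[? ?] /andP[? ?].
by apply/andP; split; lra.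
Unshelve. all: by end_near. Qed.

(** A bound for the inverse modulus on a compact rectangle. The resulting [m] keeps the zeros of
    small perturbations of [F] out of that rectangle. *)
Lemma cmod_limit_bounded_away (x0 x1 y0 : R) : 1 / 4 < x0 ->
  (forall s, x0 <= complex.Re s -> F s != 0) ->
  exists2 m, 0 < m & forall s, x0 <= complex.Re s -> complex.Re s <= x1 ->
    `|complex.Im s| <= y0 -> m <= cmod (F s).
Proof.
move=> x04 nF; pose K := (`[x0, x1] `*` `[- y0, y0])%classic.
have cK : compact K by apply: compact_setX; exact: segment_compact.
pose g (u : R * R) := (cmod (F (Complex u.1 u.2)))^-1.
have cg : {within K, continuous g}.
  apply: continuous_in_subspaceT => u; rewrite inE /K/= !in_itv/= => -[/andP[ux _] _].
  apply: cvgV; first by rewrite cmod_eq0 nF.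
  by apply: continuous_cmod_limit; apply: lt_le_trans x04 ux.
have [M [Mr hM]] := compact_bounded (continuous_compact cg cK).
have M1 : M < `|M| + 1 by rewrite ltr_pwDr// ler_norm.
exists (`|M| + 1)^-1; first by rewrite invr_gt0 ltr_wpDl.
move=> s sx0 sx1 sy.
have Fs : 0 < cmod (F s) by rewrite cmod_gt0 nF.
rewrite -[leRHS]invrK lef_pV2 ?posrE ?invr_gt0 ?ltr_wpDl//.
have := hM _ M1 (g (complex.Re s, complex.Im s)).
rewrite /g/= ger0_norm ?invr_ge0 ?cmod_ge0//.
have -> : Complex (complex.Re s) (complex.Im s) = s by case: (s).
apply; exists (complex.Re s, complex.Im s).
  by rewrite /K/= !in_itv/= sx0 sx1 -ler_norml sy.
by rewrite /g/=; case: (s).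
Qed.




Lemma cvg_r s : 1 / 4 <= complex.Re s -> cmod (r N s - F s) @[N --> \oo] --> 0.
Proof.
move=> s4; apply: (@squeeze_cvgr _ _ _ _ (cst 0) (fun N => delta N * cmod (s + 2) ^+ 3)).
- by near=> N; rewrite cmod_ge0 r_F.
- exact: cvg_cst.
- by rewrite -[X in _ --> X](mul0r (cmod (s + 2) ^+ 3)); exact: cvgMl.
Unshelve. all: by end_near. Qed.

Lemma measurable_cmod_limit (x : R) : 1 / 4 <= x ->
  measurable_fun setT (fun t => cmod (F (Complex x t))).
Proof.
move=> x4; apply: (@measurable_fun_cvg _ _ _ _ (fun N t => cmod (r N (Complex x t)))).
  move=> N; apply: measurable_cmod; apply: cmeasurable_halfplane_rational (rational_r N) _ _.
    exact: cmeasurable_line.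
  by move=> t /=; lra.
by move=> t _; apply: cvg_cmod_dist; exact: cvg_r.
Qed.

Lemma measurable_ln_max (h : R -> R) (e : R) : measurable_fun setT h ->
  measurable_fun setT (fun t => ln (Num.max (h t) e)).
Proof.
move=> mh; apply: measurableT_comp; first exact: measurable_ln.
exact: measurable_maxr.
Qed.

Lemma pint_ln_max (M x c e : R) (h : R -> R) : 1 <= M -> 0 <= x -> x < c -> 0 < e -> e <= 1 ->
  measurable_fun setT h -> (forall t, h t <= M * cmod (Complex x t + 2) ^+ 3) ->
  pint (c - x) (fun t => ln (Num.max (h t) e)).
Proof.
move=> M1 x0 xc e0 e1 mh hM; have a0 : 0 < c - x by rewrite subr_gt0.
apply: (@pint_le _ _ _ (fun t => ln_growth M x t - cst (ln e) t)) => //.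
- exact: measurable_ln_max.
- by apply: pintB; [exact: (pmean_ln_growth M x0 xc).1|exact: pint_cst].
- by move=> t; exact: ln_max_bound.
Qed.

(* Subharmonicity of [ln |F|], improved by a common zero [rho] of the approximants
   (vacuous when [rho] is outside the half-plane). *)
Lemma pmean_ln_max_ge (M x c e : R) (rho : R[i]) (g : nat -> R[i] -> R[i]) :
  1 / 4 <= x -> x < c -> 1 <= M -> 0 < e -> e <= 1 ->
  (forall N, halfplane_rational (g N)) ->
  (forall N t, cmod (g N (Complex x t)) <= M * cmod (Complex x t + 2) ^+ 3) ->
  (forall t, cmod (g N (Complex x t) - F (Complex x t)) @[N --> \oo] --> 0) ->
  cmod (g N (Complex c 0) - F (Complex c 0)) @[N --> \oo] --> 0 ->
  F (Complex c 0) != 0 -> (0 <= complex.Re rho -> forall N, g N rho = 0) ->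
  ln (cmod (F (Complex c 0))) + green x c rho <=
    pmean (c - x) (fun t => ln (Num.max (cmod (F (Complex x t))) e)).
Proof.
move=> x4 xc M1 e0 e1 rg gM gF gc Fc0 grho.
have x0 : 0 <= x by lra.
have a0 : 0 < c - x by rewrite subr_gt0.
have mg N : measurable_fun setT (fun t => cmod (g N (Complex x t))).
  by apply: measurable_cmod; apply: cmeasurable_halfplane_rational (rg N) _ _ => //; exact: cmeasurable_line.
have cg : cmod (g N (Complex c 0)) @[N --> \oo] --> cmod (F (Complex c 0)) by exact: cvg_cmod_dist.
have Fc_gt0 : 0 < cmod (F (Complex c 0)) by rewrite cmod_gt0.
have [_ cvm] := @pmean_dominated _ (c - x) (fun N t => ln (Num.max (cmod (g N (Complex x t))) e))
  (fun t => ln (Num.max (cmod (F (Complex x t))) e))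
  (fun t => ln_growth M x t - cst (ln e) t) a0
  (fun N => measurable_ln_max e (mg N)) (measurable_ln_max e (measurable_cmod_limit x4))
  (pintB (pmean_ln_growth M x0 xc).1 (pint_cst (ln e) a0))
  (fun N t => ln_max_bound M1 x0 e0 e1 (gM N t)) (fun t => cvg_ln_max e0 (cvg_cmod_dist (gF t))).
have cl : ln (cmod (g N (Complex c 0))) + green x c rho @[N --> \oo] -->
    ln (cmod (F (Complex c 0))) + green x c rho.
  apply: cvgD; last exact: cvg_cst.
  by have := cvg_comp _ _ cg (continuous_ln Fc_gt0).
apply: (ler_cvg_to cl cvm); near=> N.
have gc0 : g N (Complex c 0) != 0.
  by rewrite -cmod_gt0; near: N; exact: (cvgr_gt _ cg _ Fc_gt0).
have c0 : 0 <= c by lra.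
have [rs [rsE /(_ x c x0 xc gc0) [iN mN]]] := pmean_ln_halfplane_rational (rg N) (c0 : 0 <= complex.Re (Complex c 0)) gc0.
(* Truncation increases the logarithm only off the zeros of [g N]: at a zero, [ln 0 = 0] is at least
   [ln e]. Hence the comparison almost everywhere. *)
apply: (@le_trans _ _ (pmean (c - x) (fun t => ln (cmod (g N (Complex x t)))))); last first.
  apply: le_pmean_ae => //; first exact: (pint_ln_max M1 x0 xc e0 e1 (mg N) (gM N)).
  move: (ae_notin_seq [seq complex.Im z | z <- rs]); apply: aeS => t trs.
  have gt0 : g N (Complex x t) != 0.
    rewrite rsE//; apply: contraNN trs => trs; apply/mapP; by exists (Complex x t).
  by rewrite ler_ln ?posrE ?lt_max ?cmod_gt0 ?gt0// le_max lexx.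
rewrite mN lerD2l.
have g0 z : z \in rs -> 0 <= green x c z.
  move=> zrs; have [zx|xz] := leP (complex.Re z) x; first by rewrite green_left.
  apply: green_ge0 => //; apply: contraNneq gc0 => cz.
  by rewrite rsE// cz.
have [rx|xr] := leP (complex.Re rho) x.
  by rewrite green_left// big_seq sumr_ge0.
have rho0 : 0 <= complex.Re rho by lra.
have rrs : rho \in rs by rewrite -rsE// grho.
rewrite (big_rem _ rrs)/= lerDl big_seq sumr_ge0// => z /mem_rem; exact: g0.
Unshelve. all: by end_near. Qed.

Variable A : R.
Hypothesis A1 : 1 <= A.
Hypothesis delta1 : forall N, delta N <= 1.
Hypothesis F_le : forall s, 1 / 4 <= complex.Re s -> cmod (F s) <= A * cmod (s + 2) ^+ 3.
Hypothesis F1 : F 1 = 1.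
(** Controls the value at the remote pole [x + t] in Jensen's formula, uniformly in [t]. *)
Hypothesis F_ge1 : forall X : R, 2 <= X -> 1 <= cmod (F (Complex X 0)).

Lemma r_le N s : 1 / 4 <= complex.Re s -> cmod (r N s) <= (A + 1) * cmod (s + 2) ^+ 3.
Proof.
move=> s4; rewrite -[r N s](subrK (F s)) addrC mulrDl mul1r.
apply: le_trans (cmod_le_add _ _) _; apply: lerD; first exact: F_le.
by apply: le_trans (r_F _ s4) _; rewrite ler_piMl// exprn_ge0// cmod_ge0.
Qed.

Lemma cmodD2X3_ge1 (s : R[i]) : 1 / 4 <= complex.Re s -> 1 <= cmod (s + 2) ^+ 3.
Proof. by move=> s4; rewrite exprn_ege1// cmodD2_ge1//; lra. Qed.

Lemma r_sub_le N s z (K : R) : 1 / 4 <= complex.Re s -> cmod z <= K ->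
  cmod (r N s - z) <= (A + 1 + K) * cmod (s + 2) ^+ 3.
Proof.
move=> s4 zK; apply: le_trans (cmod_le_sub _ _) _; rewrite mulrDl; apply: lerD; first exact: r_le.
have K0 : 0 <= K by apply: le_trans zK; exact: cmod_ge0.
by apply: le_trans zK _; rewrite ler_peMr ?cmodD2X3_ge1.
Qed.

(** Removes the truncation. The bound [l], uniform in [e], is what prevents the decreasing means
    from diverging and so gives integrability of the limit. *)
Lemma pmean_ln_limit (x c l : R) : 1 / 4 <= x -> x < c ->
  (forall e, 0 < e -> e <= 1 -> l <= pmean (c - x) (fun t => ln (Num.max (cmod (F (Complex x t))) e))) ->
  pint (c - x) (fun t => ln (cmod (F (Complex x t)))) /\
  (pmean (c - x) (fun t => ln (Num.max (cmod (F (Complex x t))) n.+1%:R^-1)) @[n --> \oo] -->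
   pmean (c - x) (fun t => ln (cmod (F (Complex x t))))).
Proof.
move=> x4 xc hl; have x0 : 0 <= x by lra.
have a0 : 0 < c - x by rewrite subr_gt0.
have n0 n : 0 < n.+1%:R^-1 :> R by rewrite invr_gt0.
have n1 n : n.+1%:R^-1 <= 1 :> R by rewrite invf_le1// ler1n.
have mF := measurable_cmod_limit x4.
apply: (@pmean_decreasing_limit _ _ (fun n t => ln (Num.max (cmod (F (Complex x t))) n.+1%:R^-1)) _ l) => //.
- by move=> n; apply: (pint_ln_max A1 x0 xc (n0 n) (n1 n) mF) => t; exact: F_le.
- by apply: measurableT_comp mF; exact: measurable_ln.
- move=> n t; rewrite ler_ln ?posrE ?lt_max ?n0 ?orbT// ge_max le_max lexx/=.
  by rewrite le_max lef_pV2 ?posrE// ler_nat leqnSn orbT.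
- by move=> n; exact: hl.
- move=> t; have [Ft0|Ft0] := eqVneq (cmod (F (Complex x t))) 0; [right|left].
    apply/cvgrNyPle => B; near=> n.
    rewrite Ft0 max_r ?(ltW (n0 n))// lnV ?posrE// lerNl.
    rewrite -[leLHS]expRK ler_ln ?posrE ?expR_gt0//; apply: (@le_trans _ _ n%:R); last by rewrite ler_nat.
    near: n; exact: nbhs_infty_ger.
  have Ft : 0 < cmod (F (Complex x t)) by rewrite lt_neqAle eq_sym Ft0 cmod_ge0.
  apply: cvg_near_cst; near=> n; rewrite max_l//.
  apply: ltW; near: n.
  exact: (cvgr_lt _ (@cvg_harmonic R) _ Ft).
Unshelve. all: by end_near. Qed.

Lemma F1E : F (Complex 1 0) = 1. Proof. exact: F1. Qed.

Lemma pmean_ln_zero_gt0 (x : R) rho : 1 / 2 <= x -> x < 1 -> x < complex.Re rho -> F rho = 0 ->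
  pint (1 - x) (fun t => ln (cmod (F (Complex x t)))) /\
  0 < pmean (1 - x) (fun t => ln (cmod (F (Complex x t)))).
Proof.
move=> x2 x1 xr Fr; have x4 : 1 / 4 <= x by lra.
have r4 : 1 / 4 <= complex.Re rho by lra.
have r1 : Complex 1 0 != rho.
  by apply: contra_eq_neq Fr => <-; rewrite F1E oner_neq0.
(* A bound for [cmod (r N rho)] uniform in [N], so that the shifted approximants keep a common
   growth bound. *)
pose K := (A + 1) * cmod (rho + 2) ^+ 3.
have K0 : 0 <= K by apply: le_trans (r_le 0 r4); exact: cmod_ge0.
have cv s : 1 / 4 <= complex.Re s -> cmod (r N s - r N rho - F s) @[N --> \oo] --> 0.
  move=> s4; apply: (@squeeze_cvgr _ _ _ _ (cst 0) (fun N => cmod (r N s - F s) + cmod (r N rho - F rho))).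
  - near=> N; rewrite cmod_ge0/=.
    rewrite (_ : _ - _ - _ = (r N s - F s) - (r N rho - F rho)); last by rewrite Fr; ring.
    exact: cmod_le_sub.
  - exact: cvg_cst.
  - by rewrite -[X in _ --> X]addr0; apply: cvgD; exact: cvg_r.
have hl e : 0 < e -> e <= 1 ->
    green x 1 rho <= pmean (1 - x) (fun t => ln (Num.max (cmod (F (Complex x t))) e)).
  move=> e0 e1.
  have := @pmean_ln_max_ge (A + 1 + K) x 1 e rho (fun N s => r N s - r N rho) x4 x1.
  rewrite F1E cmod1 ln1 add0r; apply => //.
  - by rewrite ler_wpDr// lerDr (le_trans ler01).
  - by move=> N; exact: halfplane_rational_subC.
  - by move=> N t; apply: r_sub_le => //; exact: r_le.
  - by move=> t; exact: cv.
  - have := @cv (Complex 1 0); rewrite F1E; apply => /=; lra.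
  - by move=> _ N; rewrite subrr.
have [i cvm] := pmean_ln_limit x4 x1 hl; split=> //.
apply: lt_le_trans (green_gt0 x1 xr r1) _.
apply: (ler_cvg_to (cvg_cst (green x 1 rho)) cvm); near=> n.
by apply: hl; [rewrite invr_gt0|rewrite invf_le1// ler1n].
Unshelve. all: by end_near. Qed.

(** On the rectangle [cmod (s + 2)] is at most [(x + t) + t + 2]. *)
Lemma r_near N (x t m : R) s : 0 <= delta N -> delta N * (x + 2 * t + 2) ^+ 3 <= m -> 1 / 4 <= complex.Re s ->
  complex.Re s <= x + t -> `|complex.Im s| <= t -> cmod (r N s - F s) <= m.
Proof.
move=> d0 dm s4 sx sy; apply: le_trans (r_F _ s4) _; apply: le_trans dm.
rewrite ler_wpM2l// ler_pXn2r ?nnegrE ?cmod_ge0//.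
  apply: le_trans (cmod_le_add _ _) _; rewrite cmod_nat lerD2r.
  by apply: le_trans (cmod_le_ReIm _) _; rewrite (ger0_norm (_ : 0 <= complex.Re s)); lra.
by have := normr_ge0 (complex.Im s); lra.
Qed.

(** Each summand is a comparison factor, from [green_near_boundary] or [green_far], times a bound
    for the total Green mass of the zeros: for the line [1 / 4] with pole [1], and for the line [x]
    with pole [x + t]. The [ln 2] pays for a value as small as [1 / 2] at the pole. *)
Definition jensen_error (x t eta : R) : R :=
  8 / 3 * (1 + 9 / (1 - x) ^+ 2) * eta * (ln (A + 2) + 3 * ln (1 + 2) + ln 2) +
  4 / t * (ln (A + 2) + 3 * ln (x + t + 2) + ln 2).

(* Zeros within [eta] of the line are few, by Jensen's formula on the line [Re = 1/4];
   zeros at distance more than [t] weigh little, by Jensen's formula with pole [x + t]. *)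
Lemma pmean_ln_r_sub_le (x t eta m : R) N z : 1 / 2 <= x -> x < 1 -> 2 <= t ->
  0 < eta -> eta <= (1 - x) / 2 -> 0 < m -> m <= 1 ->
  (forall s, x + eta <= complex.Re s -> complex.Re s <= x + t -> `|complex.Im s| <= t -> m <= cmod (F s)) ->
  cmod z <= m / 4 -> 0 <= delta N -> delta N * (x + 2 * t + 2) ^+ 3 <= m / 4 ->
  pint (1 - x) (fun u => ln (cmod (r N (Complex x u) - z))) /\
  pmean (1 - x) (fun u => ln (cmod (r N (Complex x u) - z))) <=
    ln (cmod (r N (Complex 1 0) - z)) + jensen_error x t eta.
Proof.
move=> x2 x1 t2 eta0 etax m0 m1 Fm zm d0 dm.
have near_F := r_near d0 dm.
have z1 : cmod z <= 1 by lra.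
pose f s := r N s - z.
have rf : halfplane_rational f by exact: halfplane_rational_subC.
(* The budget is [m / 4] for the approximation and [m / 4] for the shift [z]. *)
have f_ge s : 1 / 4 <= complex.Re s -> complex.Re s <= x + t -> `|complex.Im s| <= t ->
    cmod (F s) - m / 2 <= cmod (f s).
  move=> s4 sx sy; have h1 := near_F _ s4 sx sy.
  have h2 := cmod_dist (r N s) (F s); have h3 := cmod_dist (f s) (r N s).
  rewrite (_ : f s - r N s = - z) ?cmodN in h3; last by rewrite /f; ring.
  by move: (le_trans h2 h1) (le_trans h3 zm); rewrite !ler_norml => /andP[? ?] /andP[? ?]; lra.
have f1 : 1 / 2 <= cmod (f (Complex 1 0)).
  have := f_ge (Complex 1 0); rewrite F1E cmod1 /= normr0 => h.
  by have := h ltac:(lra) ltac:(lra) ltac:(lra); lra.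
have fT : 1 / 2 <= cmod (f (Complex (x + t) 0)).
  have := f_ge (Complex (x + t) 0); rewrite /= normr0 => h.
  have := h ltac:(lra) ltac:(lra) ltac:(lra); have := @F_ge1 (x + t) ltac:(lra); lra.
have f10 : f (Complex 1 0) != 0 by rewrite -cmod_gt0; lra.
have fT0 : f (Complex (x + t) 0) != 0 by rewrite -cmod_gt0; lra.
have [rs [rsE J]] := pmean_ln_halfplane_rational rf (ler01 : 0 <= complex.Re (Complex 1 0)) f10.
have x0 : 0 <= x by lra.
have [i1 e1] := J x 1 x0 x1 f10.
have [i2 e2] := J (1 / 4) 1 ltac:(lra) ltac:(lra) f10.
have xt : x < x + t by lra.
have [i3 e3] := J x (x + t) x0 xt fT0.
split=> //; rewrite e1 lerD2l.
have A21 : 1 <= A + 2 by have := A1; lra.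
have f_le s : 1 / 4 <= complex.Re s -> cmod (f s) <= (A + 2) * cmod (s + 2) ^+ 3.
  move=> s4; have := r_sub_le N s4 z1.
  by rewrite (_ : A + 1 + 1 = A + 2)//; ring.
(* Jensen's formula read backwards: the mean is at most that of the growth majorant and the value at
   the pole is at least [- ln 2], which bounds the Green mass of all zeros. *)
have sum_le (y c : R) : 1 / 4 <= y -> y < c -> 1 / 2 <= cmod (f (Complex c 0)) ->
    pint (c - y) (fun u => ln (cmod (f (Complex y u)))) ->
    pmean (c - y) (fun u => ln (cmod (f (Complex y u)))) =
      ln (cmod (f (Complex c 0))) + \sum_(w <- rs) green y c w ->
    \sum_(w <- rs) green y c w <= ln (A + 2) + 3 * ln (c + 2) + ln 2.
  move=> y4 yc fc ic ec.
  have y0 : 0 <= y by lra.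
  have [ig eg] := pmean_ln_growth (A + 2) y0 yc.
  have c_gt0 : 0 < c - y by lra.
  have : pmean (c - y) (fun u => ln (cmod (f (Complex y u)))) <= pmean (c - y) (ln_growth (A + 2) y).
    by apply: le_pmean => // u; apply: ln_le_growth => //; exact: f_le.
  rewrite ec eg.
  have : - ln 2 <= ln (cmod (f (Complex c 0))).
    by rewrite -lnV ?posrE// ler_ln ?posrE//; lra.
  lra.
have h14 := sum_le (1 / 4) 1 ltac:(lra) ltac:(lra) f1 i2 e2.
have hT := sum_le x (x + t) ltac:(lra) xt fT i3 e3.
have k0 : 0 <= 8 / 3 * (1 + 9 / (1 - x) ^+ 2) * eta.
  by rewrite mulr_ge0 ?(ltW eta0)// mulr_ge0 ?addr_ge0 ?divr_ge0 ?sqr_ge0//.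
have t0 : 0 <= 4 / t by rewrite divr_ge0//; lra.
apply: (@le_trans _ _ (8 / 3 * (1 + 9 / (1 - x) ^+ 2) * eta * (\sum_(w <- rs) green (1 / 4) 1 w) +
    4 / t * (\sum_(w <- rs) green x (x + t) w))); last first.
  by rewrite /jensen_error; apply: lerD; apply: ler_wpM2l.
rewrite !mulr_sumr -big_split/= big_seq [leRHS]big_seq; apply: ler_sum => w wrs.
have [wx|xw] := leP (complex.Re w) x.
  rewrite green_left//; apply: addr_ge0; apply: mulr_ge0 => //.
    have [w4|w4] := leP (complex.Re w) (1 / 4); first by rewrite green_left//; lra.
    apply: green_ge0; first by lra.
    by apply: contraNneq f10 => ->; rewrite rsE//; lra.
  by rewrite green_left.
have w0 : 0 <= complex.Re w by lra.
have fw : f w = 0 by apply/eqP; rewrite rsE.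
have w1 : Complex 1 0 != w by apply: contraNneq f10 => ->; rewrite fw.
have wT : Complex (x + t) 0 != w by apply: contraNneq fT0 => ->; rewrite fw.
have g1 : 0 <= green (1 / 4) 1 w by apply: green_ge0 => //; lra.
have gT : 0 <= green x (x + t) w by exact: green_ge0.
(* A zero to the right of the line is farther than [t], or within [eta] of the line, or in the
   rectangle of [Fm]; the first two cases are each paid by one summand. *)
have [far|near] := leP (t ^+ 2) ((complex.Re w - x) ^+ 2 + complex.Im w ^+ 2).
  apply: le_trans (green_far x2 x1 t2 (ltW xw) far w1 wT) _.
  by rewrite lerDr mulr_ge0.
have wRe : complex.Re w <= x + t.
  rewrite -lerBlDl -(@ler_pXn2r _ 2)// ?nnegrE ?subr_ge0 ?(ltW xw)//; last by lra.
  by apply: le_trans (ltW near); rewrite lerDl sqr_ge0.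
have wIm : `|complex.Im w| <= t.
  rewrite -(@ler_pXn2r _ 2)// ?nnegrE ?normr_ge0//; last by lra.
  by rewrite real_normK ?num_real//; apply: le_trans (ltW near); rewrite lerDr sqr_ge0.
have [wm|wm] := leP (complex.Re w) (x + eta).
  apply: le_trans (green_near_boundary x2 x1 eta0 etax (ltW xw) wm w1) _.
  by rewrite lerDl mulr_ge0.
(* The remaining case is void: [Fm] gives [m <= cmod (F w)], while [f w = 0] forces
   [cmod (F w) <= m / 2]. *)
have := f_ge w ltac:(lra) wRe wIm; rewrite fw cmod0.
have := Fm w (ltW wm) wRe wIm; lra.
Qed.

(** The average of [pmean_ln_r_sub_le] over the circle [cmod z = m / 4]; its error term is the same
    for all these [z]. *)
Lemma pmean_ln_max_r_le (x t eta m : R) N : 1 / 2 <= x -> x < 1 -> 2 <= t ->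
  0 < eta -> eta <= (1 - x) / 2 -> 0 < m -> m <= 1 ->
  (forall s, x + eta <= complex.Re s -> complex.Re s <= x + t -> `|complex.Im s| <= t -> m <= cmod (F s)) ->
  0 <= delta N -> delta N * (x + 2 * t + 2) ^+ 3 <= m / 4 ->
  pmean (1 - x) (fun u => ln (Num.max (cmod (r N (Complex x u))) (m / 4))) <=
    ln (Num.max (cmod (r N (Complex 1 0))) (m / 4)) + jensen_error x t eta.
Proof.
move=> x2 x1 t2 eta0 etax m0 m1 Fm d0 dm.
have e0 : 0 < m / 4 by lra.
have e1 : m / 4 <= 1 by lra.
have a0 : 0 < 1 - x by lra.
have x0 : 0 <= x by lra.
have x4 : 1 / 4 <= x by lra.
have A21 : 1 <= A + 2 by have := A1; lra.
have ce y : cmod ((m / 4)%:C%C * cayley y) = m / 4.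
  by rewrite cmodM cmod_cayley mulr1 cmod_real gtr0_norm.
have ce_le y : cmod ((m / 4)%:C%C * cayley y) <= m / 4 by rewrite ce.
have J y := pmean_ln_r_sub_le x2 x1 t2 eta0 etax m0 m1 Fm (ce_le y) d0 dm.
pose H u y := ln (cmod (r N (Complex x u) - (m / 4)%:C%C * cayley y)).
pose G y := ln (cmod (r N (Complex 1 0) - (m / 4)%:C%C * cayley y)) + cst (jensen_error x t eta) y.
have [iG mG] := pmean_ln_circle (r N (Complex 1 0)) e0.
have ic := pint_cst (jensen_error x t eta) (@ltr01 R).
have mH : measurable_fun setT (fun w : R * R => H w.1 w.2).
  apply: measurable_ln_cmod.
  rewrite (_ : (fun w => _) = fun w : R * R => r N (Complex x w.1) + (- (m / 4)%:C%C) * (Complex (-1) w.2 * (Complex 1 w.2)^-1)); last first.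
    by apply/funext => w; rewrite mulNr.
  have m1' : measurable_fun setT (fst : R * R -> R) by exact: measurable_fst.
  have m2' : measurable_fun setT (snd : R * R -> R) by exact: measurable_snd.
  apply: cmeasurableD.
    apply: cmeasurable_halfplane_rational (rational_r N) _ _ => //.
  apply: cmeasurableM; first exact: cmeasurable_cst.
  apply: cmeasurableM; first exact: cmeasurable_Complex (measurable_cst _) m2'.
  by apply: cmeasurableV; exact: cmeasurable_Complex (measurable_cst _) m2'.
have mr : measurable_fun setT (fun u => cmod (r N (Complex x u))).
  by apply: measurable_cmod; apply: cmeasurable_halfplane_rational (rational_r N) _ _ => //; exact: cmeasurable_line.
have ME : (fun u => pmean 1 (H u)) = fun u => ln (Num.max (cmod (r N (Complex x u))) (m / 4)).
  by apply/funext => u; rewrite /H (pmean_ln_circle _ e0).2.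
rewrite -mG -(pmean_cst (jensen_error x t eta) (@ltr01 R)) -pmeanD//.
rewrite -ME; apply: (@pmean_exchange _ _ _ _ (ln_growth (A + 2) x)) => //.
- move=> u y; apply: ln_le_growth => //.
  have := @r_sub_le N (Complex x u) ((m / 4)%:C%C * cayley y) 1 x4; rewrite ce => /(_ e1).
  by rewrite (_ : A + 1 + 1 = A + 2)//; ring.
- exact: (pmean_ln_growth _ x0 x1).1.
- by move=> u; exact: (pmean_ln_circle _ e0).1.
- rewrite ME; apply: (pint_ln_max A21 x0 x1 e0 e1 mr) => u.
  apply: le_trans (r_le N _) _ => //.
  by apply: ler_wpM2r; [rewrite exprn_ge0// cmod_ge0|have := A1; lra].
- by move=> y; exact: (J y).1.
- exact: pintD.
- by move=> y; exact: (J y).2.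
Qed.

Lemma delta_ge0 N : 0 <= delta N.
Proof.
have h : 1 / 4 <= complex.Re (1 : R[i]) by rewrite /=; lra.
have := le_trans (cmod_ge0 _) (r_F N h).
by rewrite pmulr_lge0// (lt_le_trans ltr01)// cmodD2X3_ge1.
Qed.

(** The level [e] is a quarter of a lower bound for [cmod F] on a rectangle, so it depends on [t]
    and [eta]. With these fixed, [N] tends to infinity and the term at the pole tends to
    [ln (cmod (F 1)) = 0]. *)
Lemma pmean_ln_max_le_error (x t eta : R) : 1 / 2 <= x -> x < 1 -> 2 <= t ->
  0 < eta -> eta <= (1 - x) / 2 -> (forall s, x < complex.Re s -> F s != 0) ->
  exists2 e, 0 < e & e <= 1 /\
    pmean (1 - x) (fun u => ln (Num.max (cmod (F (Complex x u))) e)) <= jensen_error x t eta.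
Proof.
move=> x2 x1 t2 eta0 etax nF.
have [|s sx|m' m'0 Fm'] := @cmod_limit_bounded_away (x + eta) (x + t) t; [by lra|by apply: nF; lra|].
pose m := Num.min m' 1.
have m0 : 0 < m by rewrite lt_min m'0 ltr01.
have m1 : m <= 1 by rewrite ge_min lexx orbT.
have e0 : 0 < m / 4 by rewrite divr_gt0.
have e1 : m / 4 <= 1 by lra.
have Fm s : x + eta <= complex.Re s -> complex.Re s <= x + t -> `|complex.Im s| <= t -> m <= cmod (F s).
  by move=> h1 h2 h3; apply: le_trans (Fm' s h1 h2 h3); rewrite ge_min lexx.
exists (m / 4) => //; split=> //.
have x0 : 0 <= x by lra.
have x4 : 1 / 4 <= x by lra.
have a0 : 0 < 1 - x by lra.
have A11 : 1 <= A + 1 by have := A1; lra.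
have mr N : measurable_fun setT (fun u => cmod (r N (Complex x u))).
  by apply: measurable_cmod; apply: cmeasurable_halfplane_rational (rational_r N) _ _ => //; exact: cmeasurable_line.
have h4 u : 1 / 4 <= complex.Re (Complex x u) by [].
have [_ cv] := @pmean_dominated _ (1 - x) (fun N u => ln (Num.max (cmod (r N (Complex x u))) (m / 4)))
  (fun u => ln (Num.max (cmod (F (Complex x u))) (m / 4)))
  (fun u => ln_growth (A + 1) x u - cst (ln (m / 4)) u) a0
  (fun N => measurable_ln_max (m / 4) (mr N)) (measurable_ln_max (m / 4) (measurable_cmod_limit x4))
  (pintB (pmean_ln_growth (A + 1) x0 x1).1 (pint_cst (ln (m / 4)) a0))
  (fun N u => ln_max_bound A11 x0 e0 e1 (r_le N (h4 u))) (fun u => cvg_ln_max e0 (cvg_cmod_dist (cvg_r (h4 u)))).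
have h1 : 1 / 4 <= complex.Re (Complex 1 0 : R[i]) by rewrite /=; lra.
have c1 : ln (Num.max (cmod (r N (Complex 1 0))) (m / 4)) + jensen_error x t eta @[N --> \oo] --> jensen_error x t eta.
  rewrite -[X in _ --> X]add0r; apply: cvgD; last exact: cvg_cst.
  have := cvg_ln_max e0 (cvg_cmod_dist (cvg_r h1)).
  by rewrite F1E cmod1 max_l// ln1.
apply: (ler_cvg_to cv c1).
have B0 : 0 < (x + 2 * t + 2) ^+ 3 by rewrite exprn_gt0//; lra.
have mB : 0 < m / 4 / (x + 2 * t + 2) ^+ 3 by rewrite divr_gt0.
near=> N; apply: pmean_ln_max_r_le => //; first exact: delta_ge0.
rewrite -ler_pdivlMr//; near: N.
move/cvgr0Pnorm_le : (delta0) => /(_ _ mB); apply: filterS => N.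
exact: le_trans (ler_norm _).
Unshelve. all: by end_near. Qed.

(** Each summand is made at most [k / 2]. Taking [t] to be a square [w ^+ 2] turns [ln t / t] into a
    term of order [w^-1] by the crude bound [ln w <= w]. *)
Lemma jensen_error_small (x k : R) : 1 / 2 <= x -> x < 1 -> 0 < k ->
  exists t eta : R, [/\ 2 <= t, 0 < eta, eta <= (1 - x) / 2 & jensen_error x t eta <= k].
Proof.
move=> x2 x1 k0.
pose L := ln (A + 2) + 3 * ln (1 + 2) + ln 2.
have L0 : 0 <= L.
  by rewrite !addr_ge0 ?mulr_ge0 ?ln_ge0//; have := A1; lra.
pose K := 8 / 3 * (1 + 9 / (1 - x) ^+ 2) * L.
have K0 : 0 <= K.
  by rewrite mulr_ge0// mulr_ge0 ?addr_ge0 ?divr_ge0 ?sqr_ge0//.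
(* The second summand will be at most [4 * (L + 6) / w]. *)
pose w := Num.max 2 (8 * (L + 6) / k).
have w2 : 2 <= w by rewrite le_max lexx.
have wk : 8 * (L + 6) / k <= w by rewrite le_max lexx orbT.
have w0 : 0 < w by apply: lt_le_trans w2.
pose eta := Num.min ((1 - x) / 2) (k / 2 / (K + 1)).
have eta0 : 0 < eta.
  by rewrite lt_min; apply/andP; split; rewrite !divr_gt0//; lra.
exists (w ^+ 2), eta; split=> //.
- by rewrite expr2; apply: (@le_trans _ _ (2 * 1)); [rewrite mulr1|apply: ler_pM => //; lra].
- by rewrite ge_min lexx.
rewrite /jensen_error -/L.
have -> : 8 / 3 * (1 + 9 / (1 - x) ^+ 2) * eta * L = K * eta by rewrite /K; ring.
have h1 : K * eta <= k / 2.
  apply: (@le_trans _ _ (K * (k / 2 / (K + 1)))).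
    by rewrite ler_wpM2l// ge_min lexx orbT.
  rewrite mulrA ler_pdivrMr; last by lra.
  by rewrite mulrC ler_wpM2l//; lra.
have h2 : 4 / w ^+ 2 * (ln (A + 2) + 3 * ln (x + w ^+ 2 + 2) + ln 2) <= k / 2.
  have lw : ln w <= w.
    have : -1 < w - 1 by lra.
    by move=> /le_ln1Dx; rewrite subrKC => h; lra.
  have lt3 : ln (x + w ^+ 2 + 2) <= ln (1 + 2) + 2 * ln w.
    rewrite mulr_natl -lnXn// -lnM ?posrE ?exprn_gt0// ler_ln ?posrE ?mulr_gt0 ?exprn_gt0//; last first.
      by rewrite !addr_gt0 ?exprn_gt0//; lra.
    have : 4 <= w ^+ 2 by rewrite (_ : 4 = 2 ^+ 2); [rewrite ler_pXn2r ?nnegrE//; lra|ring].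
    lra.
  have h3 : ln (A + 2) + 3 * ln (x + w ^+ 2 + 2) + ln 2 <= L * w + 6 * w.
    apply: (@le_trans _ _ (L + 6 * w)); first by rewrite /L; lra.
    rewrite lerD2r -[leLHS]mulr1 ler_wpM2l//; lra.
  rewrite mulrAC ler_pdivrMr ?exprn_gt0//.
  apply: (@le_trans _ _ (4 * (L * w + 6 * w))); first by rewrite ler_pM2l.
  move: wk; rewrite ler_pdivrMr// => wk.
  rewrite (_ : 4 * (L * w + 6 * w) = (8 * (L + 6)) * w / 2); last by field.
  rewrite (_ : k / 2 * w ^+ 2 = (w * k) * w / 2); last by field.
  by rewrite ler_pM2r// ler_pM2r.
lra.
Qed.

(** Subharmonicity gives a mean of at least [ln (cmod (F 1)) = 0]. Conversely, truncated means
    decrease with the level: once a single level [e] gives at most [k], so do all smaller ones and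
    their limit. *)
Lemma pmean_ln_nonvanishing (x : R) : 1 / 2 <= x -> x < 1 ->
  (forall s, x < complex.Re s -> F s != 0) ->
  pint (1 - x) (fun t => ln (cmod (F (Complex x t)))) /\
  pmean (1 - x) (fun t => ln (cmod (F (Complex x t)))) = 0.
Proof.
move=> x2 x1 nF; have x4 : 1 / 4 <= x by lra.
have x0 : 0 <= x by lra.
have a0 : 0 < 1 - x by lra.
have A11 : 1 <= A + 1 by have := A1; lra.
have hl e : 0 < e -> e <= 1 -> 0 <= pmean (1 - x) (fun t => ln (Num.max (cmod (F (Complex x t))) e)).
  (* The choice [rho = -1], outside the half-plane, makes the Green term and the condition on common
     zeros void. *)
  move=> e0 e1; have Rem1 : complex.Re (-1 : R[i]) <= x by apply: le_trans x0; exact: lerN10.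
  have := @pmean_ln_max_ge (A + 1) x 1 e (-1) r x4 x1.
  rewrite (green_left x1 Rem1) F1E cmod1 ln1 addr0; apply => //.
  - by move=> N t; exact: r_le.
  - by move=> t; exact: cvg_r.
  - by have := @cvg_r (Complex 1 0); rewrite F1E; apply => /=; lra.
  - by rewrite [complex.Re _](_ : _ = -1)// oppr_ge0 ler10.
have [i cv] := pmean_ln_limit x4 x1 hl; split=> //.
apply/eqP; rewrite eq_le; apply/andP; split; last first.
  apply: (ler_cvg_to (cvg_cst 0) cv); near=> n.
  by apply: hl; [rewrite invr_gt0|rewrite invf_le1// ler1n].
apply/ler_addgt0Pr => k k0; rewrite add0r.
have [t [eta [t2 eta0 etax err]]] := jensen_error_small x2 x1 k0.
have [e e0 [e1 he]] := pmean_ln_max_le_error x2 x1 t2 eta0 etax nF.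
apply: (ler_cvg_to cv (cvg_cst k)); near=> n.
apply: le_trans (le_trans he err).
have n0 : 0 < n.+1%:R^-1 :> R by rewrite invr_gt0.
have ne : n.+1%:R^-1 <= e.
  by apply: ltW; near: n; exact: (cvgr_lt _ (@cvg_harmonic R) _ e0).
have mF := measurable_cmod_limit x4.
have FA t' : cmod (F (Complex x t')) <= A * cmod (Complex x t' + 2) ^+ 3 by exact: F_le.
apply: le_pmean => //.
- by apply: (pint_ln_max A1 x0 x1 n0 _ mF FA); rewrite invf_le1// ler1n.
- exact: (pint_ln_max A1 x0 x1 e0 e1 mF FA).
- move=> u; rewrite ler_ln ?posrE ?lt_max ?n0 ?e0 ?orbT// ge_max le_max lexx/=.
  by rewrite le_max ne orbT.
Unshelve. all: by end_near. Qed.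

End uniform_limit.

(** * The complex exponential *)

Section complex_exponential.
Context {R : realType}.
Implicit Types (a b x : R) (z w s : R[i]).

Lemma expR_sub1_le a : expR a - 1 <= a * expR a.
Proof.
have : (1 - a) * expR a <= expR (- a) * expR a by rewrite ler_wpM2r ?expR_ge0// expR_ge1Dx.
by rewrite -expRD addNr expR0; lra.
Qed.

Lemma normr_expR_sub1 a : `|expR a - 1| <= `|a| * Num.max 1 (expR a).
Proof.
have h1 := expR_ge1Dx a; have h3 := expR_sub1_le a.
have [a0|a0] := leP 0 a.
  rewrite !ger0_norm//; last by lra.
  by apply: le_trans h3 _; rewrite ler_wpM2l// le_max lexx orbT.
have : a * expR a <= 0 by rewrite mulr_le0_ge0 ?expR_ge0// ltW.
move=> h4; rewrite !ler0_norm; [|lra..].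
apply: (@le_trans _ _ (- a * 1)); first by lra.
by rewrite ler_wpM2l ?le_max ?lexx//; lra.
Qed.

Lemma normr_expR_sub1D a : `|expR a - 1 - a| <= a ^+ 2 * Num.max 1 (expR a).
Proof.
have h1 := expR_ge1Dx a; have h3 := expR_sub1_le a.
rewrite ger0_norm; last by lra.
apply: (@le_trans _ _ (a * (expR a - 1))); first by lra.
apply: le_trans (ler_norm _) _; rewrite normrM -(real_normK (num_real a)) expr2 -mulrA.
by rewrite ler_wpM2l// normr_expR_sub1.
Qed.

Lemma normr_sin_le b : `|sin b| <= `|b|.
Proof.
wlog b0 : b / 0 <= b.
  move=> h; have [/h//|b0] := leP 0 b.
  by rewrite -normrN -sinN -(normrN b); apply: h; rewrite oppr_ge0 ltW.
have [c _] := @MVT_segment R sin cos 0 b b0 (fun x _ => is_derive_sin x)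
  (continuous_subspaceT (@continuous_sin R)).
rewrite sin0 !subr0 => ->; rewrite normrM ler_piMl//.
by rewrite ler_norml cos_geN1 cos_le1.
Qed.

Lemma cos_sub1 b : cos b - 1 = - (2 * sin (b / 2) ^+ 2).
Proof.
rewrite {1}(_ : b = (b / 2) *+ 2); last by rewrite -mulr_natr divfK.
by rewrite cos_mulr2n -mulr_natl sin2cos2; ring.
Qed.

Lemma normr_cos_sub1 b : `|cos b - 1| <= b ^+ 2 / 2.
Proof.
rewrite cos_sub1.
have -> : b ^+ 2 / 2 = 2 * `|b / 2| ^+ 2 by rewrite real_normK ?num_real//; field.
rewrite normrN normrM ger0_norm// ler_pM2l// normrX ler_pXn2r ?nnegrE//.
exact: normr_sin_le.
Qed.

(** By the mean value theorem the error is [(cos c - 1) * b] with [0 <= c <= b], and the linear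
    bound [c] for the first factor is enough for a quadratic remainder. *)
Lemma normr_sin_sub b : `|sin b - b| <= b ^+ 2.
Proof.
wlog b0 : b / 0 <= b.
  move=> h; have [/h//|b0] := leP 0 b.
  by rewrite -normrN opprD -sinN -sqrrN; apply: h; rewrite oppr_ge0 ltW.
have [c cb] := @MVT_segment R sin cos 0 b b0 (fun x _ => is_derive_sin x)
  (continuous_subspaceT (@continuous_sin R)).
rewrite sin0 !subr0 => ->.
have /andP[c0 lecb] : 0 <= c <= b by move: cb; rewrite in_itv/=.
rewrite (_ : cos c * b - b = (cos c - 1) * b); last by ring.
rewrite normrM (ger0_norm b0) expr2 ler_wpM2r//.
rewrite cos_sub1.
rewrite normrN normrM normrX ger0_norm//.
apply: (@le_trans _ _ (2 * `|sin (c / 2)|)).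
  rewrite ler_pM2l// expr2 ler_piMl//.
  by rewrite ler_norml sin_geN1 sin_le1.
have := normr_sin_le (c / 2); rewrite (ger0_norm (_ : 0 <= c / 2)); last by lra.
by lra.
Qed.

Definition cexp z : R[i] :=
  Complex (expR (complex.Re z) * cos (complex.Im z)) (expR (complex.Re z) * sin (complex.Im z)).

Lemma cexpD z w : cexp (z + w) = cexp z * cexp w.
Proof.
case: z w => [a b] [c d]; rewrite /cexp/= expRD cosD sinD.
by congr Complex; ring.
Qed.

Lemma cexp0 : cexp 0 = 1.
Proof. by rewrite /cexp/= expR0 cos0 sin0 mulr1 mulr0. Qed.

Lemma cexp_mulrn z n : cexp (z *+ n) = cexp z ^+ n.
Proof. by elim: n => [|n ih]; rewrite ?mulr0n ?cexp0 ?expr0// mulrS exprS cexpD ih. Qed.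

Lemma cmod_cexp z : cmod (cexp z) = expR (complex.Re z).
Proof.
rewrite cmodE/= !exprMn -mulrDr cos2Dsin2 mulr1.
by rewrite sqrtr_sqr ger0_norm ?expR_ge0.
Qed.

Lemma cpowrE x s : 0 < x -> cpowr x s = cexp (s * (ln x)%:C%C).
Proof.
case: s => a b x0; rewrite /cpowr /powR gt_eqF//= /cexp/=.
by rewrite !mulr0 subr0 add0r.
Qed.

(** The factor [Num.max 1 _] covers both signs of the real part: it is [1] in [cexpN_inv1D], but can
    exceed [1] in [zeta_num_succ] when [complex.Re s > 1]. *)
Lemma cmod_cexp_sub1D z :
  cmod (cexp z - 1 - z) <= 3 * cmod z ^+ 2 * Num.max 1 (expR (complex.Re z)).
Proof.
case: z => a b; rewrite sqr_cmod/=.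
set m := Num.max _ _; apply: le_trans (cmod_le_ReIm _) _ => /=.
have m0 : 0 <= m by rewrite le_max ler01.
have em : expR a <= m by rewrite le_max lexx orbT.
have h1 : `|expR a * cos b - 1 - a| <= a ^+ 2 * m + m * (b ^+ 2 / 2).
  rewrite (_ : _ - a = (expR a - 1 - a) + expR a * (cos b - 1)); last by ring.
  apply: le_trans (ler_normD _ _) _; rewrite lerD ?normr_expR_sub1D// normrM.
  by rewrite ler_pM// ?normr_cos_sub1// ger0_norm ?expR_ge0.
have h2 : `|expR a * sin b - 0 - b| <= m * b ^+ 2 + `|b| * (`|a| * m).
  rewrite (_ : _ - b = expR a * (sin b - b) + b * (expR a - 1)); last by ring.
  apply: le_trans (ler_normD _ _) _; rewrite !normrM lerD//.
    by rewrite ler_pM// ?normr_sin_sub// ger0_norm ?expR_ge0.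
  by rewrite ler_wpM2l// normr_expR_sub1.
apply: le_trans (lerD h1 h2) _.
have h3 : `|b| * `|a| <= (a ^+ 2 + b ^+ 2) / 2.
  rewrite -(real_normK (num_real a)) -(real_normK (num_real b)).
  by have := sqr_ge0 (`|a| - `|b|); rewrite sqrrB; lra.
have : `|b| * `|a| * m <= (a ^+ 2 + b ^+ 2) / 2 * m by rewrite ler_wpM2r.
have := mulr_ge0 (sqr_ge0 a) m0; have := mulr_ge0 (sqr_ge0 b) m0.
lra.
Qed.

End complex_exponential.

(** * The function (s - 1) zeta(s) *)

Section zeta_numerator.
Context {R : realType}.
Implicit Types (s z : R[i]) (N : nat).

(** [(s - 1) * zeta_approx s N] with the division cleared, hence meaningful at [s = 1] too. *)
Definition zeta_num s N : R[i] :=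
  (s - 1) * \sum_(0 <= n < N) cpowr n.+1%:R (- s) + cpowr N%:R (1 - s).

(* [N^(-1/4)]: its decrements dominate [N^(-5/4)], hence the increments of [zeta_num]. *)
Definition root4_inv N : R := expR (- (ln N%:R / 4)).

Lemma root4_inv_gt0 N : 0 < root4_inv N. Proof. exact: expR_gt0. Qed.

Lemma ln_succ_sub N : (0 < N)%N ->
  (N.+1%:R)^-1 <= ln N.+1%:R - ln N%:R :> R /\ ln N.+1%:R - ln N%:R <= N%:R^-1 :> R.
Proof.
move=> N0; have N0' : 0 < N%:R :> R by rewrite ltr0n.
have NS : N.+1%:R = N%:R + 1 :> R by rewrite -natr1.
split.
  have : -1 < - N.+1%:R^-1 :> R by rewrite ltrN2 invf_lt1 ?ltr0n// ltr1n.
  move=> /le_ln1Dx.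
  rewrite (_ : 1 + _ = N%:R / N.+1%:R); last first.
    by rewrite NS; field; lra.
  by rewrite ln_div ?posrE ?ltr0n// lerNr opprB.
have : -1 < N%:R^-1 :> R by apply: lt_trans (_ : 0 < _); [lra|rewrite invr_gt0].
move=> /le_ln1Dx.
rewrite (_ : 1 + _ = N.+1%:R / N%:R); last first.
  by rewrite NS; field; lra.
by rewrite ln_div ?posrE ?ltr0n.
Qed.

(** Since [ln N.+1%:R - ln N%:R >= (2 * N%:R)^-1], consecutive terms have quotient at least
    [1 + (8 * N%:R)^-1]; the [9] comes from [8 * N + 1 <= 9 * N]. *)
Lemma root4_inv_sub N : (0 < N)%N -> root4_inv N / N%:R <= 9 * (root4_inv N - root4_inv N.+1).
Proof.
move=> N0; have N0' : 1 <= N%:R :> R by rewrite ler1n.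
have NS : N.+1%:R = N%:R + 1 :> R by rewrite -natr1.
have [u1 _] := ln_succ_sub N0.
have u2 : (8 * N%:R)^-1 <= (ln N.+1%:R - ln N%:R) / 4 :> R.
  apply: (@le_trans _ _ (N.+1%:R^-1 / 4)); last by rewrite ler_pM2r.
  by rewrite -invfM lef_pV2 ?posrE ?NS; lra.
have h : root4_inv N.+1 * (1 + (8 * N%:R)^-1) <= root4_inv N.
  apply: (@le_trans _ _ (root4_inv N.+1 * expR ((ln N.+1%:R - ln N%:R) / 4))).
    rewrite ler_pM2l ?root4_inv_gt0//; apply: le_trans (expR_ge1Dx _).
    by rewrite lerD2l.
  by rewrite -expRD ler_expR; lra.
rewrite ler_pdivrMr; last lra.
have {}h : root4_inv N.+1 * (8 * N%:R + 1) <= 8 * N%:R * root4_inv N.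
  rewrite (_ : _ * _ = (8 * N%:R) * (root4_inv N.+1 * (1 + (8 * N%:R)^-1))); last by field; lra.
  by rewrite ler_pM2l//; lra.
have := root4_inv_gt0 N.+1; have := root4_inv_gt0 N.
set v := root4_inv N; set w := root4_inv N.+1 in h * => v0 w0.
rewrite -(@ler_pM2l _ (8 * N%:R + 1)); last by lra.
have h9 : w * (8 * N%:R + 1) * (9 * N%:R) <= 8 * N%:R * v * (9 * N%:R) by rewrite ler_pM2r//; lra.
have : v * 1 <= v * N%:R by rewrite ler_pM2l.
nra.
Qed.

Lemma cmodB1_le s : 1 / 4 <= complex.Re s -> cmod (s - 1) <= cmod (s + 2).
Proof.
case: s => a b /= a4; rewrite !cmodE/= ler_wsqrtr//.
rewrite subr0 !addr0 lerD2r; nra.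
Qed.

Lemma cexp_ln N : (0 < N)%N -> cexp (ln N%:R)%:C%C = N%:R :> R[i].
Proof.
move=> N0; rewrite /cexp/= cos0 sin0 mulr1 mulr0 lnK ?posrE ?ltr0n//.
by rewrite -(rmorph_nat (real_complex R)).
Qed.

(** With [u] the step of the logarithm, [N%:R] to the power [1 - s] is [N.+1%:R] to that power times
    [cexp ((s - 1) * u)]. Expanding the exponential, the first-order terms cancel up to
    [1 - N.+1%:R * u], and both this and the remainder [N.+1%:R * E] are of order [N^-1]. The
    constant is [63 = (1 + 6) * 9], from [hA], [hB] and [root4_inv_sub]. *)
Lemma zeta_num_succ s N : 1 / 4 <= complex.Re s -> (0 < N)%N ->
  cmod (zeta_num s N.+1 - zeta_num s N) <=
    63 * cmod (s + 2) ^+ 3 * (root4_inv N - root4_inv N.+1).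
Proof.
move=> s4 N0; have N1 : 1 <= N%:R :> R by rewrite ler1n.
have NS : N.+1%:R = N%:R + 1 :> R by rewrite -natr1.
pose L : R := ln N.+1%:R; pose l : R := ln N%:R; pose u := L - l.
have [u1 u2] := ln_succ_sub N0; rewrite -/L -/l -/u in u1 u2.
have u0 : 0 <= u by apply: le_trans u1; rewrite invr_ge0.
have l0 : 0 <= l by rewrite ln_ge0.
pose E := cexp ((s - 1) * u%:C%C) - 1 - (s - 1) * u%:C%C.
have -> : zeta_num s N.+1 - zeta_num s N =
    cexp (- s * L%:C%C) * ((s - 1) * (1 - N.+1%:R * u%:C%C) - N.+1%:R * E).
  rewrite /zeta_num big_nat_recr//= !cpowrE ?ltr0n// -/L -/l.
  have -> : cexp ((1 - s) * L%:C%C) = cexp (- s * L%:C%C) * N.+1%:R.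
    by rewrite -(cexp_ln (isT : 0 < N.+1)%N) -cexpD; congr cexp; ring.
  have -> : cexp ((1 - s) * l%:C%C) = cexp (- s * L%:C%C) * N.+1%:R * cexp ((s - 1) * u%:C%C).
    rewrite -(cexp_ln (isT : 0 < N.+1)%N) -!cexpD -/L /u rmorphB; congr cexp.
    by rewrite /=; ring.
  by rewrite /E; ring.
rewrite cmodM.
have Wu := cmodB1_le s4; have W1 : 1 <= cmod (s + 2) by apply: cmodD2_ge1; lra.
have Wd0 := cmod_ge0 (s - 1).
set W := cmod (s + 2) in Wu W1 *; set d := cmod (s - 1) in Wu Wd0.
pose m := Num.max 1 (expR ((complex.Re s - 1) * u)).
have m1 : 1 <= m by rewrite le_max lexx.
have hE : cmod E <= 3 * (d * u) ^+ 2 * m.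
  apply: le_trans (cmod_cexp_sub1D _) _.
  rewrite cmodM cmod_real (ger0_norm u0) -/d.
  rewrite (_ : complex.Re _ = (complex.Re s - 1) * u)//.
  by case: (s) => a b /=; rewrite mulr0 subr0.
have hA : cmod ((s - 1) * (1 - N.+1%:R * u%:C%C)) <= d / N%:R.
  rewrite cmodM -/d ler_wpM2l//.
  rewrite (_ : 1 - _ = (1 - N.+1%:R * u)%:C%C); last first.
    by rewrite -(rmorph_nat (real_complex R)) -rmorphM/= [RHS]rmorphB.
  rewrite cmod_real distrC ger0_norm.
    apply: (@le_trans _ _ (N.+1%:R * N%:R^-1 - 1)); first by rewrite lerD2r ler_pM2l ?ltr0n.
    by rewrite NS mulrDl mul1r divff; lra.
  rewrite subr_ge0; apply: (@le_trans _ _ (N.+1%:R * N.+1%:R^-1)); first by rewrite divff// pnatr_eq0.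
  by rewrite ler_pM2l ?ltr0n.
have hB : cmod (N.+1%:R * E) <= 6 * d ^+ 2 * m / N%:R.
  rewrite cmodM cmod_nat.
  apply: (@le_trans _ _ (N.+1%:R * (3 * (d * u) ^+ 2 * m))); first by rewrite ler_pM2l ?ltr0n.
  have nu : N.+1%:R * u ^+ 2 <= 2 / N%:R.
    apply: (@le_trans _ _ (N.+1%:R * N%:R^-1 ^+ 2)).
      by rewrite ler_pM2l ?ltr0n// ler_pXn2r ?nnegrE// invr_ge0; lra.
    rewrite expr2 mulrA ler_pM2r ?invr_gt0//; last by lra.
    by rewrite ler_pdivrMr; lra.
  have : 3 * d ^+ 2 * m * (N.+1%:R * u ^+ 2) <= 3 * d ^+ 2 * m * (2 / N%:R).
    by rewrite ler_wpM2l// !mulr_ge0 ?sqr_ge0//; lra.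
  by rewrite exprMn; lra.
(* The prefactor absorbs [m]: since [u = L - l], both exponents are at most [- l / 4]. *)
have hm : expR (- complex.Re s * L) * m <= root4_inv N.
  rewrite /m maxr_pMr ?expR_ge0// mulr1 -expRD ge_max !ler_expR.
  have h : 1 / 4 * l <= complex.Re s * l by rewrite ler_wpM2r.
  have lL : l <= L by rewrite -subr_ge0.
  have h' : complex.Re s * l <= complex.Re s * L by rewrite ler_wpM2l//; lra.
  rewrite -/l /u; move: lL l0 h h'; generalize L l => L' l' lL l0 h h'.
  by apply/andP; split; lra.
rewrite cmod_cexp (_ : complex.Re (- s * _) = - complex.Re s * L); last first.
  by case: (s) => a b /=; rewrite mulr0 subr0.
have hT : cmod ((s - 1) * (1 - N.+1%:R * u%:C%C) - N.+1%:R * E) <= 7 * W ^+ 3 * (m / N%:R).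
  apply: le_trans (cmod_le_sub _ _) _; apply: le_trans (lerD hA hB) _.
  have W3 : W ^+ 2 <= W ^+ 3 by rewrite ler_weXn2l.
  have d1 : d <= W ^+ 3 by apply: (le_trans Wu); rewrite -[leLHS]expr1 ler_weXn2l.
  have d2 : d ^+ 2 <= W ^+ 3 by apply: le_trans W3; rewrite ler_pXn2r// nnegrE; lra.
  have iN : 0 <= N%:R^-1 :> R by rewrite invr_ge0; lra.
  have miN : N%:R^-1 <= m / N%:R by rewrite ler_peMl.
  have e1 : d * N%:R^-1 <= W ^+ 3 * (m / N%:R) by apply: ler_pM.
  have e2 : d ^+ 2 * (m / N%:R) <= W ^+ 3 * (m / N%:R) by rewrite ler_wpM2r//; apply: le_trans miN.
  by lra.
apply: le_trans (ler_wpM2l (expR_ge0 _) hT) _.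
have W30 : 0 <= 7 * W ^+ 3 by rewrite mulr_ge0// exprn_ge0//; lra.
rewrite mulrCA (_ : 63 * W ^+ 3 = 7 * W ^+ 3 * 9); last by ring.
rewrite -mulrA ler_wpM2l// mulrA; apply: le_trans (root4_inv_sub N0).
by rewrite ler_pM2r// invr_gt0; lra.
Qed.

End zeta_numerator.

(** * The limit of the numerators: existence, growth, link with zeta *)

Section zeta_limit.
Context {R : realType}.
Implicit Types (s z : R[i]) (N : nat).

(** [u + c] is nonincreasing and bounded below, so it converges, and so does [u]; the increments
    telescope to the error bound. *)
Lemma cvg_telescope_bound (u c : nat -> R) :
  (forall n, `|u n.+1 - u n| <= c n - c n.+1) -> c n @[n --> \oo] --> 0 ->
  (u n @[n --> \oo] --> limn u) /\ forall n, `|u n - limn u| <= c n.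
Proof.
move=> uc c0.
have uD n k : `|u (n + k)%N - u n| <= c n - c (n + k)%N.
  elim: k => [|k ih]; first by rewrite addn0 !subrr normr0.
  rewrite addnS -(subrKA (u (n + k)%N)) -(subrKA (c (n + k)%N) (c n)) [leRHS]addrC.
  by apply: le_trans (ler_normD _ _) _; rewrite lerD.
have c_ge0 n : 0 <= c n.
  apply: (ler_cvg_to c0 (cvg_cst (c n))); near=> m.
  have nm : (n <= m)%N by near: m; exact: nbhs_infty_ge.
  by rewrite -subr_ge0; have := uD n (m - n)%N; rewrite subnKC//; exact: le_trans.
have ucvg : cvgn u.
  have -> : u = (fun n => (u n + c n) - c n) by apply/funext => n; rewrite addrK.
  apply: is_cvgB; last by apply/cvg_ex; exists 0.
  apply: nonincreasing_is_cvgn.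
    apply/nonincreasing_seqP => n.
    by have := uc n; rewrite ler_norml => /andP[_]; lra.
  exists (u 0%N - c 0%N) => _ [n _ <-].
  have := uD 0%N n; rewrite add0n ler_norml => /andP[+ _].
  by have := c_ge0 n; lra.
split=> // n; rewrite distrC.
have h : `|u m - u n| @[m --> \oo] --> `|limn u - u n|.
  by apply: cvg_norm; apply: cvgB => //; exact: cvg_cst.
apply: (ler_cvg_to h (cvg_cst (c n))); near=> m.
have nm : (n <= m)%N by near: m; exact: nbhs_infty_ge.
have := uD n (m - n)%N; rewrite subnKC// => /le_trans; apply.
by rewrite gerBl.
Unshelve. all: by end_near. Qed.

Lemma cvg_root4_inv : @root4_inv R n.+1 @[n --> \oo] --> 0.
Proof.
apply/cvgr0Pnorm_le => e e0.
have e4 : 0 < e ^+ 4 by rewrite exprn_gt0.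
move: (@cvg_harmonic R) => /cvgr0Pnorm_le /(_ _ e4).
apply: filterS => n.
rewrite /harmonic/= ger0_norm ?invr_ge0// ger0_norm; last exact: ltW (root4_inv_gt0 _).
move=> h; rewrite -(@ler_pXn2r _ 4) ?nnegrE//; [|exact: ltW (root4_inv_gt0 _)|exact: ltW].
apply: le_trans h; rewrite /root4_inv -expRM_natl.
by rewrite (_ : _ * _ = - ln n.+1%:R); [rewrite expRN lnK// posrE ltr0n|field].
Qed.

(** Shifted by one because the increment bound starts at [N = 1]; by components, to match [zeta]. *)
Definition zeta_lim s : R[i] :=
  Complex (limn (fun N => complex.Re (zeta_num s N.+1))) (limn (fun N => complex.Im (zeta_num s N.+1))).

Lemma zeta_num_cvg s : 1 / 4 <= complex.Re s ->
  [/\ complex.Re (zeta_num s N.+1) @[N --> \oo] --> complex.Re (zeta_lim s),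
      complex.Im (zeta_num s N.+1) @[N --> \oo] --> complex.Im (zeta_lim s) &
      forall N, cmod (zeta_num s N.+1 - zeta_lim s) <= 126 * cmod (s + 2) ^+ 3 * root4_inv N.+1].
Proof.
move=> s4; pose c N := 63 * cmod (s + 2) ^+ 3 * root4_inv N.+1.
have c0 : c N @[N --> \oo] --> 0.
  by rewrite -[X in _ --> X](mulr0 (63 * cmod (s + 2) ^+ 3)); apply: cvgM; [exact: cvg_cst|exact: cvg_root4_inv].
have d N : cmod (zeta_num s N.+2 - zeta_num s N.+1) <= c N - c N.+1.
  by rewrite -mulrBr; exact: zeta_num_succ.
have [r1 r2] : (complex.Re (zeta_num s n.+1) @[n --> \oo] --> complex.Re (zeta_lim s)) /\
    forall n, `|complex.Re (zeta_num s n.+1) - complex.Re (zeta_lim s)| <= c n.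
  apply: cvg_telescope_bound => // n; apply: le_trans (d n).
  by rewrite -raddfB Re_le_cmod.
have [i1 i2] : (complex.Im (zeta_num s n.+1) @[n --> \oo] --> complex.Im (zeta_lim s)) /\
    forall n, `|complex.Im (zeta_num s n.+1) - complex.Im (zeta_lim s)| <= c n.
  apply: cvg_telescope_bound => // n; apply: le_trans (d n).
  by rewrite -raddfB Im_le_cmod.
split=> // N; apply: le_trans (cmod_le_ReIm _) _.
(* Twice [63]: once for the real part and once for the imaginary part. *)
have -> : 126 * cmod (s + 2) ^+ 3 * root4_inv N.+1 = c N + c N by rewrite /c; ring.
by apply: lerD; rewrite raddfB; [exact: r2|exact: i2].
Qed.

Lemma zeta_num1 s : zeta_num s 1 = s.
Proof.
by rewrite /zeta_num big_nat1 !cpowrE// ln1 rmorph0 !mulr0 cexp0 mulr1 subrK.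
Qed.

(** Comparison with the first approximant, which is [s] itself: [126] for the error, and [3] because
    [cmod s <= cmod (s + 2) + 2]. *)
Lemma cmod_zeta_lim_le s : 1 / 4 <= complex.Re s ->
  cmod (zeta_lim s) <= 129 * cmod (s + 2) ^+ 3.
Proof.
move=> s4; have [_ _ /(_ 0%N)] := zeta_num_cvg s4; rewrite zeta_num1 => h.
have W1 : 1 <= cmod (s + 2) by apply: cmodD2_ge1; lra.
have -> : zeta_lim s = (s + 2) - 2 - (s - zeta_lim s) by ring.
apply: le_trans (cmod_le_sub _ _) _.
have := cmod_le_sub (s + 2) 2; rewrite cmod_nat.
have : root4_inv 1 = 1 :> R by rewrite /root4_inv ln1 mul0r oppr0 expR0.
move: h => /[swap] -> h h'.
have W3 : cmod (s + 2) <= cmod (s + 2) ^+ 3 by rewrite -[leLHS]expr1 ler_weXn2l.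
lra.
Qed.

Lemma zeta_lim1 : zeta_lim 1 = 1 :> R[i].
Proof.
have h N : zeta_num 1 N.+1 = 1 :> R[i].
  by rewrite /zeta_num subrr mul0r add0r cpowrE ?ltr0n// mul0r cexp0.
rewrite /zeta_lim; under eq_fun do rewrite h; under [X in Complex _ (limn X)]eq_fun do rewrite h.
by rewrite !lim_cst.
Qed.

Lemma cpowr_real (x X : R) : cpowr x X%:C%C = (x `^ X)%:C%C.
Proof. by rewrite /cpowr/= mul0r cos0 sin0 mulr1 mulr0. Qed.

(** At a real point all terms are real and nonnegative, and the first term of the series alone
    contributes [X - 1 >= 1]. *)
Lemma zeta_lim_ge1 (X : R) : 2 <= X -> 1 <= cmod (zeta_lim (Complex X 0)).
Proof.
move=> X2; have X4 : 1 / 4 <= complex.Re (Complex X 0) by rewrite /=; lra.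
have [r _ _] := zeta_num_cvg X4.
apply: le_trans (Re_le_cmod _); apply: le_trans (ler_norm _).
apply: (ler_cvg_to (cvg_cst (1 : R)) r); near=> N.
have -> : zeta_num (Complex X 0) N.+1 =
    ((X - 1) * \sum_(0 <= n < N.+1) n.+1%:R `^ (- X) + N.+1%:R `^ (1 - X))%:C%C.
  rewrite /zeta_num -/(X%:C%C) -[1]/((1 : R)%:C%C) -!rmorphB -rmorphN.
  rewrite [RHS](rmorphD (real_complex R)) (rmorphM (real_complex R)) (rmorph_sum (real_complex R))/=.
  rewrite -cpowr_real; congr (_ * _ + _).
  by apply: eq_bigr => n _; rewrite -cpowr_real.
rewrite /= big_nat_recl// powR1.
have : 0 <= \sum_(0 <= i < N) i.+2%:R `^ (- X) by apply: sumr_ge0 => i _; exact: powR_ge0.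
have := powR_ge0 (N.+1%:R) (1 - X).
move: (_ `^ _) => p; move: (\sum_(_ <= _ < _) _) => q p0 q0.
have : 0 <= (X - 1) * q by rewrite mulr_ge0//; lra.
lra.
Unshelve. all: by end_near. Qed.

Lemma zetaE s : 1 / 4 <= complex.Re s -> s != 1 -> zeta s = zeta_lim s / (s - 1).
Proof.
move=> s4 s1; have [r i _] := zeta_num_cvg s4.
have e N : zeta_approx s N = zeta_num s N / (s - 1).
  have ? : s - 1 != 0 by rewrite subr_eq0.
  have ? : 1 - s != 0 by rewrite subr_eq0 eq_sym.
  by rewrite /zeta_approx /zeta_num; field; apply/andP.
rewrite /zeta; under eq_fun do rewrite e; under [X in Complex _ (limn X)]eq_fun do rewrite e.
move: (s - 1)^-1 => [a b].
move: r i; case: (zeta_lim s) => x y /= r i.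
have mRe z : complex.Re (z * Complex a b) = complex.Re z * a - complex.Im z * b by case: z.
have mIm z : complex.Im (z * Complex a b) = complex.Re z * b + complex.Im z * a by case: z.
(* The limits in [zeta] run over [N], those in [zeta_lim] over [N.+1]. *)
congr Complex; apply: cvg_lim => //; rewrite -cvg_shiftS/=.
  by under eq_fun do rewrite mRe; apply: cvgB; apply: cvgM => //; exact: cvg_cst.
by under eq_fun do rewrite mIm; apply: cvgD; apply: cvgM => //; exact: cvg_cst.
Qed.

End zeta_limit.

(** * Rational approximation of (s - 1) zeta(s) *)

Section rational_approximation.
Context {R : realType}.
Implicit Types (s z a b : R[i]) (l : R) (N k : nat).

(** In the unit disc errors of the base only add up under powers, so a base error of order [k^-2]
    leaves one of order [k^-1]. *)
Lemma cmod_subX a b k : cmod a <= 1 -> cmod b <= 1 ->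
  cmod (a ^+ k - b ^+ k) <= k%:R * cmod (a - b).
Proof.
move=> a1 b1; elim: k => [|k ih]; first by rewrite subrr cmod0 mul0r.
have -> : a ^+ k.+1 - b ^+ k.+1 = a * (a ^+ k - b ^+ k) + (a - b) * b ^+ k by rewrite !exprS; ring.
apply: le_trans (cmod_le_add _ _) _; rewrite !cmodM cmodX -natr1 mulrDl mul1r lerD//.
  by apply: le_trans ih; rewrite ler_piMl ?cmod_ge0.
by rewrite ler_piMr ?cmod_ge0// exprn_ile1 ?cmod_ge0.
Qed.

Lemma Re_scale l s : complex.Re (l%:C%C * s) = l * complex.Re s.
Proof. by case: s => x y /=; rewrite mul0r subr0. Qed.

Lemma cmod1D_ge1 z : 0 <= complex.Re z -> 1 <= cmod (1 + z).
Proof.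
move=> z0; apply: le_trans (Re_le_cmod _); apply: le_trans (ler_norm _).
by rewrite raddfD/= lerDl.
Qed.

(** Both terms equal [1 - z] up to a quadratic remainder: [3] comes from the exponential, and [1]
    from [z ^+ 2 / (1 + z)]. *)
Lemma cexpN_inv1D z : 0 <= complex.Re z -> cmod (cexp (- z) - (1 + z)^-1) <= 4 * cmod z ^+ 2.
Proof.
move=> z0; have z1 := cmod1D_ge1 z0.
have z1n0 : 1 + z != 0 by rewrite -cmod_gt0; apply: lt_le_trans z1.
have -> : cexp (- z) - (1 + z)^-1 = (cexp (- z) - 1 - (- z)) - z ^+ 2 / (1 + z) by field.
apply: le_trans (cmod_le_sub _ _) _.
rewrite (_ : 4 * _ = 3 * cmod z ^+ 2 + cmod z ^+ 2); last by ring.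
apply: lerD.
  apply: le_trans (cmod_cexp_sub1D _) _; rewrite cmodN.
  rewrite (_ : Num.max _ _ = 1) ?mulr1//; apply/max_idPl.
  by rewrite -[leRHS](@expR0 R) ler_expR raddfN oppr_le0.
by rewrite cmodM cmodV cmodX ler_piMr ?sqr_ge0// invf_le1//; apply: lt_le_trans z1.
Qed.

(** The inverse power, rather than [(1 - l / k * s) ^+ k], because for [0 <= l] its base has modulus
    at most [1] on the whole half-plane, as [cmod_subX] demands. *)
Definition rational_exp l k s : R[i] := (1 + (l / k%:R)%:C%C * s)^-1 ^+ k.

Lemma halfplane_rational_exp l k : 0 <= l -> halfplane_rational (rational_exp l k).
Proof.
move=> l0; set c := (l / k%:R)%:C%C.
have rV : halfplane_rational (fun s => (1 + c * s)^-1).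
  rewrite (_ : (fun s => _) = fun s => (1 + c *: 'X).[s]^-1); last by apply/funext => s; rewrite !hornerE.
  apply: halfplane_rationalV => s s0; rewrite !hornerE -cmod_gt0.
  apply: (@lt_le_trans _ _ 1) => //; apply: cmod1D_ge1.
  by rewrite Re_scale !mulr_ge0// invr_ge0.
rewrite /rational_exp -/c; elim: k {c} (c) rV => [|k ih] c rV.
  rewrite (_ : (fun s => _) = horner 1); first exact: halfplane_rational_horner.
  by apply/funext => s; rewrite expr0 hornerC.
rewrite (_ : (fun s => _) = fun s => (1 + c * s)^-1 * (1 + c * s)^-1 ^+ k).
  by apply: halfplane_rationalM => //; exact: ih.
by apply/funext => s; rewrite exprS.
Qed.

Lemma cexp_rational_exp l k s : 0 <= l -> 0 <= complex.Re s -> (0 < k)%N ->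
  cmod (cexp (- s * l%:C%C) - rational_exp l k s) <= 4 * l ^+ 2 * cmod s ^+ 2 / k%:R.
Proof.
move=> l0 s0 k0; have k0' : 0 < k%:R :> R by rewrite ltr0n.
set z := (l / k%:R)%:C%C * s.
have z0 : 0 <= complex.Re z by rewrite Re_scale !mulr_ge0// invr_ge0.
have -> : cexp (- s * l%:C%C) = cexp (- z) ^+ k.
  rewrite -cexp_mulrn; congr cexp; rewrite -mulr_natl /z mulNr mulrN mulrA; congr (- _).
  rewrite mulrC; congr (_ * _); rewrite -(rmorph_nat (real_complex R)) -rmorphM/=.
  by congr (_%:C%C); field; lra.
apply: le_trans (cmod_subX _ _ _) _.
- by rewrite cmod_cexp -[leRHS](@expR0 R) ler_expR raddfN oppr_le0.
- by rewrite cmodV invf_le1 ?cmod1D_ge1//; apply: lt_le_trans (cmod1D_ge1 z0).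
apply: (@le_trans _ _ (k%:R * (4 * cmod z ^+ 2))); first by rewrite ler_pM2l// cexpN_inv1D.
rewrite cmodM cmod_real ger0_norm ?divr_ge0// exprMn exprMn exprVn.
by rewrite le_eqVlt; apply/orP; left; apply/eqP; field; lra.
Qed.

(** With [W = cmod (s + 2)], each exponential is off by at most [4 * N.+1 ^ 2 * W ^ 2 / k]. The sum
    and the last term each multiply this by at most [N.+1 * W]; the given [k] makes the total
    [W ^ 3 / N.+1]. *)
Definition zeta_rational N s : R[i] :=
  let k := (8 * N.+1 ^ 4)%N in
  (s - 1) * \sum_(0 <= n < N.+1) rational_exp (ln n.+1%:R) k s + N.+1%:R * rational_exp (ln N.+1%:R) k s.

Lemma halfplane_rational_zeta N : halfplane_rational (zeta_rational N).
Proof.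
have ln_ge0 n : 0 <= ln n.+1%:R :> R by rewrite ln_ge0// ler1n.
apply: halfplane_rationalD; apply: halfplane_rationalM.
- rewrite (_ : (fun s => _) = horner ('X - 1)); first exact: halfplane_rational_horner.
  by apply/funext => s; rewrite !hornerE.
- by apply: halfplane_rational_sum => n; exact: halfplane_rational_exp.
- rewrite (_ : (fun s => _) = horner N.+1%:R); first exact: halfplane_rational_horner.
  by apply/funext => s; rewrite -polyC_natr hornerC.
- exact: halfplane_rational_exp.
Qed.

Lemma zeta_num_rational N s : 1 / 4 <= complex.Re s ->
  cmod (zeta_num s N.+1 - zeta_rational N s) <= N.+1%:R^-1 * cmod (s + 2) ^+ 3.
Proof.
move=> s4; have s0 : 0 <= complex.Re s by lra.
rewrite /zeta_rational; set k := (8 * _)%N.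
have N0 : 1 <= N.+1%:R :> R by rewrite ler1n.
have kE : k%:R = 8 * N.+1%:R ^+ 4 :> R by rewrite natrM natrX.
have W1 := cmodD2_ge1 s0; have Wd := cmodB1_le s4; have d0 := cmod_ge0 (s - 1).
have Ws : cmod s <= cmod (s + 2).
  case: (s) s0 => x y /= x0; rewrite !cmodE/= ler_wsqrtr//.
  by rewrite !addr0 lerD2r; nra.
move: Wd W1 Ws; set W := cmod (s + 2) => Wd W1 Ws.
pose q : R := 4 * N.+1%:R ^+ 2 * W ^+ 2 / k%:R.
have k0 : 0 < k%:R :> R by rewrite kE mulr_gt0// exprn_gt0.
have q0 : 0 <= q.
  by rewrite /q !mulr_ge0 ?invr_ge0 ?exprn_ge0//; lra.
have hq n : (n <= N)%N -> cmod (cexp (- s * (ln n.+1%:R)%:C%C) - rational_exp (ln n.+1%:R) k s) <= q.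
  move=> nN; have l0 : 0 <= ln n.+1%:R :> R by rewrite ln_ge0// ler1n.
  apply: le_trans (cexp_rational_exp l0 s0 _) _; first by rewrite -(ltr0n R).
  rewrite /q ler_pM2r ?invr_gt0//; apply: ler_pM; rewrite ?mulr_ge0 ?sqr_ge0 ?cmod_ge0//.
    rewrite ler_pM2l// ler_pXn2r ?nnegrE//.
    apply: (@le_trans _ _ n.+1%:R); last by rewrite ler_nat.
    have : -1 < n%:R :> R by apply: lt_le_trans (_ : 0 <= _).
    by move=> /le_ln1Dx; rewrite nat1r => /le_trans; apply; rewrite ler_nat.
  by rewrite ler_pXn2r ?nnegrE ?cmod_ge0//; lra.
rewrite /zeta_num cpowrE ?ltr0n//.
have -> : cexp ((1 - s) * (ln N.+1%:R)%:C%C) = N.+1%:R * cexp (- s * (ln N.+1%:R)%:C%C).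
  by rewrite -(cexp_ln (isT : 0 < N.+1)%N) -cexpD; congr cexp; ring.
rewrite opprD addrACA -!mulrBr -sumrB.
apply: le_trans (cmod_le_add _ _) _; rewrite !cmodM cmod_nat.
have hS : cmod (\sum_(0 <= n < N.+1) (cpowr n.+1%:R (- s) - rational_exp (ln n.+1%:R) k s)) <= N.+1%:R * q.
  apply: le_trans (cmod_sum _ _ _) _.
  rewrite (_ : N.+1%:R * q = \sum_(0 <= n < N.+1) q); last first.
    by rewrite sumr_const_nat subn0 mulr_natl.
  rewrite big_seq [leRHS]big_seq; apply: ler_sum => n; rewrite mem_index_iota => /andP[_ nN].
  by rewrite cpowrE ?ltr0n//; exact: hq.
apply: (@le_trans _ _ (W * (N.+1%:R * q) + W * (N.+1%:R * q))).
  apply: lerD; first by apply: ler_pM => //; exact: cmod_ge0.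
  apply: (@le_trans _ _ (N.+1%:R * q)); first by rewrite ler_wpM2l ?hq.
  by rewrite ler_peMl// mulr_ge0.
rewrite /q kE le_eqVlt; apply/orP; left; apply/eqP; field.
by rewrite nat1r pnatr_eq0.
Qed.

Lemma zeta_lim_rational_approx : exists (r : nat -> R[i] -> R[i]) (delta : nat -> R),
  [/\ forall N, halfplane_rational (r N),
      delta N @[N --> \oo] --> 0,
      forall N, delta N <= 1 &
      forall N s, 1 / 4 <= complex.Re s ->
        cmod (r N s - zeta_lim s) <= delta N * cmod (s + 2) ^+ 3].
Proof.
pose d N : R := N.+1%:R^-1 + 126 * root4_inv N.+1.
have d0 : d N @[N --> \oo] --> 0.
  rewrite -[X in _ --> X](_ : 0 + 126 * 0 = 0); last by rewrite mulr0 addr0.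
  apply: cvgD; first exact: cvg_harmonic.
  by apply: cvgM; [exact: cvg_cst|exact: cvg_root4_inv].
(* Dropping the first [N0] approximants makes the error factor at most [1] from the start. *)
have [N0 _ hN0] := cvgr_lt _ d0 _ (ltr01 : 0 < (1 : R)).
exists (fun N => zeta_rational (N + N0)), (fun N => d (N + N0)%N); split.
- by move=> N; exact: halfplane_rational_zeta.
- by move: d0; rewrite -(cvg_shiftn N0).
- by move=> N; apply/ltW/hN0 => /=; exact: leq_addl.
move=> N s s4; have [_ _ /(_ (N + N0)%N) h] := zeta_num_cvg s4.
have := zeta_num_rational (N + N0) s4.
set z := zeta_num _ _ in h * => h'.
have -> : zeta_rational (N + N0) s - zeta_lim s = (z - zeta_lim s) - (z - zeta_rational (N + N0) s) by ring.
apply: le_trans (cmod_le_sub _ _) _; apply: le_trans (lerD h h') _.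
by rewrite [leLHS]addrC [leRHS]mulrDl [_ * root4_inv _]mulrAC.
Qed.

End rational_approximation.

(** * From Poisson means of the numerator to the integral of zeta *)

Theorem theorem4 (R : realType) (alpha : R) :
  0 <= alpha -> alpha < 1 / 2 ->
  ((\int[lebesgue_measure]_(t in [set: R])
      (ln (cmod (zeta (Complex (1 / 2 + alpha) t) * Complex (- (1 / 2) + alpha) t))
        / ((1 / 2 - alpha) ^+ 2 + t ^+ 2))%:E = 0)%E
   <->
   ~ (exists s : R[i], [/\ 1 / 2 + alpha < complex.Re s, s <> 1 & zeta s = 0])).
Proof.
move=> alpha0 alpha2; pose x : R := 1 / 2 + alpha; pose a : R := 1 - x.
have x2 : 1 / 2 <= x by rewrite /x; lra.
have x1 : x < 1 by rewrite /x; lra.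
have a0 : 0 < a by rewrite subr_gt0.
have [r [delta [rat_r delta0 delta1 r_F]]] := @zeta_lim_rational_approx R.
have A1 : 1 <= 129 :> R by rewrite ler1n.
pose u t := ln (cmod (zeta_lim (Complex x t))).
(* The second factor of the integrand is [s - 1], which cancels the pole of [zeta]; the kernels
   differ by the constant [pi / a]. *)
have integrandE t :
    ln (cmod (zeta (Complex x t) * Complex (- (1 / 2) + alpha) t)) / ((1 / 2 - alpha) ^+ 2 + t ^+ 2) =
    pi / a * (u t * poisson a t).
  have -> : Complex (- (1 / 2) + alpha) t = Complex x t - 1.
    by apply/eqP; rewrite eq_complex/= subr0 eqxx andbT /x; apply/eqP; field.
  have s1 : Complex x t != 1 by rewrite eq_complex/= negb_and lt_eqF.
  rewrite zetaE//=; last by lra.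
  rewrite divfK ?subr_eq0// /u /poisson (_ : 1 / 2 - alpha = a); last by rewrite /a /x; field.
  have den : 0 < a ^+ 2 + t ^+ 2 by rewrite ltr_pwDl ?exprn_gt0 ?sqr_ge0.
  move: pi (@pi_neq0 R) => p p0; move: (ln _) => L.
  by field; rewrite p0 !gt_eqF.
have integralE : pint a u ->
    (\int[lebesgue_measure]_(t in [set: R])
      (ln (cmod (zeta (Complex x t) * Complex (- (1 / 2) + alpha) t)) / ((1 / 2 - alpha) ^+ 2 + t ^+ 2))%:E
    = (pi / a * pmean a u)%:E)%E.
  move=> iu; under eq_integral do rewrite integrandE EFinM.
  by rewrite integralZl// integral_pmean.
have c0 : 0 < pi / a by rewrite divr_gt0// pi_gt0.
have zeta0 s : x < complex.Re s -> s != 1 -> (zeta s = 0 <-> zeta_lim s = 0).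
  move=> xs s1; have s1' : s - 1 != 0 by rewrite subr_eq0.
  rewrite zetaE//; last by lra.
  split=> [/eqP|->]; last by rewrite mul0r.
  by rewrite mulf_eq0 invr_eq0 (negPf s1') orbF => /eqP.
split.
  move=> int0 [s [xs /eqP s1 /(zeta0 s xs s1) Fs]].
  have [iu mu] := pmean_ln_zero_gt0 rat_r delta0 r_F A1 delta1 (@cmod_zeta_lim_le R) (@zeta_lim1 R)
    x2 x1 xs Fs.
  by move: int0; rewrite integralE// => -[] /eqP; rewrite gt_eqF// mulr_gt0.
move=> nozero; have nF s : x < complex.Re s -> zeta_lim s != 0.
  (* The hypothesis excludes [s = 1], where the numerator takes the value [1]. *)
  move=> xs; have [->|s1] := eqVneq s 1; first by rewrite zeta_lim1 oner_neq0.
  by apply/eqP => /(zeta0 s xs s1) zs; apply: nozero; exists s; split=> //; apply/eqP.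
have [iu mu] := pmean_ln_nonvanishing rat_r delta0 r_F A1 delta1 (@cmod_zeta_lim_le R) (@zeta_lim1 R)
  (@zeta_lim_ge1 R) x2 x1 nF.
by rewrite integralE// mu mulr0.
Qed.
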